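(* For infinitely many values of $\xi\in(0,\tfrac12)$, the Cantor measure $\sigma(\xi)$ on $\mathbb{T}$ belongs to the Rajchman class $\mathcal{R}$, and the corresponding Cantor set $E(\xi)=\operatorname{supp}\sigma(\xi)$ is a peak set for $W^+$. Consequently, there exist modulus support points and non-trivial modulus support functionals for the set $S_0\subset c_0$.
   Context: All spaces are complex. $\mathbb{D}=\{z\in\mathbb{C}:|z|<1\}$, $\mathbb{T}=\{z\in\mathbb{C}:|z|=1\}$, $\overline{\mathbb{D}}=\mathbb{D}\cup\mathbb{T}$. Duality: $c_0=c_0(\mathbb{Z}_+)$ with the sup norm, and $c_0^*$ is identified with $\ell^1=\ell^1(\mathbb{Z}_+)$ via the bilinear coupling $\langle a,x\rangle=\sum_{n\ge0}x_na_n$, $x\in c_0$, $a\in\ell^1$. Wiener algebra: $W^+$ is the algebra of functions $f_a(z)=\sum_{n\ge0}a_nz^n$ with $a=(a_n)_{n\ge0}\in\ell^1$ (analytic in $\mathbb{D}$, continuous on $\overline{\mathbb{D}}$). A functional $a\in\ell^1$ is called non-trivial if it is not of the form $(\alpha,0,0,\ldots)$ with $\alpha\in\mathbb{C}$, i.e. $f_a$ is non-constant. The set $S_0$: for $\lambda\in\mathbb{D}$ let $\varphi_\lambda=(\lambda^j)_{j\ge0}\in c_0$ (with $0^0=1$). $S_0$ is the closed convex hull in $c_0$ of $\{\varphi_\lambda:\lambda\in\mathbb{D}\}$. Modulus support functionals: for a non-empty bounded closed convex subset $C$ of a Banach space $X$, a non-zero functional $h\in X^*$ is a modulus support functional for $C$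 if there is $y\in C$ with $|h(y)|=\sup_{x\in C}|h(x)|$; such a point $y$ is called a modulus support point of $C$ (corresponding to $h$). Class $\mathcal{R}$: for a finite complex Borel measure $\mu$ on $\mathbb{T}$, $\widehat\mu(k)=\int_{\mathbb{T}}t^{-k}\,\mu(dt)$, $k\in\mathbb{Z}$. The measure $\mu$ belongs to $\mathcal{R}$ (Rajchman class) if $\lim_{n\to+\infty}\widehat\mu(-n)=0$. Peak sets: a closed set $E\subset\mathbb{T}$ of Lebesgue measure zero is a peak set for $W^+$ if there is a function $g_E\in W^+$ with $g_E(z)=1$ for $z\in E$ and $|g_E(z)|<1$ for $z\in\overline{\mathbb{D}}\setminus E$. Cantor sets and measures: let $0<\xi<\frac12$. Put $E_0(\xi)=[0,1]$; $E_{n}(\xi)$ is obtained from $E_{n-1}(\xi)$, a disjoint union of $2^{n-1}$ closed intervals of length $\xi^{n-1}$, by removing from each of these intervals the concentric open interval of relative length $1-2\xi$. So $E_n(\xi)$ is a disjoint union of $2^n$ closed intervals of length $\xi^n$. The Cantor set of constant ratio $\xi$ is $E(\xi)=\bigcap_{n\ge1}E_n(\xi)$. Let $\sigma_n(\xi)$ be the normalized (to a probability measure) restriction of Lebesgue measure to $E_n(\xi)$; the Cantor measure of ratio $\xi$ is the weak-$*$ limit $\sigma(\xi)=\lim_{n\to\infty}\sigma_n(\xi)$ (which exists), and $\operatorname{supp}\sigma(\xi)=E(\xi)$. Both $\sigma(\xi)$ and $E(\xi)$ are carried over to $\mathbb{T}$ by the map $t\mapsto e^{2\pi i t}$ (push-forward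 measure and image set), and the same symbols denote the resulting objects on $\mathbb{T}$. *)

(* Defs.v *)
From HB Require Import structures.
From mathcomp Require Import all_boot all_order all_algebra.
From mathcomp Require Import complex.
From mathcomp Require Import all_classical all_reals all_analysis.

Set Implicit Arguments.
Unset Strict Implicit.
Unset Printing Implicit Defensive.

Import Order.TTheory GRing.Theory Num.Theory.
Import numFieldNormedType.Exports.

Local Open Scope classical_set_scope.
Local Open Scope ring_scope.
Local Open Scope complex_scope.

(* R[i] has no topology of its own in the libraries; it receives the one given
   by its modulus. *)
HB.instance Definition _ (R : realType) :=
  NormedModule.copy (complex R) (complex R)^o.

(* Stated for an abstract field: unification on the concrete R[i] is slow. *)
Lemma cvg_lincomb0 (K : numFieldType) (k : K) (x y : nat -> K) :
  x @ \oo --> (0 : K) -> y @ \oo --> (0 : K) ->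
  (k *: x n + y n) @[n --> \oo] --> (0 : K).
Proof.
move=> x0 y0; have E : k *: (0 : K) + 0 = 0 by rewrite scaler0 addr0.
by rewrite -[X in _ --> X]E; by apply: cvgD => //; apply: cvgZr.
Qed.

Lemma cvg_norm_bounded (K : numFieldType) (x : nat -> K) :
  x @ \oo --> (0 : K) -> exists M : K, forall n, `|x n| <= M.
Proof.
move=> x0; have xb : bounded_fun x.
  by apply: cvg_seq_bounded; apply/cvg_ex; exists 0.
have FF : ProperFilter (globally [set: nat]).
  exact: (@globally_properfilter _ _ 0%N).
have [M xM] := (@ex_bound _ _ _ x _ FF).1 xb.
by exists M => n; exact: xM.
Qed.

Section c0.
Variable R : realType.
Local Notation C := R[i].

Definition c0_pred : {pred nat -> C} := fun x => `[< x @ \oo --> (0 : C) >].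

Lemma c0_predP (x : nat -> C) : reflect (x @ \oo --> (0 : C)) (x \in c0_pred).
Proof. exact: asboolP. Qed.

Fact c0_submod_closed : submod_closed c0_pred.
Proof.
split; first by apply/c0_predP; exact: cvg_cst.
move=> k x y /c0_predP x0 /c0_predP y0; apply/c0_predP.
exact: cvg_lincomb0.
Qed.

HB.instance Definition _ := GRing.isSubmodClosed.Build C (nat -> C) c0_pred
  c0_submod_closed.

Record c0 := C0 { c0_fun :> nat -> C; _ : c0_fun \in c0_pred }.

HB.instance Definition _ := [isSub for c0_fun].
HB.instance Definition _ := [Choice of c0 by <:].
HB.instance Definition _ := [SubChoice_isSubLmodule of c0 by <:].

Lemma c0_cvg (x : c0) : x @ \oo --> (0 : C).
Proof. by apply/c0_predP; exact: valP. Qed.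

Definition c0_norm (x : c0) : C := (sup (range (fun n => complex.Re `|x n|)))%:C.

Lemma has_sup_c0_norm (x : c0) : has_sup (range (fun n => complex.Re `|x n|)).
Proof.
split; first by exists (complex.Re `|x 0%N|), 0%N.
have [M xM] := cvg_norm_bounded (c0_cvg x).
by exists (complex.Re M) => _ [n _ <-]; have := xM n; rewrite lecE => /andP[].
Qed.

Lemma normc_Re (z : C) : (complex.Re `|z|)%:C = `|z|.
Proof. by rewrite RRe_real// normr_real. Qed.

Lemma c0_norm_ge (x : c0) n : `|x n| <= c0_norm x.
Proof.
rewrite -normc_Re lecR; apply: sup_ubound; last by exists n.
by have [] := has_sup_c0_norm x.
Qed.

Lemma c0_norm_le (x : c0) (M : C) : (forall n, `|x n| <= M) -> c0_norm x <= M.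
Proof.
move=> xM; have MR : (complex.Re M)%:C = M.
  by apply: RRe_real; rewrite realE (le_trans _ (xM 0%N)).
rewrite -MR lecR; apply: sup_le_ub; first by exists (complex.Re `|x 0%N|), 0%N.
by move=> _ [n _ <-]; rewrite -lecR normc_Re MR.
Qed.

Lemma c0_normD (x y : c0) : c0_norm (x + y) <= c0_norm x + c0_norm y.
Proof.
apply: c0_norm_le => n; apply: (le_trans (ler_normD (x n) (y n))).
by apply: lerD; exact: c0_norm_ge.
Qed.

Lemma c0_normZ (k : C) (x : c0) : c0_norm (k *: x) = `|k| * c0_norm x.
Proof.
have le k' x' : c0_norm (k' *: x') <= `|k'| * c0_norm x'.
  apply: c0_norm_le => n; rewrite [X in `|X|](_ : _ = k' * x' n)//.
  by rewrite normrM ler_wpM2l// c0_norm_ge.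
apply/eqP; rewrite eq_le le/=; have [->|k0] := eqVneq k 0.
  rewrite normr0 mul0r scale0r; apply: le_trans (c0_norm_ge _ 0%N).
  exact: normr_ge0.
rewrite -ler_pdivlMl ?normr_gt0// -normfV.
by apply: le_trans (le _ _); rewrite scalerA mulVf// scale1r.
Qed.

Lemma c0_norm0_eq0 (x : c0) : c0_norm x = 0 -> x = 0.
Proof.
move=> x0; apply/val_inj/funext => n; apply/eqP.
by rewrite -normr_le0 -x0 c0_norm_ge.
Qed.

HB.instance Definition _ :=
  Lmodule_isNormed.Build C c0 c0_normD c0_normZ c0_norm0_eq0.

End c0.

Section duality.
Variable R : realType.
Local Notation C := R[i].

Definition ell1 : set (nat -> C) :=
  [set a | cvgn (series (fun n => `|a n|) : nat -> C)].

Definition coupling (a : nat -> C) (x : c0 R) : C :=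
  limn (series (fun n => x n * a n)).

Definition nontrivial (a : nat -> C) : Prop :=
  ~ exists alpha : C, a = (fun n => if n == 0%N then alpha else 0).

Definition wiener_fun (a : nat -> C) (z : C) : C :=
  limn (series (fun n => a n * z ^+ n)).

End duality.

Section modulus_support.
Variables (R : realType) (V : normedModType R[i]).

Definition modulus_support_point (S : set V) (h : V -> R[i]) (y : V) : Prop :=
  S y /\ supremums [set `|h x| | x in S] `|h y|.

Definition modulus_support_functional (S : set V) (h : V -> R[i]) : Prop :=
  [/\ scalar h, continuous h, exists x, h x != 0
    & exists y, modulus_support_point S h y].

(* The scalars in [0, 1] of convex_set are complex, but an element of R[i]
   lying between 0 and 1 is real. *)
Definition closed_convex_hull (A : set V) : set V :=
  smallest [set B : set V | closed B /\ convex_set B] A.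

End modulus_support.

Section circle.
Variable R : realType.
Local Notation C := R[i].

Definition circle : set C := [set z | `|z| = 1].

(* The complex plane with its Borel sigma-algebra; a Borel measure on the circle
   is a measure on borelC vanishing outside circle. *)
Definition borelC := g_sigma_algebraType (@open C).

(* t |-> e^(2 pi i t) *)
Definition circle_exp (t : measurableTypeR R) : borelC :=
  cos (2 * pi * t) +i* sin (2 * pi * t).

Lemma continuous_Complex (f g : R -> R) : continuous f -> continuous g ->
  continuous ((fun t => f t +i* g t) : R -> C).
Proof.
move=> cf cg t; apply/cvgrPdist_lt => e e0.
have eR : e = (complex.Re e)%:C by rewrite RRe_real// realE ltW.
have e20 : 0 < complex.Re e / 2 by rewrite divr_gt0// -ltcR -eR.
have /cvgrPdist_lt/(_ _ e20) ft := cf t.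
have /cvgrPdist_lt/(_ _ e20) gt := cg t.
near=> s.
have -> : f t +i* g t - (f s +i* g s) = (f t - f s)%:C + (g t - g s) *i.
  by apply/eqP; rewrite eq_complex /= addr0 add0r !eqxx.
apply: le_lt_trans (ler_normD _ _) _.
rewrite !normc_def /= !(expr0n, addr0, add0r) /= !sqrtr_sqr -rmorphD eR ltcR.
by rewrite [ltRHS]splitr; apply: ltrD; near: s.
Unshelve. all: by end_near. Qed.

Lemma measurable_circle_exp : measurable_fun setT circle_exp.
Proof.
apply: (@measurability _ _ (measurableTypeR R) borelC _ _ (@open C)) => //.
move=> _ [U oU <-]; rewrite setTI.
apply: measurable_realfun.open_measurable.
move: U oU; apply/(@continuousP R C circle_exp).
apply: continuous_Complex => t.
- apply: continuous_comp; last exact: continuous_cos.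
  exact: mulrl_continuous.
- apply: continuous_comp; last exact: continuous_sin.
  exact: mulrl_continuous.
Qed.

HB.instance Definition _ :=
  isMeasurableFun.Build _ _ _ _ circle_exp measurable_circle_exp.

End circle.
Arguments circle R : clear implicits.
Arguments circle_exp R : clear implicits.

Section rajchman.
Variable R : realType.
Local Notation C := R[i].

Definition fourier_coef (mu : {finite_measure set borelC R -> \bar R})
    (k : int) : C :=
  (\int[mu]_(z in circle R) complex.Re ((z : C) ^ (- k))) +i*
  (\int[mu]_(z in circle R) complex.Im ((z : C) ^ (- k))).

Definition rajchman (mu : {finite_measure set borelC R -> \bar R}) : Prop :=
  mu (~` circle R) = 0%E /\
  fourier_coef mu (- n%:Z) @[n --> \oo] --> (0 : C).

Definition measure_support (mu : {measure set borelC R -> \bar R}) : set C :=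
  [set z | forall U : set C, open U -> U z -> (0 < mu U)%E].

(* Lebesgue measure on the circle is the image under circle_exp of Lebesgue
   measure on [0, 1[. *)
Definition circle_lebesgue_null (E : set C) : Prop :=
  lebesgue_measure (`[0, 1[ `&` circle_exp R @^-1` E) = 0%E.

Definition peak_set (E : set C) : Prop :=
  [/\ E `<=` circle R, closed E, circle_lebesgue_null E &
    exists a : nat -> C,
      [/\ ell1 a, forall z, E z -> wiener_fun a z = 1
        & forall z, `|z| <= 1 -> ~ E z -> `|wiener_fun a z| < 1]].

End rajchman.

Section cantor.
Variable R : realType.

(* What remains of [I.1, I.2] after removing the concentric open interval of
   relative length 1 - 2 xi. *)
Definition remove_middle (xi : R) (I : R * R) : seq (R * R) :=
  [:: (I.1, I.1 + xi * (I.2 - I.1)); (I.2 - xi * (I.2 - I.1), I.2)].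

Definition cantor_intervals (xi : R) (n : nat) : seq (R * R) :=
  iter n (fun s => flatten (map (remove_middle xi) s)) [:: (0, 1)].

Definition cantor_approx (xi : R) (n : nat) : set (measurableTypeR R) :=
  \big[setU/set0]_(I <- cantor_intervals xi n) `[I.1, I.2]%classic.

Definition cantor_set (xi : R) : set R := \bigcap_n cantor_approx xi n.+1.

Lemma measurable_cantor_approx (xi : R) (n : nat) :
  measurable (cantor_approx xi n).
Proof. by apply: bigsetU_measurable => I _; exact: measurable_itv. Qed.

(* The second argument of mnormalize is only its value on null or infinite
   measures: for 0 < xi < 1/2 the set cantor_approx xi n has measure
   (2 xi)^n > 0. *)
Definition cantor_measure_approx (xi : R) (n : nat) :
    probability (measurableTypeR R) R :=
  mnormalize (mrestr lebesgue_measure (measurable_cantor_approx xi n))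
    (dirac (0 : measurableTypeR R)).

(* Weak-* convergence in the dual of C(K). *)
Definition weak_star_cvg (K : set R)
    (sigma_ : nat -> probability (measurableTypeR R) R)
    (sigma : probability (measurableTypeR R) R) : Prop :=
  forall f : R -> R, {within K, continuous f} ->
    (\int[sigma_ n]_(x in K) f x)%R @[n --> \oo] -->
    (\int[sigma]_(x in K) f x)%R.

Definition is_cantor_measure (xi : R)
    (sigma : probability (measurableTypeR R) R) : Prop :=
  weak_star_cvg `[0, 1] (cantor_measure_approx xi) sigma.

Definition cantor_circle_set (xi : R) : set R[i] :=
  circle_exp R @` cantor_set xi.

Definition circle_image (sigma : probability (measurableTypeR R) R) :
    probability (borelC R) R :=
  distribution sigma (circle_exp R).

End cantor.

Section S0.
Variable R : realType.
Local Notation C := R[i].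

Definition S0 : set (c0 R) :=
  closed_convex_hull
    [set x : c0 R | exists2 lambda : C, `|lambda| < 1
                    & forall j, x j = lambda ^+ j].

End S0.
Arguments S0 R : clear implicits.

(* Main.v *)
From HB Require Import structures.
Require Import Defs.
From mathcomp Require Import all_boot all_order all_algebra.
From mathcomp Require Import complex.
From mathcomp Require Import all_classical all_reals all_analysis.
From mathcomp Require Import measurable_realfun.
From mathcomp Require Import ring lra zify.

Import Order.TTheory GRing.Theory Num.Theory.
Import numFieldNormedType.Exports.

Local Open Scope classical_set_scope.
Local Open Scope ring_scope.
Local Open Scope complex_scope.

(** Take xi = 2 / q with q odd and q >= 512.  Two things have to be checked:
    the Cantor measure is a Rajchman measure, and the Cantor set is a peak set.

    Rajchman.  The transform of sigma is the infinite product, up to unimodular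
    factors, of the numbers cos (pi u (1 - xi) xi ^ k), which follows from the
    self-similarity of the intervals ([cantor_intervals_split], [cabs_cantor_ftS]).
    Since 1 / xi = q / 2 is a rational number that is not an integer, the
    sequence v (q / 2) ^ i cannot stay close to the integers for long: if it did,
    the nearest integers would satisfy 2 a_(i+1) = q a_i, so a_0 would be
    divisible by a large power of 2 ([rational_powers_far]).  Hence the number of
    factors bounded away from 1 tends to infinity with u ([cantor_ft_decay]).
    This is the elementary case of the theorem of Salem on Pisot numbers.

    Peak set.  Let t run over the images on the circle of the 2 ^ k left
    endpoints of generation k, put
      G_N (z) = sum_(k <= N) 4 ^ (-k) sum_t 1 / (1 - (1 - xi ^ k) conj(t) z),
    and F_N = 1 / (1 + G_N).  Every summand of G_N has positive real part in the
    closed disc, and the real part of G_N is at least a multiple of (4 xi) ^ (-j)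
    at distance about xi ^ j from the Cantor set, so F_N tends to 0 exactly on
    that set.  Crude bounds give |F_N'| <= C 8 ^ j at distance about xi ^ j
    ([cabs_copeak']).  The part of the circle at that distance has measure
    O((2 xi) ^ j), so for small xi the derivatives are bounded in L^2 uniformly
    in N ([copeak'_mean]); by Parseval and Cauchy-Schwarz the Taylor coefficients
    of the limit F are absolutely summable.  As F lies in the disc |w|^2 <= Re w,
    the function 1 - F peaks on the Cantor set ([peak_fun]).

    To stay with finite sums, Parseval is used for polynomials on roots of unity,
    where the measure estimate also comes from Parseval applied to the kernels
    ([mean_den]).  The F_N are replaced by polynomials close to them together
    with their derivatives; the class of functions which admit such polynomials
    is closed under inversion by a Neumann series ([C1poly_inv]).

    The measure sigma is the image of Lebesgue measure on [0, 1[ under the map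
    which replaces binary digits by Cantor digits; integrals against sigma and
    against the normalised Lebesgue measures of the approximating sets are both
    close to the mean of the values at the left endpoints ([left_mean_cvg],
    [approx_left_mean]).

    Support functional.  The moments of sigma form a point y of c0 because sigma
    is Rajchman, and y lies in S0 as a limit of averages of geometric sequences
    ([moments_S0]).  If a is the coefficient sequence of the peak function, then
    the value at y is the integral of the peak function against sigma, that is 1
    ([coupling_moments]), while it is at most 1 in modulus on S0 ([S0_le1]). *)

Set Implicit Arguments.
Unset Strict Implicit.
Unset Printing Implicit Defensive.

(** * Parseval on the roots of unity *)

Lemma norm_prim_root (K : numDomainType) M (w : K) :
  M.-primitive_root w -> `|w| = 1.
Proof.
move=> wM; have M0 := prim_order_gt0 wM.
apply/eqP; rewrite -(@pexpr_eq1 _ _ M)//.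
by rewrite -normrX prim_expr_order// normr1.
Qed.

(** Orthogonality of the characters of the cyclic group of order M; the size
    condition on p excludes aliasing. *)
Lemma parseval (K : numClosedFieldType) (M : nat) (w : K) (p : {poly K}) :
  M.-primitive_root w -> (size p <= M)%N ->
  \sum_(i < M) `|p.[w ^+ i]| ^+ 2 = M%:R * \sum_(n < M) `|p`_n| ^+ 2.
Proof.
move=> wM sp; have M0 := prim_order_gt0 wM.
have w1 := norm_prim_root wM.
have w0 : w != 0 by rewrite -normr_eq0 w1 oner_neq0.
have cw : (w^*)%R = w^-1.
  by apply: (mulfI w0); rewrite -normCK w1 expr1n divff.
have orth (n m : 'I_M) : \sum_(i < M) (w ^+ i) ^+ n * ((w ^+ i)^*)%R ^+ m =
    if n == m then M%:R else 0.
  have -> : \sum_(i < M) (w ^+ i) ^+ n * ((w ^+ i)^*)%R ^+ m =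
      \sum_(i < M) (w ^+ n / w ^+ m) ^+ i.
    apply: eq_bigr => i _; rewrite rmorphXn /= cw -!exprM mulnC exprM.
    by rewrite [(i * m)%N]mulnC exprM -exprMn exprVn.
  case: eqVneq => [->|nm].
    rewrite divff ?expf_neq0//; under eq_bigr do rewrite expr1n.
    by rewrite sumr_const card_ord.
  have x1 : w ^+ n / w ^+ m - 1 != 0.
    apply: contra nm; rewrite subr_eq0 => /eqP E.
    have /eqP : w ^+ n = w ^+ m by rewrite -[RHS]mul1r -E mulfVK// expf_neq0.
    by rewrite (eq_prim_root_expr wM) !modn_small.
  apply: (mulfI x1); rewrite mulr0 -subrX1 exprMn exprVn -!exprM.
  by rewrite ![(_ * M)%N]mulnC !exprM (prim_expr_order wM) !expr1n divff ?oner_neq0// subrr.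
transitivity (\sum_(n < M) \sum_(m < M) (p`_n * ((p`_m)^*)%R *
     \sum_(i < M) (w ^+ i) ^+ n * ((w ^+ i)^*)%R ^+ m)).
  transitivity (\sum_(i < M) \sum_(n < M) \sum_(m < M) p`_n * ((p`_m)^*)%R *
      ((w ^+ i) ^+ n * ((w ^+ i)^*)%R ^+ m)).
    apply: eq_bigr => i _; rewrite normCK (horner_coef_wide _ sp) rmorph_sum /=.
    rewrite mulr_suml; apply: eq_bigr => n _; rewrite mulr_sumr.
    by apply: eq_bigr => m _; rewrite rmorphM rmorphXn /= mulrACA.
  rewrite exchange_big; apply: eq_bigr => n _; rewrite exchange_big /=.
  by apply: eq_bigr => m _; rewrite mulr_sumr.
rewrite mulr_sumr; apply: eq_bigr => n _.
rewrite (bigD1 n) //= orth eqxx big1 ?addr0 => [|m mn].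
  by rewrite -normCK mulrC.
by rewrite orth eq_sym (negbTE mn) mulr0.
Qed.

(** * Real-valued modulus and convergence in the complex plane *)

Section cabs.
Variable R : realType.
Local Notation C := R[i].
Implicit Types z : C.

(** The modulus with values in R, where the order is total, rather than in
    R[i]. *)
Definition cabs z : R := complex.Re `|z|.

Lemma cabsE z : `|z| = (cabs z)%:C.
Proof. by rewrite normc_Re. Qed.

Lemma le_cabs z z' : (`|z| <= `|z'|) = (cabs z <= cabs z').
Proof. by rewrite !cabsE lecR. Qed.

Lemma cabs_ge0 z : 0 <= cabs z.
Proof. by rewrite -lecR -cabsE normr_ge0. Qed.

Lemma cabsM z z' : cabs (z * z') = cabs z * cabs z'.
Proof. by apply/complexI; rewrite -cabsE normrM !cabsE rmorphM. Qed.

Lemma cabsD z z' : cabs (z + z') <= cabs z + cabs z'.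
Proof. by rewrite -lecR rmorphD /= -!cabsE ler_normD. Qed.

Lemma cabsN z : cabs (- z) = cabs z.
Proof. by rewrite /cabs normrN. Qed.

Lemma cabsB z z' : cabs (z - z') = cabs (z' - z).
Proof. by rewrite /cabs distrC. Qed.

Lemma cabs_leB z z' : cabs (z - z') <= cabs z + cabs z'.
Proof. by rewrite -(cabsN z') cabsD. Qed.

Lemma cabs_distD z1 z2 z3 : cabs (z1 - z3) <= cabs (z1 - z2) + cabs (z2 - z3).
Proof. by rewrite -[in leLHS](subrK z2 z1) -addrA cabsD. Qed.

Lemma cabs0 : cabs 0 = 0.
Proof. by rewrite /cabs normr0. Qed.

Lemma cabs1 : cabs 1 = 1.
Proof. by rewrite /cabs normr1. Qed.

Lemma cabsV z : cabs z^-1 = (cabs z)^-1.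
Proof. by apply/complexI; rewrite -cabsE normfV cabsE fmorphV. Qed.

Lemma cabsX z n : cabs (z ^+ n) = cabs z ^+ n.
Proof. by apply/complexI; rewrite -cabsE normrX cabsE rmorphXn. Qed.

Lemma cabs_sqr z : cabs z ^+ 2 = complex.Re z ^+ 2 + complex.Im z ^+ 2.
Proof.
by apply/complexI; rewrite rmorphXn /= -cabsE -add_Re2_Im2.
Qed.

Lemma cabs_real (x : R) : cabs x%:C = `|x|.
Proof. by rewrite /cabs normc_def /= expr0n addr0 sqrtr_sqr. Qed.

Lemma cabs_eq0 z : (cabs z == 0) = (z == 0).
Proof. by rewrite -[RHS]normr_eq0 cabsE -(inj_eq (@complexI R)). Qed.

Lemma cabs_gt0 z : (0 < cabs z) = (z != 0).
Proof. by rewrite lt_def cabs_ge0 andbT cabs_eq0. Qed.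

Lemma cabs_sum (I : Type) (r : seq I) (P : pred I) (F : I -> C) :
  cabs (\sum_(i <- r | P i) F i) <= \sum_(i <- r | P i) cabs (F i).
Proof.
elim/big_rec2 : _ => [|i y x _ xy]; first by rewrite cabs0.
by apply: le_trans (cabsD _ _) _; rewrite lerD2l.
Qed.

Lemma Re_le_cabs z : `|complex.Re z| <= cabs z.
Proof.
by rewrite -(@ler_pXn2r _ 2) ?nnegrE ?cabs_ge0 ?normr_ge0// real_normK ?num_real// cabs_sqr lerDl sqr_ge0.
Qed.

Lemma Im_le_cabs z : `|complex.Im z| <= cabs z.
Proof.
by rewrite -(@ler_pXn2r _ 2) ?nnegrE ?cabs_ge0 ?normr_ge0// real_normK ?num_real// cabs_sqr lerDr sqr_ge0.
Qed.

Lemma cabs_le_ReIm z : cabs z <= `|complex.Re z| + `|complex.Im z|.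
Proof.
rewrite -(@ler_pXn2r _ 2) ?nnegrE ?cabs_ge0 ?addr_ge0//.
rewrite cabs_sqr -[complex.Re z ^+ 2]real_normK ?num_real//.
rewrite -[complex.Im z ^+ 2]real_normK ?num_real//.
have := normr_ge0 (complex.Re z); have := normr_ge0 (complex.Im z); nra.
Qed.

Lemma cReD z z' : complex.Re (z + z') = complex.Re z + complex.Re z'.
Proof. by case: z; case: z'. Qed.
Lemma cReN z : complex.Re (- z) = - complex.Re z.
Proof. by case: z. Qed.
Lemma cImD z z' : complex.Im (z + z') = complex.Im z + complex.Im z'.
Proof. by case: z; case: z'. Qed.
Lemma cImN z : complex.Im (- z) = - complex.Im z.
Proof. by case: z. Qed.

Lemma cRe_realM (x : R) z : complex.Re (x%:C * z) = x * complex.Re z.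
Proof. by case: z => a b /=; rewrite mul0r subr0. Qed.

Lemma cRe_sum (I : Type) (r : seq I) (P : pred I) (F : I -> C) :
  complex.Re (\sum_(i <- r | P i) F i) = \sum_(i <- r | P i) complex.Re (F i).
Proof. by elim/big_rec2 : _ => [//|i y x _ <-]; rewrite cReD. Qed.

Lemma cReV z : complex.Re z^-1 = complex.Re z / cabs z ^+ 2.
Proof. by rewrite cabs_sqr; case: z. Qed.

Lemma ccvgP (u : nat -> C) l :
  (u @ \oo --> l) <-> (forall e : R, 0 < e -> exists N, forall n, (N <= n)%N -> cabs (u n - l) < e).
Proof.
split=> [/cvgrPdist_lt ul e e0|ul].
  have e0' : 0 < e%:C by rewrite ltcR.
  have [N _ H] := ul _ e0'.
  exists N => n Nn; have := H n Nn; rewrite /= cabsE ltcR cabsB; exact.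
apply/cvgrPdist_lt => e e0.
have eR : e = (complex.Re e)%:C by rewrite RRe_real// realE ltW.
have [|N H] := ul (complex.Re e); first by rewrite -ltcR -eR.
by exists N => // n /= Nn; rewrite cabsE eR ltcR cabsB H.
Qed.

Lemma rcvgP (u : nat -> R) l :
  (u @ \oo --> l) <-> (forall e : R, 0 < e -> exists N, forall n, (N <= n)%N -> `|u n - l| < e).
Proof.
split=> [/cvgrPdist_lt ul e e0|ul].
  have [N _ H] := ul _ e0.
  by exists N => n Nn; rewrite distrC; apply: H.
apply/cvgrPdist_lt => e e0.
have [N H] := ul _ e0.
by exists N => // n /= Nn; rewrite distrC H.
Qed.

Lemma ccvgReIm (u : nat -> C) l :
  (u @ \oo --> l) <-> ((fun n => complex.Re (u n)) @ \oo --> complex.Re l) /\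
  ((fun n => complex.Im (u n)) @ \oo --> complex.Im l).
Proof.
split=> [/ccvgP ul|[/rcvgP ur /rcvgP ui]].
  split; apply/rcvgP => e /ul[N H]; exists N => n /H; apply: le_lt_trans.
    by rewrite -cReN -cReD Re_le_cabs.
  by rewrite -cImN -cImD Im_le_cabs.
apply/ccvgP => e e0; have e20 : 0 < e / 2 by rewrite divr_gt0.
have [N HN] := ur _ e20; have [N' HN'] := ui _ e20.
exists (maxn N N') => n; rewrite geq_max => /andP[/HN h1 /HN' h2].
apply: le_lt_trans (cabs_le_ReIm _) _; rewrite cReD cImD cReN cImN.
by rewrite [e]splitr ltrD.
Qed.

End cabs.

(** * Functions uniformly close to polynomials together with their derivative *)

Lemma expr_lt_eps (R : realType) (r e : R) : 0 <= r < 1 -> 0 < e ->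
  exists N, forall n, (N <= n)%N -> r ^+ n < e.
Proof.
move=> /andP[r0 r1] e0; have : (r ^+ n) @[n --> \oo] --> (0 : R).
  by apply: cvg_expr; rewrite ger0_norm.
move=> /rcvgP/(_ _ e0)[N H]; exists N => n /H; rewrite subr0; apply: le_lt_trans.
exact: ler_norm.
Qed.

(** Bernoulli gives K r ^ K = O(1), so K r ^ (2 K) tends to 0 with r ^ K; this
    is why the exponent is even. *)
Lemma natmul_expr_lt_eps (R : realType) (r e : R) : 0 <= r < 1 -> 0 < e ->
  exists K, (0 < K)%N /\ (K.*2.*2.+1)%:R * r ^+ K.*2 < e.
Proof.
move=> /andP[r0 r1] e0.
have [->|rn0] := eqVneq r 0.
  by exists 1%N; rewrite expr0n /= mulr0.
have rp : 0 < r by rewrite lt_def rn0.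
pose x := r^-1 - 1; have x0 : 0 < x by rewrite subr_gt0 invf_gt1.
have [||N HN] := @expr_lt_eps R r (e / (4 / x + 1)) _ _; first by rewrite r0.
  by rewrite divr_gt0// addr_gt0// divr_gt0.
exists N.+1; split => //; have := HN _ (leqnSn N); set K := N.+1 => HK.
have bern : K%:R * x <= (r ^+ K)^-1.
  have : 1 + x *+ K <= (1 + x) ^+ K.
    by rewrite mulrC mulr_natl in HK *; elim: K {HK} => [|K IH]; [rewrite expr0 mulr0n addr0|
      rewrite exprS mulrS; have : 0 <= x *+ K; [by rewrite mulrn_wge0// ltW|nra]].
  rewrite -exprVn -mulr_natl /x [1 + (_ - 1)]addrC subrK; lra.
have rK0 : 0 < r ^+ K by rewrite exprn_gt0.
have bern2 : K%:R * r ^+ K <= x^-1.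
  by rewrite -ler_pdivlMr// mulrC -ler_pdivlMr// invrK in bern *; rewrite ler_pdivlMr // in bern *.
have rK1 : r ^+ K <= 1 by rewrite exprn_ile1// ltW.
have -> : (K.*2.*2.+1)%:R = 4 * K%:R + 1 :> R.
  by rewrite -natr1 -!mul2n !natrM; ring.
rewrite -addnn exprD.
move: HK; rewrite ltr_pdivlMr; last by rewrite addr_gt0// divr_gt0.
apply: le_lt_trans.
have A : (4 * K%:R + 1) * r ^+ K <= 4 / x + 1.
  by rewrite mulrDl mul1r -mulrA lerD// ler_pM2l.
by rewrite mulrA [leRHS]mulrC ler_wpM2r// ltW.
Qed.

Section C1.
Variable R : realType.
Local Notation C := R[i].
Local Notation cabs := (@cabs R).
Implicit Types (f g : C -> C) (p q : {poly C}).

(** The second function plays the part of the derivative of the first: the pair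
    is a limit of pairs (p, p') in the uniform norm of the closed disc. *)
Definition C1poly f f' := forall e : R, 0 < e ->
  exists p, forall z, cabs z <= 1 ->
    cabs (f z - p.[z]) <= e /\ cabs (f' z - p^`().[z]) <= e.

Lemma poly_bounded p : exists2 B : R, 0 < B & forall z, cabs z <= 1 -> cabs p.[z] <= B.
Proof.
exists (1 + \sum_(i < size p) cabs p`_i) => [|z z1].
  by rewrite ltr_wpDr// sumr_ge0// => i _; exact: cabs_ge0.
rewrite horner_coef; apply: le_trans (cabs_sum _ _ _) _.
rewrite -[leLHS]add0r lerD// ler_sum// => i _.
rewrite cabsM cabsX -[leRHS]mulr1 ler_wpM2l ?cabs_ge0//.
by rewrite exprn_ile1 ?cabs_ge0.
Qed.

Lemma C1poly_poly p : C1poly (horner p) (horner p^`()).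
Proof. by move=> e e0; exists p => z _; rewrite !subrr cabs0 ltW. Qed.

Lemma C1poly_ext f f' g g' : C1poly f f' ->
  (forall z, cabs z <= 1 -> f z = g z) ->
  (forall z, cabs z <= 1 -> f' z = g' z) -> C1poly g g'.
Proof.
move=> cf fg fg' e /cf[p pP]; exists p => z z1.
by rewrite -fg// -fg'//; exact: pP.
Qed.

Lemma C1poly_lim f f' : (forall e : R, 0 < e -> exists g g', C1poly g g' /\
   forall z, cabs z <= 1 -> cabs (f z - g z) <= e /\ cabs (f' z - g' z) <= e) ->
  C1poly f f'.
Proof.
move=> H e e0; have e2 : 0 < e / 2 by rewrite divr_gt0.
have [g [g' [/(_ _ e2)[p pP] gP]]] := H _ e2.
exists p => z z1; have [a b] := gP _ z1; have [a' b'] := pP _ z1.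
rewrite [e]splitr; split.
  by apply: le_trans (cabs_distD _ (g z) _) _; rewrite lerD.
by apply: le_trans (cabs_distD _ (g' z) _) _; rewrite lerD.
Qed.

Lemma C1poly_bounded f f' : C1poly f f' -> exists2 B : R, 0 < B &
  forall z, cabs z <= 1 -> cabs (f z) <= B /\ cabs (f' z) <= B.
Proof.
move=> /(_ _ ltr01)[p pP].
have [B B0 BP] := poly_bounded p; have [B' B0' BP'] := poly_bounded p^`().
exists (1 + B + B') => [|z z1]; first by rewrite !addr_gt0.
have [a b] := pP _ z1; have c := BP _ z1; have d := BP' _ z1.
have := cabsD (f z - p.[z]) p.[z]; have := cabsD (f' z - p^`().[z]) p^`().[z].
rewrite !subrK; split; lra.
Qed.

Lemma C1poly_add f f' g g' : C1poly f f' -> C1poly g g' ->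
  C1poly (fun z => f z + g z) (fun z => f' z + g' z).
Proof.
move=> cf cg e e0; have e2 : 0 < e / 2 by rewrite divr_gt0.
have [p pP] := cf _ e2; have [q qP] := cg _ e2.
exists (p + q) => z z1; have [a b] := pP _ z1; have [a' b'] := qP _ z1.
rewrite derivD !hornerD [e]splitr !opprD.
by split; rewrite addrACA; apply: le_trans (cabsD _ _) _; rewrite lerD.
Qed.

Lemma C1poly_mul f f' g g' : C1poly f f' -> C1poly g g' ->
  C1poly (fun z => f z * g z) (fun z => f' z * g z + f z * g' z).
Proof.
move=> cf cg e e0.
have [B B0 BP] := C1poly_bounded cf; have [D D0 DP] := C1poly_bounded cg.
pose S := 2 * (B + D + 1) + 1.
have S1 : 1 < S by rewrite /S; lra.
have S0 : 0 < S by lra.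
pose d := e / S; have d0 : 0 < d by rewrite divr_gt0.
have dS : S * d = e by rewrite mulrC divfK// gt_eqF.
pose m := Num.min d 1; have m0 : 0 < m by rewrite lt_min d0 ltr01.
have md : m <= d by rewrite ge_min lexx.
have m1 : m <= 1 by rewrite ge_min lexx orbT.
have [p pP] := cf _ m0; have [q qP] := cg _ m0.
exists (p * q) => z z1.
have key (a b a' b' : C) (A E : R) : cabs a <= A -> cabs b <= E ->
    cabs (a - a') <= m -> cabs (b - b') <= m ->
    cabs (a * b - a' * b') <= m * (A + E + 1).
  move=> aA bE am bm.
  have -> : a * b - a' * b' = (a - a') * b + a * (b - b') - (a - a') * (b - b') by ring.
  apply: le_trans (cabs_leB _ _) _; apply: (le_trans (lerD (cabsD _ _) (lexx _))).
  rewrite !cabsM.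
  have := cabs_ge0 a; have := cabs_ge0 b; have := cabs_ge0 (a - a').
  have := cabs_ge0 (b - b'); nra.
have [a b] := pP _ z1; have [a' b'] := qP _ z1.
have [a1 b1] := BP _ z1; have [a2 b2] := DP _ z1.
rewrite derivM hornerD !hornerM; split.
  by apply: le_trans (key _ _ _ _ _ _ a1 a2 a a') _; rewrite -dS /S; nra.
rewrite opprD addrACA; apply: le_trans (cabsD _ _) _.
have := key _ _ _ _ _ _ b1 a2 b a'; have := key _ _ _ _ _ _ a1 b2 a b'.
by rewrite -dS /S; nra.
Qed.

Lemma C1poly_cst (c : C) : C1poly (fun=> c) (fun=> 0).
Proof.
apply: C1poly_ext (C1poly_poly c%:P) _ _ => z _; rewrite ?hornerC//.
by rewrite derivC horner0.
Qed.

Lemma C1poly_scale (c : C) f f' : C1poly f f' ->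
  C1poly (fun z => c * f z) (fun z => c * f' z).
Proof.
move=> cf; apply: C1poly_ext (C1poly_mul (C1poly_cst c) cf) _ _ => z _ //.
by rewrite mul0r add0r.
Qed.

Lemma C1poly_exp f f' n : C1poly f f' ->
  C1poly (fun z => f z ^+ n) (fun z => n%:R * f z ^+ n.-1 * f' z).
Proof.
move=> cf; elim: n => [|n IH].
  by apply: C1poly_ext (C1poly_cst 1) _ _ => z _; rewrite ?expr0// !mul0r.
apply: C1poly_ext (C1poly_mul cf IH) _ _ => z _; first by rewrite exprS.
rewrite /=; case: n {IH} => [|n]; first by rewrite expr0; ring.
by rewrite /= -[in RHS]natr1 exprS; ring.
Qed.

Lemma C1poly_sum (I : Type) (s : seq I) (F F' : I -> C -> C) :
  (forall i, C1poly (F i) (F' i)) ->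
  C1poly (fun z => \sum_(i <- s) F i z) (fun z => \sum_(i <- s) F' i z).
Proof.
move=> cF; elim: s => [|i s IH].
  by apply: C1poly_ext (C1poly_cst 0) _ _ => z _; rewrite big_nil.
by apply: C1poly_ext (C1poly_add (cF i) IH) _ _ => z _; rewrite big_cons.
Qed.

(** If d is small, the function g = 1 - d f satisfies |g| <= r < 1 on the disc,
    because |g|^2 <= 1 - 2 d Re f + d^2 |f|^2.  Then 1 / f = d / (1 - g) is the
    uniform limit of the partial sums of d g ^ k, and the derivatives of these
    partial sums converge as well since K r ^ K tends to 0. *)
Lemma C1poly_inv f f' (c : R) : 0 < c -> C1poly f f' ->
  (forall z, cabs z <= 1 -> c <= complex.Re (f z)) ->
  C1poly (fun z => (f z)^-1) (fun z => - f' z / f z ^+ 2).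
Proof.
move=> c0 cf fc; have [B B0 BP] := C1poly_bounded cf.
have cB : c <= B.
  have z0 : cabs 0 <= 1 by rewrite cabs0.
  have [b _] := BP _ z0; have := fc _ z0; have := Re_le_cabs (f 0).
  rewrite ler_norml => /andP[_]; lra.
(* This value of d minimises the bound 1 - 2 d c + d^2 B^2. *)
pose d := c / (B ^+ 2); have d0 : 0 < d by rewrite divr_gt0// exprn_gt0.
have dB : d * B ^+ 2 = c by rewrite divfK// gt_eqF// exprn_gt0.
pose g z := 1 - d%:C * f z; pose g' z := - d%:C * f' z.
have cg : C1poly g g'.
  apply: C1poly_ext (C1poly_add (C1poly_cst 1) (C1poly_scale (- d%:C) cf)) _ _ => z _.
    by rewrite /g mulNr.
  by rewrite add0r.
have fn0 z : cabs z <= 1 -> f z != 0.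
  by move=> /fc; apply: contraTneq => ->; rewrite -ltNge.
have dc1 : d * c <= 1.
  by rewrite /d mulrAC ler_pdivrMr ?exprn_gt0// mul1r expr2 ler_pM// ltW.

pose r := Num.sqrt (1 - d * c).
have r0 : 0 <= r by rewrite sqrtr_ge0.
have r2 : r ^+ 2 = 1 - d * c by rewrite sqr_sqrtr// subr_ge0.
have r1 : r < 1.
  rewrite -(@ltr_pXn2r _ 2) ?nnegrE// r2 expr1n; have := mulr_gt0 d0 c0; lra.
have gr z : cabs z <= 1 -> cabs (g z) <= r.
  move=> z1; rewrite -(@ler_pXn2r _ 2) ?nnegrE ?cabs_ge0// r2 cabs_sqr.
  have [b _] := BP _ z1; have h := fc _ z1.
  have b2 : cabs (f z) ^+ 2 <= B ^+ 2 by rewrite ler_pXn2r ?nnegrE ?cabs_ge0// ltW.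
  move: b2 h; rewrite cabs_sqr /g; case: (f z) => x y /= b2 h.
  rewrite !(mul0r, subr0, addr0, oppr0, add0r).
  have : d * (x ^+ 2 + y ^+ 2) <= c by rewrite -dB ler_pM2l.
  nra.
apply: C1poly_lim => e e0.
have [||K [K0 HK]] := @natmul_expr_lt_eps R r (e / (c^-1 + B / c ^+ 2)) _ _.
- by rewrite r0.
- by rewrite divr_gt0// addr_gt0 ?invr_gt0// divr_gt0// exprn_gt0.
set N := K.*2 in HK.
pose h z := d%:C * \sum_(k <- iota 0 N.+1) g z ^+ k.
pose h' z := d%:C * \sum_(k <- iota 0 N.+1) k%:R * g z ^+ k.-1 * g' z.
exists h, h'; split.
  by apply: C1poly_scale; apply: C1poly_sum => k; exact: C1poly_exp.
move=> z z1.
have gE : 1 - g z = d%:C * f z by rewrite /g opprB addrC subrK.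
have hE : f z * h z = 1 - g z ^+ N.+1.
  rewrite /h mulrA [_ * d%:C]mulrC -gE.
  have -> : \sum_(k <- iota 0 N.+1) g z ^+ k = \sum_(k < N.+1) g z ^+ k.
    by rewrite -[RHS](big_mkord xpredT (fun k => g z ^+ k)) /index_iota subn0.
  by rewrite -opprB mulNr -subrX1 opprB.
have sE n (x : C) : (1 - x) ^+ 2 * \sum_(k <- iota 0 n.+1) k%:R * x ^+ k.-1 =
    1 - n.+1%:R * x ^+ n + n%:R * x ^+ n.+1.
  elim: n => [|n IH].
    by rewrite big_seq1 !mul0r mulr0 expr0 addr0 mulr1 subrr.
  have -> : iota 0 n.+2 = iota 0 n.+1 ++ [:: n.+1] by rewrite -[n.+2]addn1 iotaD.
  rewrite big_cat mulrDr IH big_seq1 /= -!natr1 !exprS; ring.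
have hE' : f z ^+ 2 * h' z = - f' z * (1 - N.+1%:R * g z ^+ N + N%:R * g z ^+ N.+1).
  rewrite -sE gE /h' /g' -mulr_suml; ring.
have bnd : 0 <= r ^+ N by rewrite exprn_ge0.
have gN : cabs (g z) ^+ N <= r ^+ N by apply: lerXn2r; rewrite ?nnegrE ?cabs_ge0//; exact: gr.
have gN1 : cabs (g z) ^+ N.+1 <= r ^+ N.
  rewrite exprS -[leRHS]mul1r ler_pM ?exprn_ge0 ?cabs_ge0//.
  by apply: le_trans (gr _ z1) _; rewrite ltW.
have cf0 : c <= cabs (f z).
  by apply: le_trans (fc _ z1) _; apply: le_trans (ler_norm _) (Re_le_cabs _).
have cfV : (cabs (f z))^-1 <= c^-1 by rewrite lef_pV2 ?posrE// (lt_le_trans c0).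
have [_ f'B] := BP _ z1.
have N1 : (1 : R) <= N.*2.+1%:R by rewrite ler1n.
have cV0 : 0 < c^-1 by rewrite invr_gt0.
have Bc0 : 0 < B / c ^+ 2 by rewrite divr_gt0// exprn_gt0.
have tot : (c^-1 + B / c ^+ 2) * (N.*2.+1%:R * r ^+ N) <= e.
  by move: HK; rewrite ltr_pdivlMr ?addr_gt0// => HK; rewrite mulrC ltW.
split; apply: le_trans tot.
  have -> : (f z)^-1 - h z = g z ^+ N.+1 / f z.
    apply: (mulfI (fn0 _ z1)); rewrite mulrBr hE divff ?fn0// mulrCA divff ?fn0//.
    by rewrite mulr1 opprB addrC subrK.
  rewrite cabsM cabsV cabsX mulrC ler_pM ?invr_ge0 ?exprn_ge0 ?cabs_ge0//.
    by apply: le_trans cfV _; rewrite lerDl ltW.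
  by apply: le_trans gN1 _; rewrite ler_peMl.
have -> : - f' z / f z ^+ 2 - h' z = - f' z / f z ^+ 2 *
     (N.+1%:R * g z ^+ N - N%:R * g z ^+ N.+1).
  have f2 : f z ^+ 2 != 0 by rewrite expf_neq0// fn0.
  apply: (mulfI f2); rewrite mulrBr hE'.
  set P := N.+1%:R * _; set Q := N%:R * _.
  by field; exact: fn0.
rewrite cabsM; apply: ler_pM; rewrite ?cabs_ge0//.
  rewrite cabsM cabsN cabsV cabsX; apply: (@le_trans _ _ (B / c ^+ 2)); last by rewrite lerDr ltW.
  rewrite ler_pM ?cabs_ge0 ?invr_ge0 ?exprn_ge0 ?cabs_ge0//.
  by rewrite -!exprVn ler_pXn2r ?nnegrE ?invr_ge0 ?cabs_ge0 ?(ltW c0).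
apply: le_trans (cabs_leB _ _) _; rewrite !cabsM !cabsX.
have cn n : cabs n%:R = n%:R.
  by rewrite -(rmorph_nat (real_complex R)) cabs_real normr_nat.
rewrite !cn -addnn -addSn natrD mulrDl lerD// ler_wpM2l//.
Qed.

End C1.

(** * The exponential parametrisation of the circle *)

Section cexp.
Variable R : realType.
Local Notation C := R[i].
Local Notation cabs := (@cabs R).

Definition cexp (x : R) : C := circle_exp R x.

Lemma cexpD x y : cexp (x + y) = cexp x * cexp y.
Proof.
apply/eqP; rewrite eq_complex /= mulrDr cosD sinD eqxx /=.
by apply/eqP; exact: addrC.
Qed.

Lemma cexp0 : cexp 0 = 1.
Proof. by apply/eqP; rewrite eq_complex /= mulr0 cos0 sin0 !eqxx. Qed.

Lemma cexp1 : cexp 1 = 1.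
Proof.
have E : 2 * pi * 1 = pi *+ 2 :> R by rewrite mulr1 mulr_natl.
by apply/eqP; rewrite eq_complex /= E cos2pi sin2pi !eqxx.
Qed.

Lemma cabs_cexp x : cabs (cexp x) = 1.
Proof.
apply/eqP; rewrite -(@pexpr_eq1 _ _ 2) ?cabs_ge0// cabs_sqr /=.
by rewrite cos2Dsin2.
Qed.

Lemma cexp_neq0 x : cexp x != 0.
Proof. by rewrite -cabs_eq0 cabs_cexp oner_neq0. Qed.

Lemma cexpMn (n : nat) x : cexp (n%:R * x) = cexp x ^+ n.
Proof.
elim: n => [|n IH]; first by rewrite mul0r cexp0 expr0.
by rewrite -natr1 mulrDl mul1r cexpD IH exprSr.
Qed.

Lemma cexp_nat (n : nat) : cexp n%:R = 1.
Proof. by rewrite -[n%:R]mulr1 cexpMn cexp1 expr1n. Qed.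

Lemma cexpN x : cexp (- x) = (cexp x)^-1.
Proof.
apply: (mulfI (cexp_neq0 x)); rewrite -cexpD subrr cexp0 divff//.
exact: cexp_neq0.
Qed.

Lemma cexp_int (n : int) : cexp n%:~R = 1.
Proof. by case: n => n; rewrite ?NegzE ?mulrNz ?cexpN cexp_nat ?invr1. Qed.

Lemma lipschitz_sin (x y : R) : `|sin x - sin y| <= `|x - y|.
Proof.
wlog xy : x y / y <= x => [H|].
  have [/H//|/ltW/H] := leP y x.
  by rewrite distrC [leRHS]distrC.
have [|c _ ->] := @MVT_segment R sin cos y x xy.
  by apply: continuous_subspaceT => z; exact: continuous_sin.
by rewrite normrM ler_piMl// cos_max.
Qed.

Lemma lipschitz_cos (x y : R) : `|cos x - cos y| <= `|x - y|.
Proof.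
have := lipschitz_sin (x + pi / 2) (y + pi / 2).
by rewrite !sinDpihalf opprD addrACA subrr addr0.
Qed.

Definition cexp_lip : R := 4 * pi.

Lemma cexp_lip_gt0 : 0 < cexp_lip.
Proof. by rewrite mulr_gt0// pi_gt0. Qed.

Lemma lipschitz_cexp x y : cabs (cexp x - cexp y) <= cexp_lip * `|x - y|.
Proof.
apply: le_trans (cabs_le_ReIm _) _; rewrite cReD cReN cImD cImN /=.
have := lipschitz_cos (2 * pi * x) (2 * pi * y).
have := lipschitz_sin (2 * pi * x) (2 * pi * y).
rewrite -mulrBr normrM (ger0_norm (mulr_ge0 _ (pi_ge0 R)))// /cexp_lip.
lra.
Qed.

(** From cexp u = 1 and 0 < u < 1 one would get sin (pi u) ^ 2 = 0, by the
    double angle formula. *)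
Lemma cexp_inj01 x y : 0 <= x < 1 -> 0 <= y < 1 -> cexp x = cexp y -> x = y.
Proof.
wlog xy : x y / y <= x => [H|].
  by have [/H//|/ltW/H{}H] := leP y x => x1 y1 /esym/(H y1 x1).
move=> /andP[x0 x1] /andP[y0 y1] E.
have : cexp (x - y) = 1 by rewrite cexpD cexpN E divff// cexp_neq0.
set u := x - y => Eu; apply/eqP; rewrite -subr_eq0 -/u.
have [//|un0] := eqVneq u 0.
have u0 : 0 < u by rewrite lt_def un0 subr_ge0.
have u1 : u < 1 by rewrite /u; lra.
have : sin (pi * u) != 0.
  rewrite gt_eqF// sin_gt0_pi// mulr_gt0 ?pi_gt0//=.
  by rewrite -[ltRHS]mulr1 ltr_pM2l// pi_gt0.
move: Eu => /(congr1 (@complex.Re R)) /=.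
have -> : 2 * pi * u = (pi * u) *+ 2 by rewrite -mulrA mulr_natl.
rewrite cos_mulr2n cos2sin2 => h; rewrite -sqrf_eq0.
move: h; rewrite mulr2n => h; have -> : sin (pi * u) ^+ 2 = 0 by lra.
by rewrite eqxx.
Qed.

End cexp.

(** * Combinatorics of the Cantor intervals *)

Section cantor_lists.
Variables (R : realType) (xi : R).
Hypothesis xi01 : 0 < xi < 2^-1.
Local Notation ci := (cantor_intervals xi).

Let xi0 : 0 < xi. Proof. by case/andP: xi01. Qed.
Let xi2 : xi < 2^-1. Proof. by case/andP: xi01. Qed.
Let xi1 : xi < 1. Proof. by apply: lt_trans xi2 _; rewrite invf_lt1// ltr1n. Qed.

Definition cantor_refine (s : seq (R * R)) := flatten (map (remove_middle xi) s).

Lemma cantor_intervalsS k : ci k.+1 = cantor_refine (ci k).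
Proof. by []. Qed.

Lemma cantor_refine_cat s t : cantor_refine (s ++ t) = cantor_refine s ++ cantor_refine t.
Proof. by rewrite /cantor_refine map_cat flatten_cat. Qed.

(** The two similarities of the self-similar structure are a = 0 and
    a = 1 - xi. *)
Definition affi (a : R) (I : R * R) := (xi * I.1 + a, xi * I.2 + a).

Lemma cantor_refine_map a s :
  cantor_refine (map (affi a) s) = map (affi a) (cantor_refine s).
Proof.
elim: s => // I s IH.
rewrite -cat1s map_cat !cantor_refine_cat IH map_cat; congr cat.
rewrite /cantor_refine /affi /=.
by congr [:: (_, _); (_, _)]; ring.
Qed.

(** The intervals are defined by refining every interval at each step; because
    refinement commutes with similarities, generation k + 1 also consists of
    two scaled copies of generation k. *)
Lemma cantor_intervals_split k :
  ci k.+1 = map (affi 0) (ci k) ++ map (affi (1 - xi)) (ci k).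
Proof.
elim: k => [|k IH].
  by rewrite /= /cantor_refine /= /affi /=; do 2?congr cons; congr pair; ring.
by rewrite [LHS]cantor_intervalsS [in LHS]IH cantor_refine_cat !cantor_refine_map.
Qed.

Lemma size_cantor_intervals k : size (ci k) = (2 ^ k)%N.
Proof.
by elim: k => // k IH; rewrite cantor_intervals_split size_cat !size_map IH addnn -mul2n expnS.
Qed.

Lemma cantor_intervals_length k I : I \in ci k ->
  [/\ I.2 = I.1 + xi ^+ k, 0 <= I.1 & I.2 <= 1].
Proof.
elim: k I => [|k IH] I; first by rewrite inE => /eqP -> /=; rewrite expr0 add0r.
rewrite cantor_intervals_split mem_cat => /orP[] /mapP[J /IH[J2 J0 J1] ->];
  rewrite /affi /= J2 exprS; split; rewrite ?J2; try ring.
- by rewrite addr0 mulr_ge0// ltW.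
- rewrite addr0 -J2; have : 0 <= J.2 by rewrite J2 addr_ge0// exprn_ge0// ltW.
  by move=> h; rewrite mulr_ile1 ?(ltW xi0) ?(ltW xi1).
- by rewrite addr_ge0 ?mulr_ge0 ?subr_ge0// ltW.
- rewrite -J2; have : xi * J.2 <= xi * 1 by rewrite ler_pM2l.
  lra.
Qed.

Lemma cantor_intervals_child k I : I \in ci k.+1 ->
  exists2 J, J \in ci k & [&& J.1 <= I.1, I.1 <= I.2 & I.2 <= J.2].
Proof.
rewrite cantor_intervalsS => /flattenP[_ /mapP[J Jk ->]] IJ; exists J => //.
have [J2 _ _] := cantor_intervals_length Jk.
have x0 : 0 < xi ^+ k by rewrite exprn_gt0.
have E : J.2 - J.1 = xi ^+ k by rewrite J2 addrC addKr.
have h1 := mulr_gt0 xi0 x0; have h2 : xi * xi ^+ k < xi ^+ k by rewrite gtr_pMl.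
move: IJ; rewrite /remove_middle E !inE => /orP[] /eqP -> /=; rewrite J2;
  apply/and3P; split; lra.
Qed.

Lemma cantor_intervals_anc j k I : (j <= k)%N -> I \in ci k ->
  exists2 J, J \in ci j & [&& J.1 <= I.1, I.1 <= I.2 & I.2 <= J.2].
Proof.
move=> jk; rewrite -(subnK jk); elim: (k - j)%N I => [|n IH] I.
  rewrite add0n => Ij; exists I => //; rewrite !lexx /=.
  have [-> _ _] := cantor_intervals_length Ij.
  by rewrite lerDl exprn_ge0// ltW.
rewrite addSn => /cantor_intervals_child[J /IH[K Kj /and3P[a b c]] /and3P[d e f]].
by exists K => //; apply/and3P; split => //; apply: le_trans; eassumption.
Qed.

Lemma cantor_intervals_left k I : I \in ci k -> exists2 J, J \in ci k.+1 & J.1 = I.1.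
Proof.
move=> Ik; exists (I.1, I.1 + xi * (I.2 - I.1)) => //.
rewrite cantor_intervalsS; apply/flattenP.
by exists (remove_middle xi I); [exact: map_f|rewrite inE eqxx].
Qed.

Lemma cantor_approxP n x : cantor_approx xi n x <->
  exists2 I, I \in ci n & I.1 <= x <= I.2.
Proof.
rewrite /cantor_approx; elim: (ci n) => [|I s IH].
  by rewrite big_nil; split => // -[].
rewrite big_cons; split.
  case=> [|/IH[J Js xJ]]; first by rewrite /= in_itv /= => xI; exists I; rewrite ?mem_head.
  by exists J => //; rewrite inE Js orbT.
case=> J; rewrite inE => /orP[/eqP ->|Js] xJ; first by left; rewrite /= in_itv.
by right; apply/IH; exists J.
Qed.

(** A left endpoint remains a left endpoint in all later generations. *)
Lemma cantor_left_in k I : I \in ci k -> cantor_set xi I.1.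
Proof.
move=> Ik n _; apply/cantor_approxP.
have [kn|nk] := leqP k n.+1.
  suff [J Jn E] : exists2 J, J \in ci n.+1 & J.1 = I.1.
    exists J => //; rewrite E lexx /= -E.
    have [-> _ _] := cantor_intervals_length Jn.
    by rewrite lerDl exprn_ge0// ltW.
  rewrite -(subnK kn); elim: (n.+1 - k)%N => [|m [J /cantor_intervals_left[K Km KJ] JI]].
    by exists I.
  by rewrite addSn; exists K => //; rewrite KJ.
have [J Jn /and3P[a b c]] := cantor_intervals_anc (ltnW nk) Ik.
by exists J => //; rewrite a (le_trans b c).
Qed.

Lemma cantor_set_near k x : cantor_set xi x ->
  exists2 I, I \in ci k & I.1 <= x <= I.1 + xi ^+ k.
Proof.
move=> /(_ k Logic.I) /cantor_approxP[J Jk /andP[d e]].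
have [K Kk /and3P[a b c]] := cantor_intervals_child Jk.
exists K => //; have [<- _ _] := cantor_intervals_length Kk.
by rewrite (le_trans a d) (le_trans e c).
Qed.

Lemma pairwise_cantor_intervals k :
  pairwise (fun I J : R * R => I.2 < J.1) (ci k).
Proof.
elim: k => // k IH; rewrite cantor_intervals_split pairwise_cat !pairwise_map.
have H a : pairwise (relpre (affi a) (fun I J : R * R => I.2 < J.1)) (ci k).
  by apply: sub_pairwise IH => I J /=; rewrite ltrD2r ltr_pM2l.
rewrite !H !andbT; apply/allrelP => _ _ /mapP[I Ik ->] /mapP[J Jk ->] /=.
have [I2 I0 I1] := cantor_intervals_length Ik.
have [J2 J0 J1] := cantor_intervals_length Jk.
have : xi * I.2 <= xi * 1 by rewrite ler_pM2l.
have : 0 <= xi * J.1 by rewrite mulr_ge0// ltW.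
have := xi2; lra.
Qed.

Lemma cantor_set01 x : cantor_set xi x -> 0 <= x <= 1.
Proof.
move=> /(_ 0%N Logic.I) /cantor_approxP[J Jk /andP[a b]].
have [_ J0 J1] := cantor_intervals_length Jk.
by rewrite (le_trans J0 a) (le_trans b J1).
Qed.

Lemma cantor_set0 : cantor_set xi 0.
Proof. by apply: (@cantor_left_in 0%N (0, 1)); rewrite inE. Qed.

End cantor_lists.

(** * Sums of poles near the Cantor set *)

Section kernels.
Variables (R : realType) (xi : R).
Hypothesis xi_small : 0 < xi <= 256^-1.
Local Notation C := R[i].
Local Notation cabs := (@cabs R).
Local Notation ci := (cantor_intervals xi).
Local Notation cexp_lip := (cexp_lip R).

Lemma xi_gt0 : 0 < xi. Proof. by case/andP: xi_small. Qed.
Lemma xi_le : xi <= 256^-1. Proof. by case/andP: xi_small. Qed.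
Lemma xi_half : 0 < xi < 2^-1.
Proof. rewrite xi_gt0 /=; apply: le_lt_trans xi_le _; lra. Qed.
Lemma xi_lt1 : xi < 1. Proof. by have /andP[_] := xi_half; lra. Qed.
Lemma xiX_gt0 k : 0 < xi ^+ k. Proof. by rewrite exprn_gt0// xi_gt0. Qed.
Lemma xiX_le1 k : xi ^+ k <= 1.
Proof. by rewrite exprn_ile1// ltW ?xi_gt0 ?xi_lt1. Qed.
Lemma xiX_mono j k : (j <= k)%N -> xi ^+ k <= xi ^+ j.
Proof. by move=> jk; rewrite ler_wiXn2l// ltW ?xi_gt0 ?xi_lt1. Qed.

(** The denominator of a kernel with pole just outside the disc, at distance
    about xi ^ k from the point cexp c of the circle. *)
Definition den k (c : R) (z : C) : C := 1 - (1 - xi ^+ k)%:C * cexp (- c) * z.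

Lemma cabs_rho k (c : R) : cabs ((1 - xi ^+ k)%:C * cexp (- c)) = 1 - xi ^+ k.
Proof. by rewrite cabsM cabs_cexp mulr1 cabs_real ger0_norm// subr_ge0 xiX_le1. Qed.

Lemma Re_den k c z : cabs z <= 1 -> xi ^+ k <= complex.Re (den k c z).
Proof.
move=> z1; rewrite /den cReD cReN /=.
have := Re_le_cabs ((1 - xi ^+ k)%:C * cexp (- c) * z).
rewrite cabsM cabs_rho; set x := complex.Re _ => h.
have := ler_norm x; have := xiX_le1 k; have := cabs_ge0 z; nra.
Qed.

Lemma cabs_den k c z : cabs z <= 1 -> xi ^+ k <= cabs (den k c z).
Proof.
move=> /(Re_den k c) h; apply: le_trans h _.
exact: le_trans (ler_norm _) (Re_le_cabs _).
Qed.

(** This is the positivity of the Poisson kernel in a quantitative form. *)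
Lemma Re_denV k c z : cabs z <= 1 ->
  xi ^+ k / cabs (den k c z) ^+ 2 <= complex.Re (den k c z)^-1.
Proof.
by move=> z1; rewrite cReV ler_wpM2r ?invr_ge0 ?exprn_ge0 ?cabs_ge0// Re_den.
Qed.

Lemma Re_denV_ge0 k c z : cabs z <= 1 -> 0 <= complex.Re (den k c z)^-1.
Proof.
move=> z1; apply: le_trans (Re_denV k c z1).
by rewrite divr_ge0 ?exprn_ge0 ?cabs_ge0// ltW// xi_gt0.
Qed.

Lemma cabs_denV k c z m : cabs z <= 1 -> xi ^+ m <= cabs (den k c z) ->
  cabs (den k c z)^-1 <= xi ^- m.
Proof.
move=> z1 h; rewrite cabsV lef_pV2 ?posrE ?xiX_gt0//.
exact: lt_le_trans (xiX_gt0 _) h.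
Qed.

(** The constant is chosen so that a point which is not near generation m is
    still at distance at least xi ^ m from all poles of later generations. *)
Definition near_cst : R := cexp_lip + 2.
Lemma near_cst_gt0 : 0 < near_cst. Proof. by rewrite addr_gt0// cexp_lip_gt0. Qed.

(** The point z is at distance O(xi ^ k) from the left endpoints of
    generation k. *)
Definition near_level k z :=
  has (fun I : R * R => cabs (den k I.1 z) <= near_cst * xi ^+ k) (ci k).

Lemma near_level0 z : near_level 0 z.
Proof.
rewrite /near_level /= orbF /den expr0 subrr mul0r mul0r subr0 cabs1 mulr1.
by rewrite /near_cst; have := cexp_lip_gt0 R; lra.
Qed.

(** A left endpoint of generation k is within xi ^ m of one of generation m, so
    replacing one by the other changes the denominator by at most
    (cexp_lip + 1) xi ^ m. *)
Lemma not_near_den m k z J : cabs z <= 1 -> ~~ near_level m z -> (m <= k)%N ->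
  J \in ci k -> xi ^+ m <= cabs (den k J.1 z).
Proof.
move=> z1 /hasPn nm mk Jk.
have [I Im /and3P[a b c]] := cantor_intervals_anc xi_half mk Jk.
have := nm _ Im; rewrite -ltNge => dI.
have [I2 _ _] := cantor_intervals_length xi_half Im.
have dist : cabs (den m I.1 z - den k J.1 z) <= (cexp_lip + 1) * xi ^+ m.
  have -> : den m I.1 z - den k J.1 z =
    ((1 - xi ^+ k)%:C * (cexp (- J.1) - cexp (- I.1)) +
     (xi ^+ m - xi ^+ k)%:C * cexp (- I.1)) * z.
    by rewrite /den !rmorphB /=; ring.
  rewrite cabsM; set y := cabs (_ + _).
  suff h : y <= (cexp_lip + 1) * xi ^+ m.
    by apply: le_trans h; rewrite ler_piMr// cabs_ge0.
  apply: le_trans (cabsD _ _) _; rewrite !cabsM cabs_cexp mulr1 !cabs_real.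
  have := lipschitz_cexp (- J.1) (- I.1).
  have -> : `|- J.1 - - I.1| = J.1 - I.1.
    by rewrite opprK addrC distrC ger0_norm// subr_ge0.
  have IJ : J.1 - I.1 <= xi ^+ m by lra.
  rewrite [`|1 - _|]ger0_norm ?subr_ge0 ?xiX_le1// [`|_ - _|]ger0_norm ?subr_ge0 ?xiX_mono//.
  have := xiX_gt0 k; have := xiX_le1 k; have := cabs_ge0 (cexp (- J.1) - cexp (- I.1)).
  have := cexp_lip_gt0 R; set u := xi ^+ k; set v := xi ^+ m in IJ *.
  set t := cabs _ => k0 t0 u1 u0 h.
  have : t <= cexp_lip * v by apply: le_trans h _; rewrite ler_pM2l.
  nra.
have := cabs_distD (den m I.1 z) (den k J.1 z) 0; rewrite !subr0.
by move: dI dist; rewrite /near_cst; lra.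
Qed.

Lemma sum_ci_le k (f : R * R -> R) (b : R) :
  (forall I, I \in ci k -> f I <= b) ->
  \sum_(I <- ci k) f I <= 2 ^+ k * b.
Proof.
move=> fb; apply: le_trans (_ : \sum_(I <- ci k) b <= _).
  by rewrite big_seq [leRHS]big_seq ler_sum.
by rewrite big_const_seq count_predT size_cantor_intervals// ?xi_half// iter_addr_0 -[_ *+ _]mulr_natl natrX.
Qed.

(** The sum of 2 ^ k weight k is finite, and the bounds on G' and on G ^ 2 at
    level j have quotient of order 2 ^ j / weight j, whatever xi is. *)
Definition weight k : R := 4^-1 ^+ k.
Lemma weight_gt0 k : 0 < weight k. Proof. by rewrite exprn_gt0. Qed.

Definition pole_level k z : C := (weight k)%:C * \sum_(I <- ci k) (den k I.1 z)^-1.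
Definition pole_level' k z : C := (weight k)%:C * \sum_(I <- ci k)
  (((1 - xi ^+ k)%:C * cexp (- I.1)) / den k I.1 z ^+ 2).
(** The functions G_N. *)
Definition pole_sum N z : C := \sum_(0 <= k < N.+1) pole_level k z.
Definition pole_sum' N z : C := \sum_(0 <= k < N.+1) pole_level' k z.
(** The functions F_N; the limit of 1 - F_N is the peak function. *)
Definition copeak N z : C := (1 + pole_sum N z)^-1.
Definition copeak' N z : C := - pole_sum' N z / (1 + pole_sum N z) ^+ 2.

Lemma Re_pole_level_ge0 k z : cabs z <= 1 -> 0 <= complex.Re (pole_level k z).
Proof.
move=> z1; rewrite cRe_realM cRe_sum mulr_ge0 ?sumr_ge0// ?ltW ?weight_gt0// => I _.
exact: Re_denV_ge0.
Qed.

Lemma Re_pole_sum_ge0 N z : cabs z <= 1 -> 0 <= complex.Re (pole_sum N z).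
Proof. by move=> z1; rewrite cRe_sum sumr_ge0// => k _; exact: Re_pole_level_ge0. Qed.

Lemma Re_1D_pole_sum N z : cabs z <= 1 -> 1 <= complex.Re (1 + pole_sum N z).
Proof. by move=> /(Re_pole_sum_ge0 N); rewrite cReD /=; lra. Qed.

Lemma cabs_1D_pole_sum N z : cabs z <= 1 -> 1 <= cabs (1 + pole_sum N z).
Proof.
move=> /(Re_1D_pole_sum N) h; apply: le_trans h _; exact: le_trans (ler_norm _) (Re_le_cabs _).
Qed.

Lemma C1poly_den k c : C1poly (den k c) (fun=> - ((1 - xi ^+ k)%:C * cexp (- c))).
Proof.
set a := (_ * _); apply: C1poly_ext (C1poly_poly (1 - a *: 'X)) _ _ => z _.
  by rewrite !hornerE.
by rewrite derivB derivZ derivX -(polyC1 C) derivC !hornerE.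
Qed.

Lemma C1poly_pole_level k : C1poly (pole_level k) (pole_level' k).
Proof.
apply: C1poly_scale; apply: C1poly_sum => I.
apply: C1poly_ext (C1poly_inv (xiX_gt0 k) (C1poly_den k I.1) _) _ _ => z z1 //.
  exact: Re_den.
by rewrite opprK.
Qed.

Lemma C1poly_copeak N : C1poly (copeak N) (copeak' N).
Proof.
apply: (@C1poly_inv _ _ _ 1) => //; last exact: Re_1D_pole_sum.
apply: C1poly_ext (C1poly_add (C1poly_cst 1) (C1poly_sum (index_iota 0 N.+1) C1poly_pole_level)) _ _ => z _ //.
by rewrite add0r.
Qed.

(** All terms have nonnegative real part, so one pole of generation j is enough. *)
Lemma near_pole_sum j N z : cabs z <= 1 -> (j <= N)%N -> near_level j z ->
  (4 * xi) ^- j / near_cst ^+ 2 <= complex.Re (pole_sum N z).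
Proof.
move=> z1 jN /hasP[I Ij nI].
have -> : complex.Re (pole_sum N z) = \sum_(0 <= k < N.+1) complex.Re (pole_level k z) by rewrite cRe_sum.
rewrite (bigD1_seq j) ?mem_index_iota ?iota_uniq//=.
rewrite -[leLHS]addr0 lerD ?sumr_ge0// => [|k _]; last exact: Re_pole_level_ge0.
rewrite cRe_realM cRe_sum (big_rem I)//=.
have h : xi ^- j / near_cst ^+ 2 <= complex.Re (den j I.1 z)^-1.
  apply: le_trans (Re_denV _ _ z1).
  have d0 : 0 < cabs (den j I.1 z) by apply: lt_le_trans (cabs_den j I.1 z1); exact: xiX_gt0.
  rewrite ler_pdivlMr ?exprn_gt0//.
  have E : xi ^- j / near_cst ^+ 2 * (near_cst * xi ^+ j) ^+ 2 = xi ^+ j.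
    have := xiX_gt0 j; set x := xi ^+ j => x0.
    by field; rewrite !gt_eqF ?near_cst_gt0.
  rewrite -[leRHS]E.
  rewrite ler_wpM2l ?divr_ge0 ?invr_ge0 ?exprn_ge0 ?(ltW near_cst_gt0) ?(ltW xi_gt0)//.
  by apply: lerXn2r; rewrite ?nnegrE ?cabs_ge0// mulr_ge0 ?ltW ?near_cst_gt0 ?xiX_gt0.
have -> : (4 * xi) ^- j / near_cst ^+ 2 = weight j * (xi ^- j / near_cst ^+ 2).
  by rewrite exprMn invfM /weight -exprVn mulrA.
rewrite ler_wpM2l ?(ltW (weight_gt0 _))// -[leLHS]addr0 lerD ?sumr_ge0// => J _.
exact: Re_denV_ge0.
Qed.

Lemma cabs_pole_level k m z : cabs z <= 1 ->
  (forall I, I \in ci k -> xi ^+ m <= cabs (den k I.1 z)) ->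
  cabs (pole_level k z) <= 2^-1 ^+ k * xi ^- m.
Proof.
move=> z1 h; rewrite cabsM cabs_real ger0_norm ?(ltW (weight_gt0 _))//.
have -> : 2^-1 ^+ k = weight k * 2 ^+ k :> R.
  rewrite -exprMn; congr (_ ^+ k); by lra.
rewrite -mulrA ler_pM2l ?weight_gt0//; apply: le_trans (cabs_sum _ _ _) _.
by apply: sum_ci_le => I /h; exact: cabs_denV.
Qed.

Lemma cabs_pole_level' k m z : cabs z <= 1 ->
  (forall I, I \in ci k -> xi ^+ m <= cabs (den k I.1 z)) ->
  cabs (pole_level' k z) <= 2^-1 ^+ k * xi ^- m ^+ 2.
Proof.
move=> z1 h; rewrite cabsM cabs_real ger0_norm ?(ltW (weight_gt0 _))//.
have -> : 2^-1 ^+ k = weight k * 2 ^+ k :> R.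
  rewrite -exprMn; congr (_ ^+ k); by lra.
rewrite -mulrA ler_pM2l ?weight_gt0//; apply: le_trans (cabs_sum _ _ _) _.
apply: sum_ci_le => I /h {}h; rewrite cabsM cabs_rho -exprVn cabsX -[leRHS]mul1r.
rewrite ler_pM ?subr_ge0 ?xiX_le1 ?exprn_ge0 ?cabs_ge0//.
  by rewrite gerBl ltW// xiX_gt0.
apply: lerXn2r; rewrite ?nnegrE ?cabs_ge0 ?invr_ge0 ?(ltW (xiX_gt0 _))//.
exact: cabs_denV.
Qed.

Lemma sum_geom_inc (q : R) j : 2 <= q -> \sum_(0 <= k < j.+1) q ^+ k <= 2 * q ^+ j.
Proof.
move=> q2; elim: j => [|j IH]; first by rewrite big_nat1 expr0; lra.
rewrite big_nat_recr//= exprS; have : 0 <= q ^+ j by rewrite exprn_ge0//; lra.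
nra.
Qed.

Lemma sum_half_dec j N : (j <= N)%N ->
  \sum_(j.+1 <= k < N.+1) 2^-1 ^+ k <= 2^-1 ^+ j - 2^-1 ^+ N :> R.
Proof.
elim: N => [|N IH]; first by rewrite leqn0 => /eqP ->; rewrite big_geq// subrr.
rewrite leq_eqVlt => /predU1P[->|jN]; first by rewrite big_geq// subrr.
rewrite big_nat_recr//=; have := IH jN; rewrite [_ ^+ N.+1]exprS; lra.
Qed.

Definition pole_deriv_cst : R := 2 + xi ^- 2.

Lemma pole_deriv_cst_gt0 : 0 < pole_deriv_cst.
Proof. by rewrite addr_gt0// invr_gt0 xiX_gt0. Qed.

(** Up to generation j only |den| >= xi ^ k is available, and the bounds grow
    geometrically; beyond it z is at distance at least xi ^ (j + 1) from all
    poles, and the weights make the bounds decrease geometrically.  Both sums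
    are controlled by their term at j. *)
Lemma cabs_pole_sum' j N z : cabs z <= 1 -> (j <= N)%N ->
  (j < N)%N ==> ~~ near_level j.+1 z ->
  cabs (pole_sum' N z) <= pole_deriv_cst * (2 * xi ^+ 2) ^- j.
Proof.
move=> z1 jN nn.
apply: le_trans (cabs_sum _ _ _) _.
rewrite (@big_cat_nat _ _ _ j.+1)//=.
pose q := (2 * xi ^+ 2)^-1.
have qE : q = 2^-1 * xi^-1 ^+ 2 by rewrite /q invfM exprVn.
have q2 : 2 <= q.
  rewrite -[X in X <= _]invrK lef_pV2 ?posrE ?mulr_gt0 ?exprn_gt0 ?xi_gt0//.
  have := xi_le; have := xi_gt0; nra.
have e1 : \sum_(0 <= k < j.+1) cabs (pole_level' k z) <= 2 * q ^+ j.
  apply: le_trans (sum_geom_inc _ q2); rewrite ler_sum// => k _.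
  apply: le_trans (@cabs_pole_level' k k z z1 _) _; first by move=> I _; exact: cabs_den.
  by rewrite qE exprMn -!exprVn -!exprM mulnC.
have e2 : \sum_(j.+1 <= k < N.+1) cabs (pole_level' k z) <= xi ^- 2 * q ^+ j.
  have [->|jn] := eqVneq j N.
    by rewrite big_geq// mulr_ge0// ?invr_ge0 ?exprn_ge0 ?(ltW xi_gt0)//; lra.
  have {}jn : (j < N)%N by rewrite ltn_neqAle jn.
  rewrite jn /= in nn.
  apply: le_trans (_ : \sum_(j.+1 <= k < N.+1) 2^-1 ^+ k * xi ^- j.+1 ^+ 2 <= _).
    rewrite big_nat_cond [leRHS]big_nat_cond; apply: ler_sum => k /andP[/andP[jk _] _].
    by apply: cabs_pole_level' => // I Ik; exact: not_near_den nn jk Ik.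
  rewrite -mulr_suml.
  have -> : xi ^- 2 * q ^+ j = 2^-1 ^+ j * xi ^- j.+1 ^+ 2.
    rewrite qE -!exprVn exprMn -!exprM mulrCA -exprD; congr (_ * _ ^+ _); lia.
  rewrite ler_wpM2r ?exprn_ge0 ?invr_ge0 ?exprn_ge0 ?(ltW xi_gt0)//.
  apply: le_trans (sum_half_dec jN) _.
  by rewrite gerBl exprn_ge0.
by rewrite -exprVn -/q /pole_deriv_cst mulrDl lerD.
Qed.

Definition copeak_deriv_cst : R := (pole_deriv_cst * near_cst ^+ 4) ^+ 2.

(** The bound on G' is of order (2 xi ^ 2) ^ (-j) and that on |1 + G| is of order
    (4 xi) ^ (-j), so the quotient by the square is of order 8 ^ j. *)
Lemma cabs_copeak' j N z : cabs z <= 1 -> (j <= N)%N -> near_level j z ->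
  (j < N)%N ==> ~~ near_level j.+1 z ->
  cabs (copeak' N z) ^+ 2 <= copeak_deriv_cst * 64 ^+ j.
Proof.
move=> z1 jN nj nn.
have h1 := cabs_pole_sum' z1 jN nn.
have h2 : (4 * xi) ^- j / near_cst ^+ 2 <= cabs (1 + pole_sum N z).
  apply: le_trans (le_trans (ler_norm _) (Re_le_cabs _)).
  by rewrite cReD /=; have := near_pole_sum z1 jN nj; lra.
have a0 : 0 < (4 * xi) ^- j / near_cst ^+ 2.
  by rewrite divr_gt0 ?invr_gt0 ?exprn_gt0 ?mulr_gt0 ?xi_gt0 ?near_cst_gt0.
have -> : copeak_deriv_cst * 64 ^+ j = (pole_deriv_cst * near_cst ^+ 4 * 8 ^+ j) ^+ 2.
  have -> : 64 = 8 ^+ 2 :> R by lra.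
  by rewrite /copeak_deriv_cst [in RHS]exprMn -!exprM mulnC.
apply: lerXn2r; rewrite ?nnegrE ?cabs_ge0//.
  by rewrite !mulr_ge0 ?exprn_ge0// ltW ?pole_deriv_cst_gt0 ?near_cst_gt0.
rewrite /copeak' cabsM cabsN cabsV cabsX.
have -> : pole_deriv_cst * near_cst ^+ 4 * 8 ^+ j =
    (pole_deriv_cst * (2 * xi ^+ 2) ^- j) / ((4 * xi) ^- j / near_cst ^+ 2) ^+ 2.
  have x0 : xi != 0 by rewrite gt_eqF ?xi_gt0.
  have K0 : near_cst != 0 by rewrite gt_eqF ?near_cst_gt0.
  have -> : 8 ^+ j = (2 * xi ^+ 2) ^- j / ((4 * xi) ^- j) ^+ 2 :> R.
    have E : 8 ^+ j * (2 * xi ^+ 2) ^+ j = ((4 * xi) ^+ j) ^+ 2.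
      by rewrite -exprMn -exprM mulnC exprM; congr (_ ^+ j); ring.
    have A0 : (2 * xi ^+ 2) ^+ j != 0 by rewrite expf_neq0// mulf_neq0// expf_neq0.
    by rewrite exprVn invrK -E mulrCA mulVf// mulr1.
  set A := (2 * _) ^- j; set B := (4 * _) ^- j.
  have B0 : B != 0 by rewrite gt_eqF// invr_gt0 exprn_gt0// mulr_gt0 ?xi_gt0.
  by field; apply/andP.
rewrite ler_pM ?cabs_ge0 ?invr_ge0 ?exprn_ge0 ?cabs_ge0//.
rewrite lef_pV2 ?posrE ?exprn_gt0//; last exact: lt_le_trans h2.
by apply: lerXn2r; rewrite ?nnegrE ?cabs_ge0// ltW.
Qed.

(** The indicator of nearness to generation j is replaced by the sum of the
    squared kernels of that generation, whose mean values are computed by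
    Parseval.  The level used at z is the last one to which z is near. *)
Lemma cabs_copeak'_sum N z : cabs z <= 1 ->
  cabs (copeak' N z) ^+ 2 <= copeak_deriv_cst * near_cst ^+ 2 *
    \sum_(0 <= j < N.+1) (64 * xi ^+ 2) ^+ j * \sum_(I <- ci j) cabs (den j I.1 z) ^- 2.
Proof.
move=> z1.
have ex : exists j, (j <= N)%N && near_level j z by exists 0%N; rewrite leq0n near_level0.
have ub j : (j <= N)%N && near_level j z -> (j <= N)%N by case/andP.
have [j /andP[jN nj] jmax] := ex_maxnP ex ub.
have nn : (j < N)%N ==> ~~ near_level j.+1 z.
  by apply/implyP => jN'; apply/negP => h; have := jmax j.+1; rewrite jN' h ltnn => /(_ isT).
apply: le_trans (cabs_copeak' z1 jN nj nn) _; rewrite -mulrA.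
have Bf0 : 0 <= copeak_deriv_cst by rewrite exprn_ge0// mulr_ge0 ?exprn_ge0 ?ltW ?pole_deriv_cst_gt0 ?near_cst_gt0.
rewrite ler_wpM2l// (bigD1_seq j) ?mem_index_iota ?iota_uniq//=.
have nneg i : 0 <= (64 * xi ^+ 2) ^+ i * \sum_(I <- ci i) cabs (den i I.1 z) ^- 2.
  rewrite mulr_ge0 ?exprn_ge0 ?mulr_ge0 ?exprn_ge0 ?(ltW xi_gt0)// sumr_ge0// => I _.
  by rewrite invr_ge0 exprn_ge0 ?cabs_ge0.
rewrite mulrDr -[leLHS]addr0 lerD//; last first.
  by rewrite mulr_ge0 ?exprn_ge0 ?(ltW near_cst_gt0)// sumr_ge0.
move/hasP: nj => [I Ij dI]; rewrite (big_rem I)//= exprMn mulrCA -mulrA.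
rewrite -[leLHS]mulr1 ler_wpM2l ?exprn_ge0//.
have d0 : 0 < cabs (den j I.1 z) by apply: lt_le_trans (cabs_den j I.1 z1); exact: xiX_gt0.
have h : 1 <= near_cst ^+ 2 * (xi ^+ 2) ^+ j * cabs (den j I.1 z) ^- 2.
  rewrite ler_pdivlMr ?exprn_gt0// mul1r.
  have -> : near_cst ^+ 2 * (xi ^+ 2) ^+ j = (near_cst * xi ^+ j) ^+ 2 by rewrite [in RHS]exprMn -!exprM mulnC.
  by apply: lerXn2r; rewrite ?nnegrE ?cabs_ge0// mulr_ge0 ?ltW ?near_cst_gt0 ?xiX_gt0.
apply: le_trans h _.
set D := cabs _ ^- 2; set S := \sum_(y <- _) _.
have S0 : 0 <= S by rewrite sumr_ge0// => J _; rewrite invr_ge0 exprn_ge0 ?cabs_ge0.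
rewrite [leRHS](_ : _ = near_cst ^+ 2 * (xi ^+ 2) ^+ j * D + near_cst ^+ 2 * (xi ^+ 2) ^+ j * S).
  by rewrite lerDl !mulr_ge0 ?exprn_ge0 ?(ltW near_cst_gt0) ?(ltW xi_gt0).
by ring.
Qed.

End kernels.

(** * Mean square bounds on the circle *)

Section parsevalR.
Variable R : realType.
Local Notation C := R[i].
Local Notation cabs := (@cabs R).

Lemma cexp_prim_root M : (0 < M)%N -> M.-primitive_root (cexp (M%:R^-1 : R)).
Proof.
move=> M0; have Mn0 : M%:R != 0 :> R by rewrite pnatr_eq0 -lt0n.
rewrite /primitive_root_of_unity M0 /=; apply/forallP => i; apply/eqP.
rewrite unity_rootE -cexpMn; apply/eqP/eqP => [|->]; last by rewrite divff// cexp1.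
have := ltn_ord i; rewrite leq_eqVlt => /predU1P[//|iM].
rewrite -(cexp0 R) => /cexp_inj01; rewrite lexx ltr01 divr_ge0//=.
rewrite ltr_pdivrMr ?ltr0n// mul1r ltr_nat iM => /(_ isT isT)/eqP.
by rewrite mulf_eq0 invr_eq0 (negbTE Mn0) orbF pnatr_eq0.
Qed.

Lemma parsevalR M (p : {poly C}) : (0 < M)%N -> (size p <= M)%N ->
  \sum_(i < M) cabs p.[cexp M%:R^-1 ^+ i] ^+ 2 =
  M%:R * \sum_(n < M) cabs p`_n ^+ 2.
Proof.
move=> M0 sp; apply/complexI.
rewrite rmorphM rmorph_nat !rmorph_sum /=.
transitivity (\sum_(i < M) `|p.[cexp M%:R^-1 ^+ i]| ^+ 2).
  by apply: eq_bigr => i _; rewrite cabsE rmorphXn.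
rewrite (parseval (cexp_prim_root M0) sp); congr (_ * _).
by apply: eq_bigr => i _; rewrite cabsE rmorphXn.
Qed.

(** This is the Cauchy estimate on the circle of radius 1/2, from Parseval for
    p (z / 2). *)
Lemma coef_bound (p : {poly C}) (b : R) n :
  (forall z, cabs z <= 2^-1 -> cabs p.[z] <= b) -> cabs p`_n <= 2 ^+ n * b.
Proof.
move=> pb; have b0 : 0 <= b.
  by apply: le_trans (cabs_ge0 _) (pb 0 _); rewrite cabs0 invr_ge0.
pose M := (maxn n (size p)).+1.
pose q := \poly_(i < size p) (p`_i * (2^-1)%:C ^+ i).
have sq : (size q <= M)%N.
  by apply: leq_trans (size_poly _ _) _; rewrite /M; lia.
have := parsevalR (ltn0Sn _) sq.
have M0 : 0 < M%:R :> R by rewrite ltr0n.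
have nM : (n < M)%N by rewrite /M; lia.
have qn : cabs q`_n = cabs p`_n * 2^-1 ^+ n.
  rewrite coef_poly; case: ltnP => h; last by rewrite nth_default// cabs0 mul0r.
  by rewrite cabsM cabsX cabs_real ger0_norm.
have le1 : cabs q`_n ^+ 2 <= \sum_(i < M) cabs q`_i ^+ 2.
  rewrite (bigD1 (Ordinal nM))//= lerDl sumr_ge0// => i _.
  by rewrite exprn_ge0 ?cabs_ge0.
have le2 : \sum_(i < M) cabs q.[cexp M%:R^-1 ^+ i] ^+ 2 <= M%:R * b ^+ 2.
  have -> : M%:R * b ^+ 2 = \sum_(i < M) b ^+ 2.
    by rewrite sumr_const card_ord mulr_natl.
  apply: ler_sum => i _; apply: lerXn2r; rewrite ?nnegrE ?cabs_ge0//.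
  rewrite horner_poly.
  have -> : \sum_(j < size p) p`_j * (2^-1)%:C ^+ j * (cexp M%:R^-1 ^+ i) ^+ j =
     p.[(2^-1)%:C * cexp M%:R^-1 ^+ i].
    by rewrite horner_coef; apply: eq_bigr => j _; rewrite exprMn mulrA.
  by apply: pb; rewrite cabsM cabsX cabs_cexp expr1n mulr1 cabs_real ger0_norm.
move=> E; rewrite E ler_pM2l// in le2.
have : cabs q`_n <= b.
  rewrite -(@ler_pXn2r _ 2) ?nnegrE ?cabs_ge0//; exact: le_trans le1 le2.
by rewrite qn exprVn ler_pdivrMr ?exprn_gt0// mulrC.
Qed.

End parsevalR.

Section approx.
Variables (R : realType) (xi : R).
Hypothesis xi_small : 0 < xi <= 256^-1.
Local Notation C := R[i].
Local Notation cabs := (@cabs R).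
Local Notation ci := (cantor_intervals xi).
Local Notation den := (den xi).

(** On M-th roots of unity the kernel 1 / (1 - a w) equals its truncation to
    degree M - 1 divided by 1 - a ^ M, and Parseval gives the mean square of the
    truncation. *)
Lemma mean_den (M k : nat) (c : R) : (0 < M)%N -> (1 - xi ^+ k) ^+ M <= 2^-1 ->
  \sum_(i < M) cabs (den k c (cexp M%:R^-1 ^+ i)) ^- 2 <= 4 * M%:R * xi ^- k.
Proof.
move=> M0 rM.
have r0 : 0 <= 1 - xi ^+ k by rewrite subr_ge0 xiX_le1.
have r1 : 1 - xi ^+ k < 1 by rewrite gtrBl xiX_gt0.
pose a : C := (1 - xi ^+ k)%:C * cexp (- c).
have ca : cabs a = 1 - xi ^+ k by exact: cabs_rho.
have dE w : den k c w = 1 - a * w by [].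
clearbody a.
pose p := \poly_(n < M) a ^+ n.
have sp : (size p <= M)%N by exact: size_poly.
have w1 i : (cexp M%:R^-1 ^+ i) ^+ M = 1 :> C.
  by rewrite exprAC (prim_expr_order (cexp_prim_root R M0)) expr1n.
have cw i : cabs (cexp M%:R^-1 ^+ i) <= 1 by rewrite cabsX cabs_cexp expr1n.
have bnd i : cabs (den k c (cexp M%:R^-1 ^+ i)) ^- 2 <=
    4 * cabs p.[cexp M%:R^-1 ^+ i] ^+ 2.
  set w := cexp _ ^+ i.
  have E : den k c w * p.[w] = 1 - a ^+ M.
    rewrite horner_poly.
    have -> : \sum_(j < M) a ^+ j * w ^+ j = \sum_(j < M) (a * w) ^+ j.
      by apply: eq_bigr => j _; rewrite exprMn.
    have -> : den k c w = - (a * w - 1) by rewrite dE opprB.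
    by rewrite mulNr -subrX1 exprMn w1 mulr1 opprB.
  have d0 : 0 < cabs (den k c w) by apply: lt_le_trans (cabs_den xi_small k c (cw i)); rewrite xiX_gt0.
  have h : 2^-1 <= cabs (den k c w) * cabs p.[w].
    rewrite -cabsM E; have := cabs_distD 1 (a ^+ M) 0.
    by rewrite !subr0 cabs1 cabsX ca; lra.
  rewrite -exprVn; have -> : 4 * cabs p.[w] ^+ 2 = (2 * cabs p.[w]) ^+ 2 by ring.
  apply: lerXn2r; rewrite ?nnegrE ?mulr_ge0 ?invr_ge0 ?cabs_ge0//.
  by rewrite -[leLHS]mul1r ler_pdivrMr//; lra.
apply: (@le_trans _ _ (\sum_(i < M) 4 * cabs p.[cexp M%:R^-1 ^+ i] ^+ 2)).
  by apply: ler_sum => i _; exact: bnd.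
rewrite -mulr_sumr (parsevalR M0 sp) -!mulrA !ler_pM2l ?ltr0n//.
have -> : \sum_(n < M) cabs p`_n ^+ 2 = \sum_(n < M) ((1 - xi ^+ k) ^+ 2) ^+ n.
  by apply: eq_bigr => n _; rewrite coef_poly ltn_ord cabsX ca -!exprM mulnC.
set r := 1 - xi ^+ k in r0 r1 *.
have -> : xi ^- k = (1 - r)^-1 by rewrite /r subKr.
have r2 : r ^+ 2 <= r by rewrite expr2 -[leRHS]mulr1 ler_wpM2l// ltW.
have r20 : 0 < 1 - r by lra.
apply: (@le_trans _ _ (\sum_(n < M) r ^+ n)).
  by apply: ler_sum => n _; apply: lerXn2r; rewrite ?nnegrE ?exprn_ge0.
rewrite -[leRHS]mul1r ler_pdivlMr// mulrC -opprB mulNr -subrX1 opprB.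
by rewrite gerBl exprn_ge0.
Qed.

(** The factor 8 is 4 from [mean_den] times 2 from the geometric series. *)
Definition copeak_mean_cst : R := copeak_deriv_cst xi * near_cst R ^+ 2 * 8.

(** The term of generation j contributes at most a multiple of
    64 ^ j 2 ^ j xi ^ (2 j) xi ^ (-j) = (128 xi) ^ j <= 2 ^ (-j). *)
Lemma copeak'_mean N M : (0 < M)%N -> (1 - xi ^+ N) ^+ M <= 2^-1 ->
  \sum_(i < M) cabs (copeak' xi N (cexp M%:R^-1 ^+ i)) ^+ 2 <= M%:R * copeak_mean_cst.
Proof.
move=> M0 rM.
have Bf0 : 0 <= copeak_deriv_cst xi * near_cst R ^+ 2 by rewrite mulr_ge0 ?exprn_even_ge0.
have cw i : cabs (cexp (M%:R^-1 : R) ^+ i) <= 1 by rewrite cabsX cabs_cexp expr1n.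
apply: (@le_trans _ _ (\sum_(i < M) (copeak_deriv_cst xi * near_cst R ^+ 2 *
    \sum_(0 <= j < N.+1) (64 * xi ^+ 2) ^+ j *
      \sum_(I <- ci j) cabs (den j I.1 (cexp M%:R^-1 ^+ i)) ^- 2))).
  by apply: ler_sum => i _; exact: cabs_copeak'_sum.
rewrite -mulr_sumr exchange_big /= /copeak_mean_cst [leRHS]mulrCA ler_wpM2l//.
apply: (@le_trans _ _ (\sum_(0 <= j < N.+1) M%:R * 4 * 2^-1 ^+ j)); last first.
  rewrite -mulr_sumr -mulrA ler_pM2l ?ltr0n//.
  rewrite big_nat_recl// expr0.
  have -> : \sum_(0 <= i < N) 2^-1 ^+ i.+1 = \sum_(1 <= k < N.+1) 2^-1 ^+ k :> R.
    by rewrite big_add1.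
  have := @sum_half_dec R 0 N (leq0n _); have : 0 <= 2^-1 ^+ N :> R by rewrite exprn_ge0.
  rewrite expr0; lra.
rewrite big_nat_cond [leRHS]big_nat_cond; apply: ler_sum => j /andP[/andP[_ jN] _].
rewrite -mulr_sumr exchange_big /=.
have x0 := xi_gt0 xi_small.
have h I : I \in ci j -> \sum_(i < M) cabs (den j I.1 (cexp M%:R^-1 ^+ i)) ^- 2 <=
    4 * M%:R * xi ^- j.
  move=> _; apply: mean_den => //; apply: le_trans rM.
  apply: lerXn2r; rewrite ?nnegrE ?subr_ge0 ?xiX_le1//.
  by rewrite lerD2l lerN2 xiX_mono.
have s0 : 0 <= (64 * xi ^+ 2) ^+ j by rewrite exprn_ge0// mulr_ge0// exprn_ge0// ltW.
apply: (@le_trans _ _ ((64 * xi ^+ 2) ^+ j * (2 ^+ j * (4 * M%:R * xi ^- j)))).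
  by rewrite ler_wpM2l//; exact: (sum_ci_le h).
have -> : (64 * xi ^+ 2) ^+ j * (2 ^+ j * (4 * M%:R * xi ^- j)) =
    M%:R * 4 * (128 * xi) ^+ j.
  have -> : (128 * xi) ^+ j = (64 * xi ^+ 2) ^+ j * 2 ^+ j * xi ^- j.
    rewrite -exprVn -!exprMn; congr (_ ^+ _); field; exact: lt0r_neq0.
  by ring.
rewrite ler_pM2l ?mulr_gt0 ?ltr0n//; apply: lerXn2r; rewrite ?nnegrE ?mulr_ge0 ?(ltW x0)//.
by have := xi_le xi_small; lra.
Qed.

Lemma approx_poly N : exists p : {poly C},
  (forall z, cabs z <= 1 -> cabs (copeak xi N z - p.[z]) <= 2^-1 ^+ N) /\
  (forall K, \sum_(n < K) (n.+1%:R * cabs p`_n.+1) ^+ 2 <= 2 * copeak_mean_cst + 2).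
Proof.
have e0 : 0 < 2^-1 ^+ N :> R by rewrite exprn_gt0.
have [p pP] := C1poly_copeak xi_small N e0; exists p; split => [z z1|K].
  by case: (pP z z1).
have [||M1 HM1] := @expr_lt_eps R (1 - xi ^+ N) 2^-1.
- by rewrite subr_ge0 xiX_le1//= gtrBl xiX_gt0.
- by rewrite invr_gt0.
(* The order M exceeds the degree, so Parseval is exact, and it makes
   (1 - xi ^ N) ^ M small, as the mean estimates require. *)
pose M := (maxn K (maxn M1 (size p))).+1.
have M0 : (0 < M)%N by [].
have KM : (K <= M)%N by rewrite /M; lia.
have rM : (1 - xi ^+ N) ^+ M <= 2^-1 by apply/ltW/HM1; rewrite /M; lia.
have sp : (size p^`() <= M)%N.
  have [->|p0] := eqVneq p 0; first by rewrite deriv0 size_poly0.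
  by apply: leq_trans (ltnW (lt_size_deriv p0)) _; rewrite /M; lia.
have P := parsevalR M0 sp.
have Mp : 0 < M%:R :> R by rewrite ltr0n.
apply: (@le_trans _ _ (\sum_(n < M) cabs p^`()`_n ^+ 2)).
  rewrite (big_ord_widen _ (fun n => (n.+1%:R * cabs p`_n.+1) ^+ 2) KM) big_mkcond /=.
  apply: ler_sum => n _; case: ifP => _; last by rewrite exprn_ge0 ?cabs_ge0.
  rewrite coef_deriv -[p`_n.+1 *+ _]mulr_natl cabsM -(rmorph_nat (real_complex R)) cabs_real.
  by rewrite normr_nat.
rewrite -(ler_pM2l Mp) -P.
have cw i : cabs (cexp (M%:R^-1 : R) ^+ i) <= 1 by rewrite cabsX cabs_cexp expr1n.
apply: (@le_trans _ _ (\sum_(i < M) (2 * cabs (copeak' xi N (cexp M%:R^-1 ^+ i)) ^+ 2 + 2))).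
  apply: ler_sum => i _; have [_ h] := pP _ (cw i).
  have h1 : 2^-1 ^+ N <= 1 :> R by rewrite exprn_ile1// invf_le1// ler1n.
  set w := _ ^+ i in h *.
  have := cabs_distD p^`().[w] (copeak' xi N w) 0; rewrite !subr0 cabsB.
  have := cabs_ge0 p^`().[w]; have := cabs_ge0 (copeak' xi N w).
  have := cabs_ge0 (copeak' xi N w - p^`().[w]).
  set x := cabs _ in h *; set y := cabs _; set t := cabs _ => x0 y0 t0 ht.
  have : t ^+ 2 <= (x + y) ^+ 2 by apply: lerXn2r => //; rewrite nnegrE addr_ge0.
  have x1 : x ^+ 2 <= 1 by rewrite exprn_ile1//; exact: le_trans h h1.
  have := sqr_ge0 (x - y); rewrite sqrrB sqrrD !mulr2n; lra.
rewrite big_split /= -mulr_sumr sumr_const card_ord -mulr_natl.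
have := copeak'_mean M0 rM; nra.
Qed.

(** On the disc of radius 1/2 the kernels are bounded by 2, so the tails of G_N
    are small there; this suffices to make the Taylor coefficients converge. *)
Lemma copeak_close N N' z : cabs z <= 2^-1 -> (N <= N')%N ->
  cabs (copeak xi N z - copeak xi N' z) <= 2 * 2^-1 ^+ N.
Proof.
move=> z2 NN'; have z1 : cabs z <= 1 by apply: le_trans z2 _; lra.
have g1 := cabs_1D_pole_sum xi_small N z1; have g2 := cabs_1D_pole_sum xi_small N' z1.
have n1 : 1 + pole_sum xi N z != 0 by rewrite -cabs_gt0 (lt_le_trans _ g1).
have n2 : 1 + pole_sum xi N' z != 0 by rewrite -cabs_gt0 (lt_le_trans _ g2).
have -> : copeak xi N z - copeak xi N' z =
    (pole_sum xi N' z - pole_sum xi N z) * ((1 + pole_sum xi N z)^-1 * (1 + pole_sum xi N' z)^-1).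
  by rewrite /copeak; field; rewrite n1 n2.
rewrite cabsM -[leRHS]mulr1 ler_pM ?cabs_ge0//; last first.
  by rewrite cabsM !cabsV mulr_ile1 ?invr_ge0 ?cabs_ge0// invf_le1// (lt_le_trans _ g1, lt_le_trans _ g2).
have -> : pole_sum xi N' z - pole_sum xi N z = \sum_(N.+1 <= k < N'.+1) pole_level xi k z.
  by rewrite /pole_sum (@big_cat_nat _ _ _ N.+1 0 N'.+1)//= addrAC subrr add0r.
apply: le_trans (cabs_sum _ _ _) _.
apply: (@le_trans _ _ (\sum_(N.+1 <= k < N'.+1) 2 * 2^-1 ^+ k)).
  apply: ler_sum => k _; rewrite cabsM cabs_real ger0_norm ?(ltW (weight_gt0 R k))//.
  have -> : 2^-1 ^+ k = weight R k * 2 ^+ k :> R.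
    rewrite -exprMn; congr (_ ^+ k); by lra.
  rewrite mulrCA ler_pM2l ?weight_gt0// mulrC; apply: le_trans (cabs_sum _ _ _) _.
  apply: sum_ci_le => I _.
  rewrite cabsV -[leRHS]invrK lef_pV2 ?posrE//; last first.
    by apply: lt_le_trans (cabs_den xi_small _ _ z1); rewrite xiX_gt0.
  have := cabs_distD 1 ((1 - xi ^+ k)%:C * cexp (- I.1) * z) 0.
  rewrite !subr0 cabs1 cabsM cabs_rho// -/(den k I.1 z) => h.
  have := xiX_gt0 xi_small k; have := xiX_le1 xi_small k; have := cabs_ge0 z; nra.
rewrite -mulr_sumr ler_pM2l//; apply: le_trans (@sum_half_dec R _ _ NN') _.
by rewrite gerBl exprn_ge0.
Qed.

End approx.

(** * Absolutely convergent power series *)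

Section series.
Variable R : realType.
Local Notation C := R[i].
Local Notation cabs := (@cabs R).

Lemma rcauchy_cvg (u : nat -> R) :
  (forall e, 0 < e -> exists N, forall n, (N <= n)%N -> `|u n - u N| < e) ->
  exists l : R, u @ \oo --> l.
Proof.
move=> H; apply/cvg_ex/cauchy_cvgP/cauchy_exP => e e0.
have [N HN] := H e e0; exists (u N); exists N => // n Nn.
by rewrite /= /ball/= distrC; exact: HN.
Qed.

Lemma ccauchy_cvg (u : nat -> C) :
  (forall e, 0 < e -> exists N, forall n, (N <= n)%N -> cabs (u n - u N) < e) ->
  exists l : C, u @ \oo --> l.
Proof.
move=> H.
have [|x Hx] := @rcauchy_cvg (fun n => complex.Re (u n)).
  move=> e /H[N HN]; exists N => n /HN; apply: le_lt_trans.
  by rewrite -cReN -cReD Re_le_cabs.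
have [|y Hy] := @rcauchy_cvg (fun n => complex.Im (u n)).
  move=> e /H[N HN]; exists N => n /HN; apply: le_lt_trans.
  by rewrite -cImN -cImD Im_le_cabs.
by exists (x +i* y); apply/ccvgReIm.
Qed.

Lemma ccvg_unique (u : nat -> C) (l l' : C) : u @ \oo --> l -> u @ \oo --> l' -> l = l'.
Proof. by move=> ul ul'; apply: (cvg_unique _ ul ul'). Qed.

Lemma rcvg_le (u : nat -> R) (l D : R) : u @ \oo --> l -> (forall n, u n <= D) -> l <= D.
Proof.
move=> /rcvgP ul uD; rewrite leNgt; apply/negP => Dl.
have [|N /(_ _ (leqnn N))] := ul (l - D); first by rewrite subr_gt0.
rewrite distrC => h; have := le_lt_trans (ler_norm _) h; have := uD N; lra.
Qed.

Lemma rcvg_sum (f : nat -> nat -> R) (g : nat -> R) L :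
  (forall n, (fun N => f N n) @ \oo --> g n) ->
  (fun N => \sum_(0 <= n < L) f N n) @ \oo --> \sum_(0 <= n < L) g n.
Proof.
move=> fg; elim: L => [|L IH].
  by under eq_fun do rewrite big_geq//; rewrite big_geq//; exact: cvg_cst.
under eq_fun do rewrite big_nat_recr//=.
by rewrite big_nat_recr//=; apply: cvgD.
Qed.

Lemma cabs_dist_dist (x y : C) : `|cabs x - cabs y| <= cabs (x - y).
Proof.
have := cabs_distD x y 0; have := cabs_distD y x 0.
by rewrite !subr0 [cabs (y - x)]cabsB ler_norml; lra.
Qed.

Lemma ccvg_cabs (u : nat -> C) (l : C) : u @ \oo --> l -> (fun n => cabs (u n)) @ \oo --> cabs l.
Proof.
move=> /ccvgP ul; apply/rcvgP => e /ul[N H]; exists N => n /H.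
exact/le_lt_trans/cabs_dist_dist.
Qed.

Lemma bounded_tail (u : nat -> R) B : (forall n, 0 <= u n) ->
  (forall L, \sum_(0 <= n < L) u n <= B) ->
  forall e, 0 < e -> exists K, forall L, \sum_(K <= n < L) u n < e.
Proof.
move=> u0 uB e e0.
have /cvg_ex[l /rcvgP] : cvgn (series u).
  apply: nondecreasing_is_cvgn.
    by apply: nondecreasing_series => n _ _; exact: u0.
  by exists B => _ [n _ <-]; exact: uB.
have e20 : 0 < e / 2 by rewrite divr_gt0.
move=> /(_ _ e20)[K HK]; exists K => L.
have [LK|KL] := leqP L K; first by rewrite big_geq.
have := HK K (leqnn K); have := HK L (ltnW KL).
have -> : series u L = series u K + \sum_(K <= n < L) u n.
  by rewrite /series /= (@big_cat_nat _ _ _ K)//= ltnW.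
rewrite !ltr_norml => /andP[_ h1] /andP[h2 _]; lra.
Qed.

(** Bounded partial sums of moduli: the form of membership in ell1 that is
    convenient in estimates. *)
Definition abs_summable (a : nat -> C) := exists B, forall L, \sum_(0 <= n < L) cabs (a n) <= B.

Lemma abs_summable_tail a : abs_summable a -> forall e : R, 0 < e ->
  exists K, forall L, \sum_(K <= n < L) cabs (a n) < e.
Proof. by move=> [B aB]; apply: bounded_tail aB => n; exact: cabs_ge0. Qed.

Lemma abs_summable_cvg a : abs_summable a -> series a @ \oo --> limn (series a).
Proof.
move=> aB; suff [l H] : exists l : C, series a @ \oo --> l.
  by apply/cvg_ex; exists l.
apply: ccauchy_cvg => e /(abs_summable_tail aB)[K HK]; exists K => n Kn.
have -> : series a n = series a K + \sum_(K <= i < n) a i.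
  by rewrite /series /= (@big_cat_nat _ _ _ K).
rewrite addrAC subrr add0r; apply: le_lt_trans (HK n); exact: cabs_sum.
Qed.

Lemma abs_summable_le (a b : nat -> C) : abs_summable a -> (forall n, cabs (b n) <= cabs (a n)) -> abs_summable b.
Proof.
by move=> [B aB] ba; exists B => L; apply: le_trans (aB L); apply: ler_sum.
Qed.

Lemma ell1P a : @ell1 R a <-> abs_summable a.
Proof.
have E n : series (fun n => `|a n|) n = (\sum_(0 <= i < n) cabs (a i))%:C.
  by rewrite /series /= rmorph_sum; apply: eq_bigr => i _; rewrite cabsE.
split=> [/cvg_ex[/= l /ccvgReIm[/rcvgP lr _]]|aB].
  exists (complex.Re l) => L; rewrite leNgt; apply/negP => h.
  have [|N HN] := lr (\sum_(0 <= n < L) cabs (a n) - complex.Re l); first by rewrite subr_gt0.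
  have := HN (maxn N L) (leq_maxl _ _); rewrite E /=.
  rewrite (@big_cat_nat _ _ _ L)//= ?leq_maxr//.
  have : 0 <= \sum_(L <= i < maxn N L) cabs (a i) by rewrite sumr_ge0// => i _; exact: cabs_ge0.
  set x := \sum_(L <= _ < _) _ => x0 /(le_lt_trans (ler_norm _)); lra.
rewrite /ell1 /=; apply/cvg_ex.
have [|l H] := @ccauchy_cvg (series (fun n => `|a n|)); last by exists l.
move=> e /(abs_summable_tail aB)[K HK]; exists K => n Kn.
rewrite !E -rmorphB cabs_real (@big_cat_nat _ _ _ K 0 n)//= addrAC subrr add0r.
by rewrite ger0_norm ?HK// sumr_ge0// => i _; exact: cabs_ge0.
Qed.

Lemma abs_summable_wiener a z : abs_summable a -> cabs z <= 1 -> abs_summable (fun n => a n * z ^+ n).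
Proof.
move=> aB z1; apply: abs_summable_le aB _ => n; rewrite cabsM cabsX ler_piMr ?cabs_ge0//.
by rewrite exprn_ile1 ?cabs_ge0.
Qed.

Lemma wiener_cvg a z : abs_summable a -> cabs z <= 1 ->
  series (fun n => a n * z ^+ n) @ \oo --> wiener_fun a z.
Proof. by move=> aB z1; apply: abs_summable_cvg; exact: abs_summable_wiener. Qed.

(** By Parseval, a bound on the square mean of the derivative of the power
    series with coefficients u. *)
Definition deriv_l2_le (D : R) (u : nat -> C) :=
  forall L, \sum_(0 <= n < L) (n%:R * cabs (u n)) ^+ 2 <= D.

Lemma sum_inv_sqr K m : (0 < K)%N ->
  \sum_(K.+1 <= n < K.+1 + m) n%:R ^- 2 <= K%:R^-1 - (K + m)%:R^-1 :> R.
Proof.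
move=> K0; elim: m => [|m IH]; first by rewrite !addn0 subrr big_geq.
rewrite addnS big_nat_recr ?leq_addr//= addSn addnS.
apply: le_trans (lerD IH (lexx _)) _.
have n0 : 0 < (K + m)%:R :> R by rewrite ltr0n; lia.
rewrite -natr1; set x := _%:R in n0 *; rewrite -addrA lerD2l.
have x1 : 0 < x + 1 by lra.
have -> : - x^-1 + (x + 1) ^- 2 = - (x + 1)^-1 - (x * (x + 1) ^+ 2)^-1.
  have xn := lt0r_neq0 n0; have x1n := lt0r_neq0 x1.
  by field; rewrite -natrD xn x1n.
by rewrite gerDl oppr_le0 invr_ge0 mulr_ge0 ?exprn_ge0// ltW.
Qed.

(** The inequality |u n| <= (t (n |u n|)^2 + 1 / (t n^2)) / 2, with t small and then
    K large, replaces Cauchy-Schwarz; the tail is small uniformly in u. *)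
Lemma deriv_l2_tail D e : 0 < e -> exists K, forall u, deriv_l2_le D u ->
  forall L, \sum_(K <= n < L) cabs (u n) <= e.
Proof.
move=> e0; have [D0|D0] := ltP D 0.
  exists 0%N => u /(_ 0%N); rewrite big_geq// => h.
  by have := le_lt_trans h D0; rewrite ltxx.
pose t := e / (D + 1); have t0 : 0 < t by rewrite divr_gt0//; lra.
have tD : t * D <= e by rewrite /t mulrAC ler_pdivrMr; nra.
clearbody t.
pose K := (Num.truncn (t * e)^-1).+1.
have K0 : 0 < K%:R :> R by rewrite ltr0n.
have hK : K%:R^-1 <= t * e.
  rewrite -[leRHS]invrK lef_pV2 ?posrE ?invr_gt0 ?mulr_gt0//.
  by apply/ltW; rewrite /K; apply: Num.Theory.truncnS_gt.
exists K.+1 => u uD L.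
have [LK|KL] := leqP L K.+1; first by rewrite big_geq// ltW.
apply: (@le_trans _ _ (\sum_(K.+1 <= n < L) 2^-1 * (t * (n%:R * cabs (u n)) ^+ 2 + t^-1 * n%:R ^- 2))).
  rewrite big_nat_cond [leRHS]big_nat_cond; apply: ler_sum => n /andP[/andP[nK _] _].
  have n0 : 0 < n%:R :> R by rewrite ltr0n; lia.
  set x := cabs (u n).
  have : 0 <= t * (n%:R * x - t^-1 * n%:R^-1) ^+ 2 by rewrite mulr_ge0 ?sqr_ge0// ltW.
  have -> : t * (n%:R * x - t^-1 * n%:R^-1) ^+ 2 =
     t * (n%:R * x) ^+ 2 + t^-1 * n%:R ^- 2 - 2 * x.
    have nn := lt0r_neq0 n0; have tn := lt0r_neq0 t0.
    by field; rewrite ?nn ?tn.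
  lra.
rewrite -mulr_sumr big_split /= -!mulr_sumr.
have h1 : t * \sum_(K.+1 <= n < L) (n%:R * cabs (u n)) ^+ 2 <= e.
  apply: le_trans tD; rewrite ler_pM2l//; apply: le_trans (uD L).
  rewrite [leRHS](@big_cat_nat _ _ _ K.+1)//= ?(ltnW KL)// lerDr sumr_ge0// => n _.
  by rewrite exprn_ge0// mulr_ge0// cabs_ge0.
have h2 : t^-1 * \sum_(K.+1 <= n < L) n%:R ^- 2 <= e.
  rewrite mulrC ler_pdivrMr// mulrC; apply: le_trans hK.
  have := @sum_inv_sqr K (L - K.+1) isT; rewrite subnKC ?(ltnW KL)// => h.
  by apply: le_trans h _; rewrite gerBl invr_ge0.
lra.
Qed.

Lemma deriv_l2_abs_summable D u : deriv_l2_le D u -> abs_summable u.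
Proof.
move=> uD; have [K /(_ u uD) HK] := deriv_l2_tail D (@ltr01 R).
exists (\sum_(0 <= n < K) cabs (u n) + 1) => L.
have s0 m n : 0 <= \sum_(m <= i < n) cabs (u i) by rewrite sumr_ge0// => i _; exact: cabs_ge0.
have [LK|KL] := leqP L K.
  by rewrite [in leRHS](@big_cat_nat _ _ _ L)//=; have := s0 L K; lra.
by rewrite (@big_cat_nat _ _ _ K)//= ?(ltnW KL)// lerD2l.
Qed.

(** Coefficientwise convergence together with uniformly small tails gives
    convergence at every point of the closed disc. *)
Lemma deriv_l2_poly_cvg D (p : nat -> {poly C}) (a : nat -> C) (z : C) :
  (forall N, deriv_l2_le D (fun n => (p N)`_n)) -> deriv_l2_le D a ->
  (forall n, (fun N => (p N)`_n) @ \oo --> a n) -> cabs z <= 1 ->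
  (fun N => (p N).[z]) @ \oo --> wiener_fun a z.
Proof.
move=> pD aD pa z1; apply/ccvgP => e e0.
have e40 : 0 < e / 4 by rewrite divr_gt0.
have [K HK] := deriv_l2_tail D e40.
have zX n (x : C) : cabs (x * z ^+ n) <= cabs x.
  by rewrite cabsM cabsX ler_piMr ?cabs_ge0// exprn_ile1 ?cabs_ge0.
have : (fun N => \sum_(0 <= n < K) cabs ((p N)`_n - a n)) @ \oo --> \sum_(0 <= n < K) (0 : R).
  apply: rcvg_sum => n; rewrite -(cabs0 R); apply: ccvg_cabs.
  apply/ccvgP => d d0; have /ccvgP/(_ d d0)[N HN] := pa n.
  by exists N => m /HN; rewrite subr0.
rewrite big1 ?/rcvgP// => /rcvgP/(_ _ e40)[N HN]; exists N => m /HN.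
rewrite subr0 => /(le_lt_trans (ler_norm _)) Hm.
have [L HL] : exists L, cabs (series (fun n => a n * z ^+ n) (maxn K L) - wiener_fun a z) < e / 4.
  have /ccvgP/(_ _ e40)[L H] := wiener_cvg (deriv_l2_abs_summable aD) z1.
  by exists L; apply: H; exact: leq_maxr.
apply: le_lt_trans (cabs_distD _ (series (fun n => a n * z ^+ n) (maxn K L)) _) _.
have -> : (p m).[z] = \sum_(0 <= n < maxn K (size (p m))) (p m)`_n * z ^+ n.
  by rewrite big_mkord; apply: horner_coef_wide; exact: leq_maxr.
rewrite /series /= in HL *.
rewrite (@big_cat_nat _ _ _ K 0 (maxn K (size _)))//= ?leq_maxl//.
rewrite (@big_cat_nat _ _ _ K 0 (maxn K L))//= ?leq_maxl// in HL *.
set S1 := \sum_(0 <= i < K) _; set S2 := \sum_(K <= i < _) _.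
set T1 := \sum_(0 <= i < K) _ in HL *; set T2 := \sum_(K <= i < _) _ in HL *.
have h1 : cabs (S1 - T1) <= \sum_(0 <= n < K) cabs ((p m)`_n - a n).
  rewrite /S1 /T1 -sumrB; apply: le_trans (cabs_sum _ _ _) _; apply: ler_sum => n _.
  by rewrite -mulrBl zX.
have h2 : cabs S2 <= e / 4.
  apply: le_trans (cabs_sum _ _ _) _; apply: le_trans (HK _ (pD m) (maxn K (size (p m)))).
  by apply: ler_sum => n _; exact: zX.
have h3 : cabs T2 <= e / 4.
  apply: le_trans (cabs_sum _ _ _) _; apply: le_trans (HK _ aD (maxn K L)).
  by apply: ler_sum => n _; exact: zX.
have -> : S1 + S2 - (T1 + T2) = (S1 - T1) + (S2 - T2) by ring.
have := cabsD (S1 - T1) (S2 - T2); have := cabs_leB S2 T2; lra.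
Qed.

End series.

(** * The Cantor set is a peak set *)

Section cantor_topology.
Variables (R : realType) (xi : R).
Hypothesis xi01 : 0 < xi < 2^-1.

Lemma continuous_cexp : continuous (@cexp R).
Proof.
apply: continuous_Complex => t.
- apply: continuous_comp; last exact: continuous_cos.
  exact: mulrl_continuous.
- apply: continuous_comp; last exact: continuous_sin.
  exact: mulrl_continuous.
Qed.

Lemma closed_cantor_set : closed (cantor_set xi).
Proof.
apply: closed_bigI => n _; rewrite /cantor_approx big_tnth.
apply: closed_bigsetU => i _; exact: interval_closed.
Qed.

Lemma compact_cantor_set : compact (cantor_set xi).
Proof.
apply: (subclosed_compact closed_cantor_set (@segment_compact R 0 1)).
by move=> x /(cantor_set01 xi01); rewrite /= in_itv.
Qed.

Lemma closed_cantor_circle : closed (cantor_circle_set xi).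
Proof.
apply: compact_closed; first exact: norm_hausdorff.
apply: continuous_compact; last exact: compact_cantor_set.
apply: continuous_subspaceT => x; exact: continuous_cexp.
Qed.

End cantor_topology.

Section peak.
Variables (R : realType) (xi : R).
Hypothesis xi_small : 0 < xi <= 256^-1.
Local Notation C := R[i].
Local Notation cabs := (@cabs R).
Local Notation ci := (cantor_intervals xi).
Local Notation den := (den xi).
Let xi01 := xi_half xi_small.

(** The polynomials p_N close to F_N have coefficients which converge, by the
    Cauchy estimate on the circle of radius 1/2, and satisfy a common bound on
    the derivative. *)
Lemma copeak_limit : exists2 a : nat -> C, abs_summable a &
  forall z, cabs z <= 1 -> (fun N => copeak xi N z) @ \oo --> wiener_fun a z.
Proof.
have [p pP] := choice (approx_poly xi_small).
set D := 2 * copeak_mean_cst xi + 2 in pP.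
have pD N : deriv_l2_le D (fun n => (p N)`_n).
  have [_ H] := pP N; case=> [|L].
    by rewrite big_geq//; have := H 0%N; rewrite big_ord0.
  rewrite big_nat_recl//= mul0r expr0n add0r big_mkord; exact: H.
have close N N' z : cabs z <= 2^-1 -> (N <= N')%N ->
    cabs ((p N).[z] - (p N').[z]) <= 4 * 2^-1 ^+ N.
  move=> z2 NN'; have z1 : cabs z <= 1 by apply: le_trans z2 _; lra.
  have [h _] := pP N; have [h' _] := pP N'.
  have := cabs_distD (p N).[z] (copeak xi N z) (p N').[z].
  have := cabs_distD (copeak xi N z) (copeak xi N' z) (p N').[z].
  have := copeak_close xi_small z2 NN'; have := h z z1; have := h' z z1.
  rewrite [cabs (copeak xi N z - (p N).[z])]cabsB.
  have : 2^-1 ^+ N' <= 2^-1 ^+ N :> R.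
    by rewrite ler_wiXn2l// invf_le1// ler1n.
  lra.
have lim n : exists l : C, (fun N => (p N)`_n) @ \oo --> l.
  apply: ccauchy_cvg => e e0.
  have [||N HN] := @expr_lt_eps R 2^-1 (e / (2 ^+ n * 4)) _ _.
  - by rewrite invr_ge0 ler0n invf_lt1// ltr1n.
  - by rewrite divr_gt0// mulr_gt0// exprn_gt0.
  exists N => m Nm; rewrite cabsB -coefB.
  apply: (@le_lt_trans _ _ (2 ^+ n * (4 * 2^-1 ^+ N))).
    by apply: coef_bound => z z2; rewrite hornerD hornerN; exact: close.
  by have := HN N (leqnn N); rewrite ltr_pdivlMr ?mulr_gt0 ?exprn_gt0// mulrC -mulrA.
have [a aP] := choice lim.
have aD : deriv_l2_le D a.
  move=> L; apply: (@rcvg_le _ (fun N => \sum_(0 <= n < L) (n%:R * cabs (p N)`_n) ^+ 2)).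
    apply: rcvg_sum => n; have h : (fun N => n%:R * cabs (p N)`_n) @ \oo --> n%:R * cabs (a n).
      by apply: cvgMr; apply: ccvg_cabs; exact: aP.
    by apply: cvgM.
  by move=> N; exact: pD.
exists a => [|z z1]; first exact: deriv_l2_abs_summable aD.
have /ccvgP H := deriv_l2_poly_cvg pD aD aP z1.
apply/ccvgP => e e0; have e20 : 0 < e / 2 by rewrite divr_gt0.
have [N HN] := H _ e20.
have [||N' HN'] := @expr_lt_eps R 2^-1 (e / 2) _ _ => //.
  by rewrite invr_ge0 ler0n invf_lt1// ltr1n.
exists (maxn N N') => m; rewrite geq_max => /andP[/HN h1 /HN' h2].
have [/(_ z z1) h _] := pP m.
have := cabs_distD (copeak xi m z) (p m).[z] (wiener_fun a z); lra.
Qed.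

Lemma cantor_circle_near z k : cantor_circle_set xi z -> near_level xi k z.
Proof.
move=> [x xE <-]; have [I Ik /andP[a b]] := cantor_set_near xi01 k xE.
apply/hasP; exists I => //; rewrite -/(cexp x).
have -> : den k I.1 (cexp x) = (cexp 0 - cexp (x - I.1)) + (xi ^+ k)%:C * cexp (x - I.1).
  by rewrite /den cexp0 cexpD rmorphB /=; ring.
apply: le_trans (cabsD _ _) _; rewrite cabsM cabs_cexp mulr1 cabs_real.
have x0 := xiX_gt0 xi_small k.
have := lipschitz_cexp 0 (x - I.1); rewrite sub0r normrN !ger0_norm ?subr_ge0// ?(ltW x0)//.
have : cexp_lip R * (x - I.1) <= cexp_lip R * xi ^+ k by rewrite ler_pM2l ?cexp_lip_gt0//; lra.
rewrite /near_cst mulrDl; lra.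
Qed.

Lemma copeak_cvg0 z : cabs z <= 1 -> cantor_circle_set xi z ->
  (fun N => copeak xi N z) @ \oo --> (0 : C).
Proof.
move=> z1 zE; apply/ccvgP => e e0.
have x0 := xi_gt0 xi_small; have x1 := xi_le xi_small.
have K0 : 0 < near_cst R ^+ 2 by rewrite exprn_gt0 ?near_cst_gt0.
have [||N HN] := @expr_lt_eps R (4 * xi) (e / near_cst R ^+ 2) _ _.
- by rewrite mulr_ge0 ?(ltW x0)//=; lra.
- by rewrite divr_gt0.
exists N => n /HN; rewrite ltr_pdivlMr// => h; rewrite subr0; apply: le_lt_trans h.
have := near_pole_sum xi_small z1 (leqnn n) (cantor_circle_near n zE).
have q0 : 0 < (4 * xi) ^- n / near_cst R ^+ 2 by rewrite divr_gt0// invr_gt0 exprn_gt0// mulr_gt0.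
move=> h; have {}h : (4 * xi) ^- n / near_cst R ^+ 2 <= cabs (1 + pole_sum xi n z).
  apply: le_trans (le_trans (ler_norm _) (Re_le_cabs _)); rewrite cReD /=; lra.
rewrite /copeak cabsV -[leRHS]invrK lef_pV2 ?posrE ?(lt_le_trans q0)//.
  by rewrite [((4 * xi) ^+ n * _)^-1]invfM.
by rewrite [((4 * xi) ^+ n * _)^-1]invfM.
Qed.

(** Such a point is a limit of left endpoints, and the Cantor set is closed. *)
Lemma near_all_cantor z : (forall k, near_level xi k z) -> cantor_circle_set xi z.
Proof.
move=> nz; apply: (closed_cantor_circle xi01) => U.
move=> /nbhs_ballP[e /= e0 eU].
have eR : e = (complex.Re e)%:C by rewrite RRe_real// realE ltW.
have er0 : 0 < complex.Re e by rewrite -ltcR -eR.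
pose B := cabs z + near_cst R.
have B0 : 0 < B by rewrite ltr_wpDl ?cabs_ge0 ?near_cst_gt0.
have [||k Hk] := @expr_lt_eps R xi (complex.Re e / B).
- by rewrite (ltW (xi_gt0 xi_small)) (xi_lt1 xi_small).
- by rewrite divr_gt0.
have /hasP[I Ik dI] := nz k.
exists (cexp I.1); split.
  by exists I.1 => //; exact: cantor_left_in Ik.
apply: eU; rewrite -ball_normE /= cabsE eR ltcR.
have := Hk k (leqnn k); rewrite ltr_pdivlMr// => h; apply: le_lt_trans h.
rewrite cabsB.
have -> : cexp I.1 - z = cexp I.1 * (den k I.1 z - (xi ^+ k)%:C * cexp (- I.1) * z).
  rewrite /den rmorphB /= cexpN; have := cexp_neq0 I.1; set u := cexp I.1 => u0.
  by field.
rewrite cabsM cabs_cexp mul1r; apply: le_trans (cabs_leB _ _) _.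
rewrite !cabsM cabs_cexp mulr1 cabs_real ger0_norm ?(ltW (xiX_gt0 xi_small k))//.
by move: dI; rewrite /B mulrDr; lra.
Qed.

(** Beyond the first generation to which z is not near, the terms of G_N
    decrease geometrically, so |1 + G_N (z)| stays bounded. *)
Lemma copeak_away z : cabs z <= 1 -> ~ cantor_circle_set xi z ->
  exists2 c : R, 0 < c & forall N, c <= cabs (copeak xi N z).
Proof.
move=> z1 zE.
have [m nm] : exists m, ~~ near_level xi m z.
  apply: contrapT => H; apply: zE; apply: near_all_cantor => k.
  by apply: contrapT => /negP h; apply: H; exists k.
have x0 := xiX_gt0 xi_small m.
pose A := \sum_(0 <= k < m) cabs (pole_level xi k z) + xi ^- m * 2.
have A0 : 0 <= A.
  rewrite addr_ge0 ?mulr_ge0 ?invr_ge0 ?(ltW x0)// sumr_ge0// => k _.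
  exact: cabs_ge0.
have s0 i j : 0 <= \sum_(i <= k < j) cabs (pole_level xi k z).
  by rewrite sumr_ge0// => k _; exact: cabs_ge0.
have GA N : cabs (pole_sum xi N z) <= A.
  apply: le_trans (cabs_sum _ _ _) _.
  have [Nm|mN] := leqP N.+1 m.
    rewrite /A [X in _ <= X + _](@big_cat_nat _ _ _ N.+1)//= -addrA lerDl.
    by rewrite addr_ge0// mulr_ge0// invr_ge0 ltW.
  rewrite (@big_cat_nat _ _ _ m)//= ?(ltnW mN)// lerD2l.
  apply: (@le_trans _ _ (\sum_(m <= k < N.+1) 2^-1 ^+ k * xi ^- m)).
    rewrite big_nat_cond [leRHS]big_nat_cond; apply: ler_sum => k /andP[/andP[mk _] _].
    by apply: cabs_pole_level => // I Ik; exact: (not_near_den xi_small z1 nm mk Ik).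
  rewrite -mulr_suml mulrC ler_pM2l ?invr_gt0//.
  rewrite big_ltn//.
  have h : 2^-1 ^+ m <= 1 :> R by rewrite exprn_ile1// invf_le1// ler1n.
  have mN' : (m <= N)%N by rewrite -ltnS.
  have := @sum_half_dec R m N mN'.
  have : 0 <= 2^-1 ^+ N :> R by rewrite exprn_ge0.
  lra.
exists (1 + A)^-1 => [|N]; first by rewrite invr_gt0 ltr_wpDr.
rewrite /copeak cabsV lef_pV2 ?posrE ?ltr_wpDr//; last first.
  by apply: lt_le_trans (cabs_1D_pole_sum xi_small N z1).
by apply: le_trans (cabsD _ _) _; rewrite cabs1 lerD2l.
Qed.

(** This is the image of the half-plane Re w >= 1 under inversion. *)
Lemma copeak_disc N z : cabs z <= 1 -> cabs (copeak xi N z) ^+ 2 <= complex.Re (copeak xi N z).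
Proof.
move=> z1; rewrite /copeak cReV cabsV -exprVn mulrC -[leLHS]mulr1 ler_wpM2l ?exprn_ge0 ?invr_ge0 ?cabs_ge0//.
exact: Re_1D_pole_sum.
Qed.

(** For w = F (z) nonzero with |w|^2 <= Re w one has
    |1 - w|^2 = 1 - 2 Re w + |w|^2 <= 1 - |w|^2 < 1. *)
Lemma peak_fun : exists a : nat -> C,
  [/\ abs_summable a, forall z, cantor_circle_set xi z -> wiener_fun a z = 1
    & forall z, `|z| <= 1 -> ~ cantor_circle_set xi z -> `|wiener_fun a z| < 1].
Proof.
have [a aS aF] := copeak_limit.
pose b n : C := (n == 0%N)%:R - a n.
have bS : abs_summable b.
  have [B aB] := aS; exists (1 + B) => L.
  apply: (@le_trans _ _ (\sum_(0 <= n < L) ((n == 0%N)%:R + cabs (a n)))).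
    apply: ler_sum => n _; apply: le_trans (cabs_leB _ _) _; rewrite lerD2r.
    by rewrite -(rmorph_nat (real_complex R)) cabs_real normr_nat.
  rewrite big_split /= lerD//; case: L => [|L]; first by rewrite big_geq.
  by rewrite big_nat_recl//= big1 ?addr0.
have bE z : cabs z <= 1 -> wiener_fun b z = 1 - wiener_fun a z.
  move=> z1; apply: ccvg_unique (wiener_cvg bS z1) _.
  have /ccvgP H := wiener_cvg aS z1; apply/ccvgP => e /H[N HN].
  exists N.+1 => [[//|n]] /ltnW/HN h.
  have -> : series (fun n => b n * z ^+ n) n.+1 = 1 - series (fun n => a n * z ^+ n) n.+1.
    rewrite /series /= /b; under eq_bigr do rewrite mulrBl.
    rewrite sumrB; congr (_ - _); rewrite big_nat_recl//= big1 ?addr0.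
      by rewrite expr0 mulr1.
    by move=> i _; rewrite mul0r.
  rewrite cabsB [X in cabs X](_ : _ = series (fun n => a n * z ^+ n) n.+1 - wiener_fun a z)//.
  by ring.
exists b; split=> // z.
  move=> zE; have z1 : cabs z <= 1 by case: zE => x _ <-; rewrite cabs_cexp.
  by rewrite bE// (ccvg_unique (aF z z1) (copeak_cvg0 z1 zE)) subr0.
have -> : (`|z| <= 1) = (cabs z <= 1) by rewrite -(normr1 C) le_cabs cabs1.
move=> z1 zE; rewrite -(normr1 C) !cabsE ltcR cabs1 bE//.
have [c c0 Fc] := copeak_away z1 zE; set w := wiener_fun a z.
have Fw := aF z z1; rewrite -/w in Fw.
have wc : c <= cabs w.
  rewrite -lerN2; apply: (@rcvg_le _ (fun N => - cabs (copeak xi N z))).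
    by apply: cvgN; exact: ccvg_cabs.
  by move=> N; rewrite lerN2.
have wd : cabs w ^+ 2 - complex.Re w <= 0.
  apply: (@rcvg_le _ (fun N => cabs (copeak xi N z) * cabs (copeak xi N z) - complex.Re (copeak xi N z))).
    apply: cvgB; last by have /ccvgReIm[] := Fw.
    by apply: cvgM; exact: ccvg_cabs.
  by move=> N; have := copeak_disc N z1; rewrite expr2; lra.
rewrite -(@ltr_pXn2r _ 2) ?nnegrE ?cabs_ge0// expr1n.
have : 0 < cabs w ^+ 2 by rewrite exprn_gt0// (lt_le_trans c0).
move: wd; rewrite !cabs_sqr; case: (w) => x y /=; rewrite sub0r; nra.
Qed.

(** A point of [0, 1[ whose image on the circle lies in the Cantor set lies in
    the Cantor set itself, because only 0 and 1 are identified and 0 belongs to it; and that set is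
    covered by 2 ^ n intervals of length xi ^ n. *)
Lemma cantor_null : circle_lebesgue_null (cantor_circle_set xi).
Proof.
have sub : `[0, 1[ `&` circle_exp R @^-1` cantor_circle_set xi `<=` cantor_set xi.
  move=> x [/=]; rewrite in_itv /= => x01 [y yE /= yx].
  have /andP[y0] := cantor_set01 xi01 yE; rewrite le_eqVlt => /predU1P[y1|y1].
    suff -> : x = 0 by exact: cantor_set0.
    apply: cexp_inj01 => //; first by rewrite lexx ltr01.
    have E : cexp x = cexp y by exact: esym yx.
    by rewrite E y1 cexp1 cexp0.
  suff <- : y = x by [].
  by apply: cexp_inj01 => //; rewrite y0.
have sub2 n : `[0, 1[ `&` circle_exp R @^-1` cantor_circle_set xi `<=` cantor_approx xi n.+1.
  by move=> x /sub /(_ n Logic.I).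
have meas n : (lebesgue_measure (cantor_approx xi n) <= ((2 * xi) ^+ n)%:E)%E.
  apply: (@le_trans _ _ (\sum_(I <- ci n) lebesgue_measure (`[I.1, I.2]%classic : set (measurableTypeR R)))%E).
    rewrite /cantor_approx; elim: (ci n) => [|I s IH].
      by rewrite !big_nil measure0.
    rewrite !big_cons; apply: le_trans (measureU2 _ _ _) _.
    - exact: measurable_itv.
    - by apply: bigsetU_measurable => J _; exact: measurable_itv.
    by apply: leeD.
  rewrite big_seq (eq_bigr (fun=> (xi ^+ n)%:E)).
    rewrite -big_seq sumEFin lee_fin big_const_seq count_predT size_cantor_intervals iter_addr_0.
    by rewrite -[xi ^+ n *+ _]mulr_natl natrX -exprMn.
  move=> I Ik; have [E _ _] := cantor_intervals_length xi01 Ik.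
  rewrite lebesgue_measure_itv /= lte_fin E ltrDl xiX_gt0//.
  by rewrite -EFinD addrAC subrr add0r.
set A := _ `&` _ in sub sub2 *.
have mA : measurable (A : set (measurableTypeR R)).
  apply: measurableI; first exact: measurable_itv.
  rewrite -[X in measurable X]setTI; apply: measurable_circle_exp => //.
  rewrite -[cantor_circle_set xi]setCK; apply: measurableC; apply: sub_sigma_algebra.
  apply: closed_openC; exact: (closed_cantor_circle xi01).
apply/eqP; rewrite -measure_le0; apply/lee_addgt0Pr => e e0.
rewrite add0e.
have x0 := xi_gt0 xi_small; have x1 := xi_le xi_small.
have [||N HN] := @expr_lt_eps R (2 * xi) e => //.
  by rewrite mulr_ge0 ?(ltW x0)//=; lra.
apply: (@le_trans _ _ (lebesgue_measure (cantor_approx xi N.+1))).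
  by apply: le_measure; rewrite ?inE//; exact: measurable_cantor_approx.
apply: le_trans (meas _) _; rewrite lee_fin ltW// HN//.
Qed.

Lemma peak_cantor : peak_set (cantor_circle_set xi).
Proof.
split.
- by move=> _ [x _ <-]; rewrite /circle /= -[circle_exp R x]/(cexp x) (cabsE (cexp x)) cabs_cexp.
- exact: (closed_cantor_circle xi01).
- exact: cantor_null.
have [a [aS a1 a2]] := peak_fun; exists a; split => //.
by apply/ell1P.
Qed.

End peak.

(** * Integrals of nearly constant functions over finitely many cells *)

Section cells.
Context d (T : measurableType d) (R : realType) (mu : probability T R).
Implicit Types (A D : set T) (g : T -> R).

Lemma prob_fin A : measurable A -> mu A = (fine (mu A))%:E.
Proof.
by move=> mA; rewrite fineK// fin_num_measure.
Qed.

Lemma bounded_integrable g (M : R) A : measurable_fun setT g -> (forall x, `|g x| <= M) ->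
  measurable A -> mu.-integrable A (EFin \o g).
Proof.
move=> mg gM mA; apply: measurable_bounded_integrable => //.
- by rewrite (le_lt_trans (probability_le1 mu mA))// ltry.
- exact: measurable_funTS.
- by exists M; split; rewrite ?num_real// => x Mx y _; apply: le_trans (gM y) (ltW Mx).
Qed.

Lemma Rintegral_near_cst g (M : R) A (v w : R) : measurable_fun setT g ->
  (forall x, `|g x| <= M) -> measurable A -> (forall x, A x -> `|g x - v| <= w) ->
  `|\int[mu]_(x in A) g x - v * fine (mu A)| <= w * fine (mu A).
Proof.
move=> mg gM mA gv; have ig := bounded_integrable mg gM mA.
have ic r : mu.-integrable A (EFin \o (fun=> r)).
  by apply: (@bounded_integrable (fun=> r) `|r|).
rewrite -!Rintegral_cst// -RintegralB//.
have igv : mu.-integrable A (EFin \o (fun x => g x - v)).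
  apply: (@bounded_integrable _ (M + `|v|)) => //; first exact: measurable_funB.
  by move=> x; apply: le_trans (ler_normB _ _) _; rewrite lerD2r.
apply: le_trans (le_normr_Rintegral mA igv) _.
apply: le_Rintegral => //.
apply: (@bounded_integrable _ (M + `|v|)) => //.
  by apply: measurableT_comp => //; exact: measurable_funB.
by move=> x; rewrite normr_id; apply: le_trans (ler_normB _ _) _; rewrite lerD2r.
Qed.

(** The cells exhaust the probability mass, so the rest of D is negligible. *)
Lemma Rintegral_cells g (M w : R) D (A : nat -> set T) (v : nat -> R) m :
  measurable_fun setT g -> (forall x, `|g x| <= M) -> measurable D ->
  (forall i, (i < m)%N -> measurable (A i)) ->
  (forall i, (i < m)%N -> A i `<=` D) ->
  (forall i j, (i < j < m)%N -> A i `&` A j = set0) ->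
  \sum_(0 <= i < m) fine (mu (A i)) = 1 ->
  (forall i x, (i < m)%N -> A i x -> `|g x - v i| <= w) ->
  `|\int[mu]_(x in D) g x - \sum_(0 <= i < m) v i * fine (mu (A i))| <= w.
Proof.
move=> mg gM mD mA AD dA sA gv.
pose B k := \big[setU/set0]_(0 <= i < k) A i.
have BE k x : B k x <-> exists2 i, (i < k)%N & A i x.
  rewrite /B big_mkord; split=> [|[i ik Aix]].
    by rewrite -bigcup_mkord => -[i /= ik Aix]; exists i.
  by rewrite -bigcup_mkord; exists i.
have mB k : (k <= m)%N -> measurable (B k).
  move=> km; rewrite /B big_mkord; apply: bigsetU_measurable => i _; apply: mA.
  exact: leq_trans km.
have key k : (k <= m)%N ->
  fine (mu (B k)) = \sum_(0 <= i < k) fine (mu (A i)) /\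
  `|\int[mu]_(x in B k) g x - \sum_(0 <= i < k) v i * fine (mu (A i))| <=
    w * \sum_(0 <= i < k) fine (mu (A i)).
  elim: k => [_|k IH km].
    by rewrite /B !big_geq// measure0 Rintegral_set0 subrr normr0 mulr0.
  have [IH1 IH2] := IH (ltnW km).
  have BS : B k.+1 = B k `|` A k by rewrite /B big_nat_recr.
  have dis : B k `&` A k = set0.
    apply/seteqP; split=> // x [/BE[i ik Aix] Akx].
    by have <- : A i `&` A k = set0 by apply: dA; rewrite ik km.
  have mBk := mB _ (ltnW km); have mAk := mA _ km.
  rewrite BS !big_nat_recr//= -IH1; split.
    by rewrite measureU//= (prob_fin mBk) (prob_fin mAk).
  rewrite Rintegral_setU//; first last.
  - by rewrite disj_set2E; apply/eqP.
  - by apply: bounded_integrable mg gM _; exact: measurableU.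
  rewrite -IH1 in IH2.
  have := Rintegral_near_cst mg gM mAk (gv k ^~ km).
  rewrite mulrDr => h; rewrite opprD addrACA; apply: le_trans (ler_normD _ _) _.
  by rewrite lerD.
have [h1 h2] := key m (leqnn m).
rewrite sA in h1 h2; rewrite mulr1 in h2.
have mBm := mB m (leqnn m).
have BD : B m `<=` D by move=> x /BE[i im]; exact: AD.
rewrite -(setDUK BD) Rintegral_setU//; first last.
- by rewrite disj_set2E; apply/eqP; rewrite -subset0 => x [Bx [_ /(_ Bx)]].
- by apply: bounded_integrable mg gM _; apply: measurableU => //; exact: measurableD.
- exact: measurableD.
have mBD : measurable (D `\` B m) by exact: measurableD.
have z : fine (mu (D `\` B m)) = 0.
  have : (mu (D `\` B m) <= mu (~` B m))%E.
    by apply: le_measure; rewrite ?inE//; [exact: measurableC] || move=> x [].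
  rewrite probability_setC// (prob_fin mBm) (prob_fin mBD) h1 -EFinB subrr lee_fin => h.
  by apply/eqP; rewrite /= eq_le h fine_ge0// measure_ge0.
have := @Rintegral_near_cst g M (D `\` B m) 0 M mg gM mBD.
rewrite z !mulr0 subr0 => /(_ _)/(le_trans _) h0.
have -> : \int[mu]_(x in D `\` B m) g x = 0.
  by apply/eqP; rewrite -normr_le0; apply: h0 => // x _; rewrite subr0.
by rewrite addr0.
Qed.

End cells.

Section modulus.
Variable R : realType.

(** The near-covering form of the compactness of [0, 1]. *)
Lemma unif_continuous01 (f : R -> R) (e : R) : continuous f -> 0 < e ->
  exists2 del : R, 0 < del & forall x y : R, 0 <= x <= 1 -> `|x - y| < del -> `|f x - f y| < e.
Proof.
move=> cf e0; have e20 : 0 < e / 2 by rewrite divr_gt0.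
have /compact_near_coveringP/(_ R ((0:R)^'+) (fun (d x : R) => forall y, `|x - y| < d -> `|f x - f y| < e)) :=
  @segment_compact R 0 1.
have near (x : R) : `[0, 1]%classic x -> \forall x' \near x & i \near (0:R)^'+,
   forall y : R, `|x' - y| < i -> `|f x' - f y| < e.
  move=> _; have /cvgrPdist_lt/(_ _ e20)/nbhs_ballP[r /= r0 rf] := cf x.
  have r20 : 0 < r / 2 by rewrite divr_gt0.
  exists (ball x (r / 2), [set i | i < r / 2]).
    split => /=; first exact: nbhsx_ballx.
    exact: nbhs_right_lt.
  move=> [x' i] /= [xx' ir] y x'y.
  have h1 : `|f x - f x'| < e / 2.
    by apply: rf; rewrite /ball /= in xx' *; apply: lt_trans xx' _; lra.
  have h2 : `|f x - f y| < e / 2.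
    apply: rf; rewrite /ball /= in xx' *.
    have := ler_distD x' x y; lra.
  have := ler_distD (f x) (f x') (f y); rewrite [`|f x' - f x|]distrC; lra.
move=> /(_ _ near) H.
have [d0 /= [d00 dH]] : exists d0 : R, 0 < d0 /\ forall x : R, `[0, 1]%classic x ->
   forall y : R, `|x - y| < d0 -> `|f x - f y| < e.
  near (0 : R)^'+ => d0; exists d0; split; first by near: d0; exact: nbhs_right_gt.
  by near: d0; apply: filterS H => d0 h x /h.
exists d0 => // x y x01; apply: dH; by rewrite /= in_itv.
Unshelve. all: by end_near. Qed.

Lemma bounded01 (f : R -> R) : continuous f ->
  exists M : R, forall x : R, 0 <= x <= 1 -> `|f x| <= M.
Proof.
move=> cf.
have cptf : compact (f @` `[0, 1]%classic).
  apply: continuous_compact; last exact: segment_compact.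
  by apply: continuous_subspaceT => x; exact: cf.
have [M [_ HM]] := compact_bounded cptf.
by exists (M + 1) => x x01; apply: HM; [rewrite ltrDl|exists x; rewrite //= in_itv].
Qed.

Definition clamp (x : R) : R := Num.max 0 (Num.min 1 x).

Lemma clamp01 x : 0 <= clamp x <= 1.
Proof. by rewrite /clamp le_max lexx /= ge_max ler01 ge_min lexx. Qed.

Lemma clamp_id x : 0 <= x <= 1 -> clamp x = x.
Proof.
by move=> /andP[x0 x1]; rewrite /clamp min_r// max_r.
Qed.

Lemma continuous_clamp : continuous clamp.
Proof.
move=> x; apply: (@continuous_max R R (fun=> 0) (Num.min 1) x); first exact: cvg_cst.
apply: (@continuous_min R R (fun=> 1) id x); [exact: cvg_cst|exact: cvg_id].
Qed.

(** This extends a function that is continuous only on [0, 1] to a continuous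
    function on R. *)
Lemma continuous_comp_clamp (f : R -> R) : {within `[0, 1], continuous f} ->
  continuous (f \o clamp).
Proof.
move=> /subspace_continuousP cf x.
have cx : `[0, 1]%classic (clamp x) by rewrite /= in_itv /= clamp01.
apply: (@cvg_comp _ _ _ clamp f _ (within `[0, 1]%classic (nbhs (clamp x)))).
  move=> U wU; have H : nbhs x (clamp @^-1` [set y | `[0, 1]%classic y -> U y]) := continuous_clamp wU.
  apply: (@filterS _ (nbhs x) _ _ _ _ H) => y; apply.
  by rewrite /= in_itv; exact: clamp01.
exact: cf.
Qed.

End modulus.

(** * The Cantor measure *)

Section cantor_nth.
Variables (R : realType) (xi : R).
Hypothesis xi01 : 0 < xi < 2^-1.
Local Notation ci := (cantor_intervals xi).

Definition cantor_itv n i : R * R := nth (0, 0) (ci n) i.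

Lemma cantor_itv_in n i : (i < 2 ^ n)%N -> cantor_itv n i \in ci n.
Proof. by move=> h; rewrite mem_nth// size_cantor_intervals. Qed.

Lemma nth_refine (s : seq (R * R)) i (b : bool) : (i < size s)%N ->
  nth (0, 0) (cantor_refine xi s) (b + i.*2) = nth (0, 0) (remove_middle xi (nth (0, 0) s i)) b.
Proof.
elim: s i => // I s IH [|i] /=.
  by case: b {IH}.
by rewrite ltnS doubleS => /IH <-; case: b {IH}.
Qed.

Lemma cantor_itv_child n i (b : bool) : (i < 2 ^ n)%N ->
  (cantor_itv n i).1 <= (cantor_itv n.+1 (b + i.*2)).1 /\ (cantor_itv n.+1 (b + i.*2)).2 <= (cantor_itv n i).2.
Proof.
move=> i2; rewrite /cantor_itv cantor_intervalsS nth_refine ?size_cantor_intervals//.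
have [J2 _ _] := cantor_intervals_length xi01 (cantor_itv_in i2).
have x0 : 0 < xi by case/andP: xi01.
have x1 : xi < 1 by case/andP: xi01; lra.
rewrite -/(cantor_itv n i) /=.
have E : (cantor_itv n i).2 - (cantor_itv n i).1 = xi ^+ n by rewrite J2 addrC addKr.
rewrite /remove_middle E J2; have h : 0 <= xi ^+ n by rewrite exprn_ge0// ltW.
by case: b => /=; nra.
Qed.

Lemma cantor_itv_disjoint n i j x : (i < j < 2 ^ n)%N ->
  (cantor_itv n i).1 <= x <= (cantor_itv n i).2 -> ~ (cantor_itv n j).1 <= x <= (cantor_itv n j).2.
Proof.
move=> /andP[ij jn] /andP[_ a] /andP[b _].
have /(pairwiseP (0, 0)) := pairwise_cantor_intervals xi01 n.
move=> /(_ i j); rewrite !inE size_cantor_intervals (ltn_trans ij jn) jn => /(_ isT isT ij).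
by rewrite -!/(cantor_itv _ _) => h; have := le_lt_trans (le_trans b a) h; rewrite ltxx.
Qed.

(** The integral of f against the uniform probability on the left endpoints of
    generation n. *)
Definition left_mean n (f : R -> R) : R := \sum_(0 <= i < 2 ^ n) f (cantor_itv n i).1 * 2^-1 ^+ n.

Lemma left_meanE n f : left_mean n f = 2^-1 ^+ n * \sum_(I <- ci n) f I.1.
Proof.
by rewrite (big_nth (0, 0)) size_cantor_intervals mulr_sumr; apply: eq_bigr => i _; rewrite mulrC.
Qed.

(** The set of the numbers whose first n binary digits are those of i. *)
Definition dyad n i : set (measurableTypeR R) := [set x : R | i%:R * 2^-1 ^+ n <= x < i.+1%:R * 2^-1 ^+ n].

Lemma dyadE n i : dyad n i = `[i%:R * 2^-1 ^+ n, i.+1%:R * 2^-1 ^+ n[%classic.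
Proof. by apply/seteqP; split=> x /=; rewrite in_itv. Qed.

Lemma measurable_dyad n i : measurable (dyad n i).
Proof. by rewrite dyadE; exact: measurable_itv. Qed.

Let half n : 0 < 2^-1 ^+ n :> R. Proof. by rewrite exprn_gt0. Qed.

Lemma dyad_disj n i j x : dyad n i x -> dyad n j x -> i = j.
Proof.
move=> /andP[a b] /andP[c d].
have := le_lt_trans a d; have := le_lt_trans c b; rewrite !ltr_pM2r// !ltr_nat !ltnS => h1 h2.
by apply/eqP; rewrite eqn_leq h1 h2.
Qed.

Lemma dyad_split n i x : dyad n i x -> exists b : bool, dyad n.+1 (b + i.*2) x.
Proof.
move=> /andP[a b].
have E (k : nat) : k%:R * 2^-1 ^+ n = k.*2%:R * 2^-1 ^+ n.+1 :> R.
  by rewrite -muln2 natrM exprS; field.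
rewrite !E in a b.
have [h|h] := ltP x (i.*2.+1%:R * 2^-1 ^+ n.+1).
  by exists false; rewrite /dyad /= add0n a h.
by exists true; rewrite /dyad /= add1n h -doubleS b.
Qed.

Lemma dyad01 n i x : (i < 2 ^ n)%N -> dyad n i x -> 0 <= x < 1.
Proof.
move=> i2 /andP[a b]; rewrite (le_trans _ a) ?mulr_ge0 ?(ltW (half _))//=.
apply: lt_le_trans b _; rewrite exprVn ler_pdivrMr ?exprn_gt0// mul1r -natrX ler_nat.
exact: i2.
Qed.

Definition cantor_step n (x : measurableTypeR R) : measurableTypeR R :=
  \sum_(0 <= i < 2 ^ n) (cantor_itv n i).1 * \1_(dyad n i) x.

Lemma cantor_step_dyad n i x : (i < 2 ^ n)%N -> dyad n i x -> cantor_step n x = (cantor_itv n i).1.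
Proof.
move=> i2 xc; rewrite /cantor_step (bigD1_seq i) ?mem_index_iota ?iota_uniq//=.
rewrite indicE mem_set// mulr1 big1 ?addr0// => j ji.
rewrite indicE memNset ?mulr0// => /(dyad_disj xc) E.
by rewrite E eqxx in ji.
Qed.

Lemma cantor_step_out n x : ~ (0 <= x < 1) -> cantor_step n x = 0.
Proof.
move=> x01; rewrite /cantor_step big_nat_cond big1// => i /andP[/andP[_ i2] _].
by rewrite indicE memNset ?mulr0// => /(dyad01 i2).
Qed.

Lemma measurable_cantor_step n : measurable_fun setT (cantor_step n).
Proof.
apply: measurable_sum => i; apply: measurable_funM => //.
by apply: measurable_indic; exact: measurable_dyad.
Qed.

(** The dyadic cell of x and the Cantor interval with the same index shrink
    together. *)
Lemma dyad_follow n i x m : (i < 2 ^ n)%N -> dyad n i x ->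
  exists j, [/\ (j < 2 ^ (m + n))%N, dyad (m + n) j x,
    (cantor_itv n i).1 <= (cantor_itv (m + n) j).1 & (cantor_itv (m + n) j).2 <= (cantor_itv n i).2].
Proof.
move=> i2 xc; elim: m => [|m [j [j2 xj a b]]]; first by exists i.
have [c xd] := dyad_split xj; exists (c + j.*2)%N.
have [h1 h2] := cantor_itv_child c j2; rewrite addSn; split => //.
- by rewrite expnS; case: (c); lia.
- exact: le_trans h1.
- exact: le_trans b.
Qed.

Lemma dyad_ex n x : 0 <= x < 1 -> exists2 i, (i < 2 ^ n)%N & dyad n i x.
Proof.
move=> x01; have d0 : dyad 0 0 x by rewrite /dyad /= mul0r mul1r expr0.
have [j [j2 xj _ _]] := dyad_follow n (isT : (0 < 2 ^ 0)%N) d0.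
by rewrite addn0 in j2 xj; exists j.
Qed.

Lemma cantor_step_follow n i x m : (i < 2 ^ n)%N -> dyad n i x -> (n <= m)%N ->
  (cantor_itv n i).1 <= cantor_step m x <= (cantor_itv n i).2.
Proof.
move=> i2 xc nm; have [j [j2 xj a b]] := dyad_follow (m - n) i2 xc.
rewrite subnK// in j2 xj a b; rewrite (cantor_step_dyad j2 xj) a (le_trans _ b)//.
have [-> _ _] := cantor_intervals_length xi01 (cantor_itv_in j2).
by rewrite lerDl exprn_ge0//; case/andP: xi01 => /ltW.
Qed.

Lemma xi_lim : 0 <= xi < 1.
Proof. by case/andP: xi01 => /ltW -> /=; lra. Qed.

Lemma cantor_step_cvg x : exists l : R, (fun n => cantor_step n x : R) @ \oo --> l.
Proof.
have [x01|x01] := pselect (0 <= x < 1); last first.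
  by exists 0; under eq_fun do rewrite cantor_step_out//; exact: cvg_cst.
apply: rcauchy_cvg => e e0.
have [||N HN] := @expr_lt_eps R xi e => //; first exact: xi_lim.
have [i i2 xc] := dyad_ex N x01; exists N => n Nn.
have /andP[a b] := cantor_step_follow i2 xc Nn; have /andP[c d] := cantor_step_follow i2 xc (leqnn N).
have [E _ _] := cantor_intervals_length xi01 (cantor_itv_in i2).
have := HN N (leqnn N); rewrite ltr_norml; rewrite E in b d; lra.
Qed.

(** The map that sends binary digits d_k to the sum of
    d_k (1 - xi) xi ^ k, that is, a right inverse of the Cantor staircase. *)
Definition cantor_fun (x : measurableTypeR R) : measurableTypeR R := limn (fun n => cantor_step n x : R).

Lemma cantor_step_cvg_fun x : (fun n => cantor_step n x : R) @ \oo --> (cantor_fun x : R).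
Proof. by have [l H] := cantor_step_cvg x; apply/cvg_ex; exists l. Qed.

Lemma measurable_cantor_fun : measurable_fun setT cantor_fun.
Proof.
apply: (@measurable_fun_cvg _ _ _ _ cantor_step) => [m|x _]; first exact: measurable_cantor_step.
exact: cantor_step_cvg_fun.
Qed.

HB.instance Definition _ := isMeasurableFun.Build _ _ _ _ cantor_fun measurable_cantor_fun.

Lemma cantor_fun_dyad n i x : (i < 2 ^ n)%N -> dyad n i x ->
  (cantor_itv n i).1 <= cantor_fun x <= (cantor_itv n i).2.
Proof.
move=> i2 xc; apply/andP; split.
  rewrite -lerN2; apply: (@rcvg_le _ (fun m => - cantor_step (m + n) x)).
    by apply: cvgN; have := @cantor_step_cvg_fun x; rewrite -(cvg_shiftn n).
  by move=> m; rewrite lerN2; have /andP[] := cantor_step_follow i2 xc (leq_addl m n).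
apply: (@rcvg_le _ (fun m => cantor_step (m + n) x)).
  by have := @cantor_step_cvg_fun x; rewrite -(cvg_shiftn n).
by move=> m; have /andP[] := cantor_step_follow i2 xc (leq_addl m n).
Qed.

Lemma cantor_fun_cantor x : cantor_set xi (cantor_fun x).
Proof.
have [x01|x01] := pselect (0 <= x < 1); last first.
  have -> : cantor_fun x = 0; last exact: cantor_set0.
  by rewrite /cantor_fun; under eq_fun do rewrite cantor_step_out//; rewrite lim_cst.
move=> n _; have [i i2 xc] := dyad_ex n.+1 x01.
apply/cantor_approxP; exists (cantor_itv n.+1 i); first exact: cantor_itv_in.
exact: cantor_fun_dyad.
Qed.

Lemma itv01_mass : lebesgue_measure (`[0, 1[%classic : set (measurableTypeR R)) = 1%E.
Proof. by rewrite lebesgue_measure_itv /= lte_fin ltr01 -EFinB subr0. Qed.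

(** This covers both the uniform probability on [0, 1[ and the normalised
    restrictions of Lebesgue measure to the approximations of the Cantor set. *)
Lemma mnormalize_mrestrE (E : set (measurableTypeR R)) (mE : measurable E)
   (Q : probability (measurableTypeR R) R) (m : R) A : lebesgue_measure E = m%:E -> 0 < m ->
  A `<=` E -> mnormalize (mrestr lebesgue_measure mE) Q A = (lebesgue_measure A * m^-1%:E)%E.
Proof.
move=> Em m0 AE; rewrite /mnormalize /= /mrestr setTI Em eqe gt_eqF//=.
by rewrite setIidl.
Qed.

Definition unif01 : probability (measurableTypeR R) R :=
  mnormalize (mrestr lebesgue_measure (measurable_itv `[0, 1[ : measurable (`[0, 1[%classic : set (measurableTypeR R))))
    (dirac (0 : measurableTypeR R)).

Lemma unif01_dyad n i : (i < 2 ^ n)%N -> unif01 (dyad n i) = (2^-1 ^+ n)%:E.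
Proof.
move=> i2.
have -> : unif01 (dyad n i) = (lebesgue_measure (dyad n i) * (1 : R)^-1%:E)%E.
  apply: mnormalize_mrestrE => //; first exact: itv01_mass.
  by move=> x /(dyad01 i2); rewrite /= in_itv.
rewrite invr1 mule1 dyadE lebesgue_measure_itv /= lte_fin ltr_pM2r// ltr_nat ltnSn.
by rewrite -EFinB -mulrBl -natr1 addrAC subrr add0r mul1r.
Qed.

Definition cantor_measure : probability (measurableTypeR R) R := distribution unif01 cantor_fun.

End cantor_nth.

(** * Weak-star convergence to the Cantor measure *)

Section cantor_integrals.
Variables (R : realType) (xi : R).
Hypothesis xi01 : 0 < xi < 2^-1.
Local Notation ci := (cantor_intervals xi).
Local Notation cantor_itv := (cantor_itv xi).
Local Notation left_mean := (left_mean xi).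
Local Notation sigma := (cantor_measure xi01).

Let xi0 : 0 < xi. Proof. by case/andP: xi01. Qed.
Let half n : 0 < 2^-1 ^+ n :> R. Proof. by rewrite exprn_gt0. Qed.

Lemma sum_half_cells n : \sum_(0 <= i < 2 ^ n) (2^-1 ^+ n : R) = 1.
Proof.
by rewrite sumr_const_nat subn0 -[_ *+ _]mulr_natl natrX exprVn divff// expf_neq0.
Qed.

Lemma cantor_fun01 x : 0 <= (cantor_fun xi x : R) <= 1.
Proof. exact: (cantor_set01 xi01 (cantor_fun_cantor xi01 x)). Qed.

Lemma cantor_itv01 n i : (i < 2 ^ n)%N -> 0 <= (cantor_itv n i).1 <= 1.
Proof. by move=> i2; exact: (cantor_set01 xi01 (cantor_left_in xi01 (cantor_itv_in xi i2))). Qed.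

(** On a dyadic cell of generation n the map [cantor_fun] stays in one interval
    of length xi ^ n, where f is nearly constant. *)
Lemma left_mean_cvg (f : R -> R) (D : set (measurableTypeR R)) : continuous f ->
  measurable D -> (forall x : R, 0 <= x <= 1 -> D x) ->
  (fun n => left_mean n f) @ \oo --> (\int[sigma]_(x in D) f x)%R.
Proof.
move=> cf mD D01.
have mf : measurable_fun setT (f : measurableTypeR R -> R) by exact: continuous_measurable_fun.
have mphi := measurable_cantor_fun xi01.
have [M HM] := bounded01 cf.
have gM x : `|f (cantor_fun xi x)| <= M by apply: HM; exact: cantor_fun01.
have mg : measurable_fun setT (fun x => f (cantor_fun xi x)) by exact: measurableT_comp.
have -> : \int[sigma]_(x in D) f x = \int[unif01 R]_x f (cantor_fun xi x).
  rewrite /Rintegral; congr fine.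
  have E : cantor_fun xi @^-1` D = setT.
    by apply/seteqP; split => // x _; apply: D01; exact: cantor_fun01.
  rewrite -E; apply: integral_pushforward => //.
  - exact/measurable_EFinP.
  - rewrite E; exact: (bounded_integrable (unif01 R) mg gM measurableT).
apply/rcvgP => e e0.
have e20 : 0 < e / 2 by rewrite divr_gt0.
have [del del0 Hdel] := unif_continuous01 cf e20.
have [||N HN] := @expr_lt_eps R xi del => //; first exact: xi_lim xi01.
exists N => n /HN xd; rewrite distrC; apply: (@le_lt_trans _ _ (e / 2)); last lra.
have -> : left_mean n f = \sum_(0 <= i < 2 ^ n) f (cantor_itv n i).1 * fine (unif01 R (@dyad R n i)).
  rewrite /left_mean big_nat_cond [RHS]big_nat_cond; apply: eq_bigr => i /andP[/andP[_ i2] _].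
  by rewrite unif01_dyad.
apply: (Rintegral_cells mg gM) => //.
- by move=> i _; exact: measurable_dyad.
- move=> i j /andP[ij _]; apply/seteqP; split=> // x [/= xi_ xj].
  by move: ij; rewrite (dyad_disj xi_ xj) ltnn.
- rewrite -[RHS](sum_half_cells n) big_nat_cond [RHS]big_nat_cond.
  by apply: eq_bigr => i /andP[/andP[_ i2] _]; rewrite unif01_dyad.
move=> i x i2 xc; rewrite distrC; apply/ltW/Hdel; first exact: cantor_itv01.
have := cantor_fun_dyad xi01 i2 xc; have [-> _ _] := cantor_intervals_length xi01 (cantor_itv_in xi i2).
by move=> /andP[a b]; rewrite distrC ger0_norm ?subr_ge0//; lra.
Qed.

Definition cantor_cell n i : set (measurableTypeR R) := `[(cantor_itv n i).1, (cantor_itv n i).2]%classic.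

Lemma cantor_approxE n : cantor_approx xi n = \big[setU/set0]_(i < 2 ^ n) cantor_cell n i.
Proof.
by rewrite /cantor_approx (big_nth (0, 0)) size_cantor_intervals big_mkord.
Qed.

Lemma cantor_cell_disj n i j : (i < j < 2 ^ n)%N -> cantor_cell n i `&` cantor_cell n j = set0.
Proof.
move=> ij; apply/seteqP; split=> // x []; rewrite /cantor_cell /= !in_itv /= => a b.
exact: (cantor_itv_disjoint xi01 ij a b).
Qed.

Lemma cantor_cell_mass n i : (i < 2 ^ n)%N -> lebesgue_measure (cantor_cell n i) = (xi ^+ n)%:E.
Proof.
move=> i2; have [E _ _] := cantor_intervals_length xi01 (cantor_itv_in xi i2).
rewrite lebesgue_measure_itv /= -/(cantor_itv n i) lte_fin E ltrDl exprn_gt0//.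
by rewrite -EFinD addrAC subrr add0r.
Qed.

Lemma cantor_approx_mass n : lebesgue_measure (cantor_approx xi n) = ((2 * xi) ^+ n)%:E.
Proof.
rewrite cantor_approxE measure_bigsetU_ord//=.
- rewrite (eq_bigr (fun=> (xi ^+ n)%:E)) => [|i _]; last exact: cantor_cell_mass.
  by rewrite sumEFin sumr_const card_ord -[xi ^+ n *+ _]mulr_natl natrX -exprMn.
- by move=> i; exact: measurable_itv.
apply/trivIsetP => /= i j _ _ ij.
have [h|h|h] := ltngtP i j.
- by apply: cantor_cell_disj; rewrite h ltn_ord.
- by rewrite setIC; apply: cantor_cell_disj; rewrite h ltn_ord.
- by move: ij; rewrite -val_eqE /= h eqxx.
Qed.

Lemma approx_cell n i : (i < 2 ^ n)%N -> cantor_measure_approx xi n (cantor_cell n i) = (2^-1 ^+ n)%:E.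
Proof.
move=> i2.
have x2 : 0 < (2 * xi) ^+ n by rewrite exprn_gt0// mulr_gt0.
have -> : cantor_measure_approx xi n (cantor_cell n i) =
   (lebesgue_measure (cantor_cell n i) * ((2 * xi) ^+ n)^-1%:E)%E.
  apply: mnormalize_mrestrE => //; first exact: cantor_approx_mass.
  by rewrite cantor_approxE => x xi_; rewrite -bigcup_mkord; exists i.
rewrite cantor_cell_mass// -EFinM -exprVn -exprMn; congr (_ ^+ _)%:E.
by rewrite invfM mulrC divfK// gt_eqF.
Qed.

(** Each interval of generation n has mass 2 ^ (-n), and f is nearly constant on
    it. *)
Lemma approx_left_mean (f : R -> R) (M : R) : continuous f -> (forall x, `|f x| <= M) ->
  (fun n => \int[cantor_measure_approx xi n]_(x in `[0, 1]) f x - left_mean n f) @ \oo --> (0 : R).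
Proof.
move=> cf fM.
have mf : measurable_fun setT (f : measurableTypeR R -> R) by exact: continuous_measurable_fun.
apply/rcvgP => e e0.
have e20 : 0 < e / 2 by rewrite divr_gt0.
have [del del0 Hdel] := unif_continuous01 cf e20.
have [||N HN] := @expr_lt_eps R xi del => //; first exact: xi_lim xi01.
exists N => n /HN xd; rewrite subr0; apply: (@le_lt_trans _ _ (e / 2)); last lra.
have -> : left_mean n f = \sum_(0 <= i < 2 ^ n) f (cantor_itv n i).1 *
    fine (cantor_measure_approx xi n (cantor_cell n i)).
  rewrite /left_mean big_nat_cond [RHS]big_nat_cond; apply: eq_bigr => i /andP[/andP[_ i2] _].
  by rewrite approx_cell.
apply: (Rintegral_cells mf fM).
- exact: measurable_itv.
- by move=> i _; exact: measurable_itv.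
- move=> i i2 x; have [_ a b] := cantor_intervals_length xi01 (cantor_itv_in xi i2).
  rewrite /cantor_cell /= !in_itv /= => /andP[c d].
  by rewrite (le_trans a c) (le_trans d b).
- exact: cantor_cell_disj.
- rewrite -[RHS](sum_half_cells n) big_nat_cond [RHS]big_nat_cond.
  by apply: eq_bigr => i /andP[/andP[_ i2] _]; rewrite approx_cell.
move=> i x i2; rewrite /cantor_cell /= in_itv /= => /andP[a b].
rewrite distrC; apply/ltW/Hdel; first exact: cantor_itv01.
have [E _ _] := cantor_intervals_length xi01 (cantor_itv_in xi i2).
by rewrite distrC ger0_norm ?subr_ge0//; move: b; rewrite -/(cantor_itv n i) E; lra.
Qed.

Lemma is_cantor : is_cantor_measure xi sigma.
Proof.
move=> f cf.
have cg := continuous_comp_clamp cf; set g := f \o @clamp R in cg.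
have [M HM] := bounded01 cg.
have gM x : `|g x| <= M.
  have := HM (clamp x) (clamp01 x).
  by rewrite /g /= (clamp_id (clamp01 x)).
have E (mu : probability (measurableTypeR R) R) :
    \int[mu]_(x in `[0, 1]) f x = \int[mu]_(x in `[0, 1]) g x.
  by apply: eq_Rintegral => x; rewrite inE /= in_itv /= => x01; rewrite /g /= clamp_id.
rewrite E; under eq_fun do rewrite E.
have -> : (fun n => \int[cantor_measure_approx xi n]_(x in `[0, 1]) g x) =
    (fun n => (\int[cantor_measure_approx xi n]_(x in `[0, 1]) g x - left_mean n g) + left_mean n g).
  by apply/funext => n; rewrite subrK.
have D01 (x : R) : 0 <= x <= 1 -> (`[0, 1]%classic : set (measurableTypeR R)) x.
  by move=> x01; rewrite /= in_itv.
have := cvgD (approx_left_mean cg gM) (left_mean_cvg cg (measurable_itv `[0, 1]) D01).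
by rewrite add0r => H; apply: H.
Qed.

End cantor_integrals.

(** * The Fourier transform of the Cantor measure *)

Section fourier.
Variables (R : realType) (xi : R).
Hypothesis xi01 : 0 < xi < 2^-1.
Local Notation C := R[i].
Local Notation cabs := (@cabs R).
Local Notation ci := (cantor_intervals xi).
Local Notation left_mean := (left_mean xi).
Local Notation sigma := (cantor_measure xi01).

(** The transform, at u, of the uniform probability on the left endpoints. *)
Definition exp_mean n (u : R) : C := (2^-1 ^+ n)%:C * \sum_(I <- ci n) cexp (u * I.1).

(** The Fourier transform of sigma at an arbitrary real frequency: the functional
    equation relates u to xi u, so integers alone would not do. *)
Definition cantor_ft (u : R) : C :=
  (\int[sigma]_y complex.Re (cexp (u * y)))%R +i* (\int[sigma]_y complex.Im (cexp (u * y)))%R.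

Lemma exp_mean_ReIm n u : exp_mean n u = left_mean n (fun y => complex.Re (cexp (u * y))) +i*
  left_mean n (fun y => complex.Im (cexp (u * y))).
Proof.
rewrite /exp_mean !left_meanE; elim: (ci n) => [|I s]; first by rewrite !big_nil !mulr0.
rewrite !big_cons !mulrDr => ->; apply/eqP.
by rewrite eq_complex /= mul0r subr0 mul0r addr0 !eqxx.
Qed.

Lemma exp_mean_cvg u : (fun n => exp_mean n u) @ \oo --> cantor_ft u.
Proof.
apply/ccvgReIm; split => /=.
  have -> : (fun n => complex.Re (exp_mean n u)) = (fun n => left_mean n (fun y => complex.Re (cexp (u * y)))).
    by apply/funext => n; rewrite exp_mean_ReIm.
  apply: left_mean_cvg => // t; rewrite /=.
  by apply: continuous_comp; [apply: continuous_comp|exact: continuous_cos];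
   apply: mulrl_continuous.
have -> : (fun n => complex.Im (exp_mean n u)) = (fun n => left_mean n (fun y => complex.Im (cexp (u * y)))).
  by apply/funext => n; rewrite exp_mean_ReIm.
apply: left_mean_cvg => // t; rewrite /=.
by apply: continuous_comp; [apply: continuous_comp|exact: continuous_sin];
  apply: mulrl_continuous.
Qed.

(** The two scaled copies of generation n in generation n + 1 differ by a
    translation of 1 - xi. *)
Lemma exp_meanS n u : exp_mean n.+1 u =
  (2^-1)%:C * (1 + cexp (u * (1 - xi))) * exp_mean n (xi * u).
Proof.
rewrite /exp_mean exprS rmorphM /=.
have -> : \sum_(I <- ci n.+1) cexp (u * I.1) =
    (1 + cexp (u * (1 - xi))) * \sum_(I <- ci n) cexp (xi * u * I.1).
  rewrite cantor_intervals_split big_cat !big_map /=.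
  rewrite mulrDl mul1r mulr_sumr; congr (_ + _); apply: eq_bigr => I _.
    by congr cexp; ring.
  by rewrite -cexpD; congr cexp; ring.
by ring.
Qed.

Lemma cabs_exp_mean n u : cabs (exp_mean n u) <= 1.
Proof.
rewrite /exp_mean cabsM cabs_real ger0_norm ?exprn_ge0// exprVn ler_pdivrMl ?exprn_gt0//.
apply: le_trans (cabs_sum _ _ _) _.
by apply: sum_ci_le => I _; rewrite cabs_cexp.
Qed.

Lemma cabs_cantor_ft u : cabs (cantor_ft u) <= 1.
Proof.
by apply: rcvg_le (ccvg_cabs (@exp_mean_cvg u)) _ => n; exact: cabs_exp_mean.
Qed.

Lemma cabs_cantor_ftS u : cabs (cantor_ft u) = cabs ((2^-1)%:C * (1 + cexp (u * (1 - xi)))) * cabs (cantor_ft (xi * u)).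
Proof.
set a := _ * (1 + _).
suff : (fun n => cabs (exp_mean n.+1 u)) @ \oo --> cabs a * cabs (cantor_ft (xi * u)).
  have := ccvg_cabs (@exp_mean_cvg u); rewrite -(cvg_shiftS (fun n => cabs (exp_mean n u))) => h1 h2.
  exact: (cvg_unique _ h1 h2).
have -> : (fun n => cabs (exp_mean n.+1 u)) = (fun n => cabs a * cabs (exp_mean n (xi * u))).
  by apply/funext => n; rewrite exp_meanS cabsM.
by apply: cvgMr; apply: ccvg_cabs; exact: exp_mean_cvg.
Qed.

End fourier.

(** * Powers of a non-integral rational number stay away from the integers *)

Section arithmetic.
Variable R : realType.
Local Notation cabs := (@cabs R).

Lemma cos_half (t : R) : cabs ((2^-1)%:C * (1 + cexp t)) ^+ 2 = (1 + cos (2 * pi * t)) / 2.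
Proof.
rewrite cabsM cabs_real exprMn cabs_sqr /= add0r.
have := cos2Dsin2 (2 * pi * t); set c := cos _; set s := sin _ => h.
rewrite ger0_norm//; have -> : s ^+ 2 = 1 - c ^+ 2 by lra.
by field.
Qed.

(** The modulus is |cos (pi v)|, which is at most cos (pi eta) when v is at
    distance at least eta from the integers. *)
Lemma far_contraction (eta : R) : 0 < eta <= 2^-1 ->
  exists2 c : R, 0 <= c < 1 & forall v, (forall a : int, eta <= `|v - a%:~R|) ->
    cabs ((2^-1)%:C * (1 + cexp v)) <= c.
Proof.
move=> /andP[e0 e1]; have p0 := pi_gt0 R.
have th : 2 * pi * eta \in `[0, pi]%R.
  rewrite in_itv /= !mulr_ge0 ?(ltW p0) ?(ltW e0)//= mulrAC ler_piMl ?(ltW p0)//.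
  by rewrite -ler_pdivlMl// mulr1.
have c1 : cos (2 * pi * eta) < 1.
  rewrite -[ltRHS](@cos0 R) ltr_cos ?mulr_gt0// in_itv /= lexx ltW//.
exists (Num.sqrt ((1 + cos (2 * pi * eta)) / 2)).
  rewrite sqrtr_ge0 -[ltRHS]sqrtr1 ltr_sqrt//; lra.
move=> v vf.
have cN := cos_geN1 (2 * pi * eta).
rewrite -(@ler_pXn2r _ 2) ?nnegrE ?cabs_ge0 ?sqrtr_ge0// [leRHS]sqr_sqrtr; last by lra.
pose a := Num.floor (v + 2^-1); pose t := v - a%:~R.
have /andP[a0 a1] := floor_itv (v + 2^-1).
rewrite -/a intrD in a0 a1.
have vt : cexp v = cexp t.
  by rewrite /t cexpD cexpN cexp_int invr1 mulr1.
rewrite vt cos_half ler_pM2r// lerD2l.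
have tE : cos (2 * pi * t) = cos (2 * pi * `|t|).
  have [h|h] := leP 0 t; first by rewrite ger0_norm.
  by rewrite ltr0_norm// mulrN cosN.
rewrite tE; have t1 : `|t| <= 2^-1 by rewrite ler_norml /t; lra.
have := vf a; rewrite -/t le_eqVlt => /predU1P[->//|h].
apply/ltW; rewrite ltr_cos//; first by rewrite ltr_pM2l// mulr_gt0.
rewrite in_itv /= !mulr_ge0 ?(ltW p0)//= mulrAC ler_piMl ?(ltW p0)//.
by rewrite -ler_pdivlMl// mulr1.
Qed.

(** If v (q/2) ^ i were within eta of an integer a i for all i <= L, then
    2 a (i+1) - q a i would be an integer of modulus less than 1, hence 0.  So
    2 ^ L a L = q ^ L a 0, and 2 ^ L divides the positive integer a 0, which is
    at most X + 1. *)
Lemma rational_powers_far (q : nat) (X : R) : odd q ->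
  let eta : R := (2 * (q%:R + 2))^-1 in
  exists L, forall v, 1 <= v <= X -> exists2 i, (i <= L)%N &
    forall a : int, eta <= `|v * (q%:R / 2) ^+ i - a%:~R|.
Proof.
move=> oq eta.
have q0 : (0 : R) <= q%:R by rewrite ler0n.
have D0 : 0 < 2 * (q%:R + 2) :> R by lra.
have eta0 : 0 < eta by rewrite invr_gt0.
have etaD : (q%:R + 2) * eta = 2^-1 by rewrite /eta; field; lra.
have eta1 : eta <= 2^-1 by nra.
have [||L0 HL0] := @expr_lt_eps R 2^-1 (`|X| + 1)^-1.
- by rewrite invr_ge0 ler0n invf_lt1// ltr1n.
- by rewrite invr_gt0 ltr_wpDl.
pose L := L0; have HL : `|X| + 1 < 2 ^+ L.
  have := HL0 L (leqnn _); rewrite exprVn ltf_pV2 ?posrE ?exprn_gt0 ?ltr_wpDl//.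
exists L => v /andP[v1 vX]; apply: contrapT => H.
have near i : exists a : int, (i <= L)%N -> `|v * (q%:R / 2) ^+ i - a%:~R| < eta.
  have [iL|iL] := leqP i L; last by exists 0 => h.
  apply: contrapT => Hi; apply: H; exists i => // a; rewrite leNgt; apply/negP => h.
  by apply: Hi; exists a.
have [a aP] := choice near.
have step i : (i < L)%N -> 2 * a i.+1 = q%:Z * a i.
  move=> iL; apply/eqP; rewrite -subr_eq0; apply: contraT => n0.
  have : (1 : R) <= `|(2 * a i.+1 - q%:Z * a i)%:~R|.
    by rewrite -intr_norm ler1z -gtz0_ge1 normr_gt0.
  have h1 := aP _ (ltnW iL); have h2 := aP _ iL.
  have -> : (2 * a i.+1 - q%:Z * a i)%:~R =
      - (2 * (v * (q%:R / 2) ^+ i.+1 - (a i.+1)%:~R)) + q%:R * (v * (q%:R / 2) ^+ i - (a i)%:~R) :> R.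
    by rewrite rmorphB !rmorphM /= exprS; field.
  move=> /le_trans/(_ (ler_normD _ _)); rewrite normrN !normrM !normr_nat.
  have : q%:R * `|v * (q%:R / 2) ^+ i - (a i)%:~R| <= q%:R * eta by rewrite ler_wpM2l// ltW.
  lra.
have pow i : (i <= L)%N -> 2 ^+ i * a i = q%:Z ^+ i * a 0%N.
  elim: i => [|i IH] iL; first by rewrite !expr0.
  by rewrite exprSr -mulrA step// mulrCA IH ?(ltnW iL)// exprS mulrA.
have h0 := aP 0%N (leq0n _); rewrite expr0 mulr1 in h0.
have a0 : (0 < a 0%N)%R.
  by rewrite -(ltr0z R); move: h0; rewrite ltr_norml; lra.
have : (2 ^+ L %| a 0%N)%Z.
  rewrite -(@Gauss_dvdzr _ (q%:Z ^+ L)); last first.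
    by apply: coprimezXl; apply: coprimezXr; rewrite coprimezE /= coprime2n.
  by rewrite -pow// dvdz_mulr.
move=> /dvdzP[b ab].
have b1 : 1 <= b.
  by rewrite -gtz0_ge1; move: a0; rewrite ab pmulr_lgt0// exprn_gt0.
have : (2 ^+ L : R) <= (a 0%N)%:~R.
  rewrite ab rmorphM rmorphXn /= ler_peMl ?exprn_ge0// ler1z//.
have := ler_norm X; move: h0; rewrite ltr_norml; lra.
Qed.

End arithmetic.

(** * Decay of the Fourier transform *)

Section decay.
Variables (R : realType) (q : nat).
Hypothesis oq : odd q.
Let xi : R := 2 / q%:R.
Hypothesis xi01 : 0 < xi < 2^-1.
Local Notation C := R[i].
Local Notation cabs := (@cabs R).

Let P (v : R) : R := cabs (cantor_ft xi01 (v / (1 - xi))).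

Let xi1 : 0 < 1 - xi. Proof. by case/andP: xi01; lra. Qed.
Let xi0 : 0 < xi. Proof. by case/andP: xi01. Qed.

Let PS v : P v = cabs ((2^-1)%:C * (1 + cexp v)) * P (xi * v).
Proof. by rewrite /P cabs_cantor_ftS divfK ?gt_eqF// mulrA. Qed.

Let P0 v : 0 <= P v. Proof. exact: cabs_ge0. Qed.
Let P1 v : P v <= 1. Proof. exact: cabs_cantor_ft. Qed.

Let half1 v : cabs ((2^-1)%:C * (1 + cexp v)) <= 1.
Proof.
rewrite cabsM cabs_real ger0_norm//; have := cabsD 1 (cexp v).
rewrite cabs1 cabs_cexp; lra.
Qed.

Let P_le v m : P v <= P (v * xi ^+ m).
Proof.
elim: m => [|m IH]; first by rewrite expr0 mulr1.
apply: le_trans IH _; rewrite PS exprS [xi * (v * _)]mulrCA ler_piMl//.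
Qed.

Let eta : R := (2 * (q%:R + 2))^-1.

(** Each step of the induction finds one more factor at most c: among the
    numbers v xi ^ k of a bounded range above X, one is far from the
    integers, and the remaining product is a value of P beyond X. *)
Lemma cantor_ft_decay : exists2 c : R, 0 <= c < 1 & forall B : nat, exists2 X : R, 1 <= X &
  forall v, X <= v -> P v <= c ^+ B.
Proof.
have q0 : (0 : R) <= q%:R by rewrite ler0n.
have eta01 : 0 < eta <= 2^-1.
  rewrite invr_gt0; apply/andP; split; first lra.
  by rewrite lef_pV2 ?posrE; lra.
have [c c01 Hc] := far_contraction eta01; exists c => //.
have /andP[c0 c1] := c01.
have th1 : 1 < xi^-1 by rewrite invf_gt1//; case/andP: xi01; lra.
have th0 : 0 < xi^-1 by lra.
have thE : xi^-1 = q%:R / 2 by rewrite /xi invf_div.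
elim=> [|B [X X1 HX]].
  by exists 1 => // v _; rewrite expr0.
pose Y := xi^-1 * X.
have Y1 : 1 <= Y by rewrite /Y; nra.
have YX : Y * xi = X by rewrite /Y mulrAC mulVf ?mul1r// gt_eqF.
have Y0 : 0 < Y by lra.
have [L HL] := @rational_powers_far R q (xi^-1 * Y) oq.
exists (xi^-1 ^+ L.+2 * Y).
  have : 1 <= xi^-1 ^+ L.+2 by rewrite exprn_ege1// ltW.
  nra.
move=> v vX.
have vY : xi^-1 * Y < v.
  apply: lt_le_trans vX; rewrite ltr_pM2r// -[ltLHS]expr1 ltr_eXn2l//.
have v0 : 0 < v by apply: lt_trans vY; rewrite mulr_gt0.
(* The least such k is the scale at which v xi ^ k enters the range [Y, Y / xi]. *)
have ex : exists k, v * xi ^+ k <= xi^-1 * Y.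
  have [||k Hk] := @expr_lt_eps R xi (xi^-1 * Y / v).
  - by case/andP: xi01 => h1 h2; apply/andP; split; lra.
  - by rewrite divr_gt0// mulr_gt0.
  by exists k; have := Hk k (leqnn k); rewrite ltr_pdivlMr// mulrC => /ltW.
have [k kY kmin] := ex_minnP ex.
case: k kY kmin => [|k] kY kmin; first by move: kY; rewrite expr0 mulr1 leNgt vY.
have Yk : Y < v * xi ^+ k.+1.
  have : ~~ (v * xi ^+ k <= xi^-1 * Y).
    by apply/negP => /kmin; rewrite ltnn.
  by rewrite -ltNge -ltr_pdivlMl ?invr_gt0// invrK mulrCA -exprS.
have Lk : (L < k.+1)%N.
  rewrite ltnS leqNgt; apply/negP => kL.
  have : v <= xi^-1 ^+ k.+2 * Y.
    rewrite [xi^-1 ^+ _]exprSr -mulrA exprVn -ler_pdivrMl ?invr_gt0 ?exprn_gt0//.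
    by rewrite invrK mulrC.
  apply/negP; rewrite -ltNge; apply: lt_le_trans vX.
  by rewrite ltr_pM2r// ltr_eXn2l.
have [|i iL far] := HL (v * xi ^+ k.+1).
  by rewrite kY andbT (le_trans Y1)// ltW.
have ik : (i < k.+1)%N by apply: leq_ltn_trans Lk.
set w := v * xi ^+ k.+1 * (q%:R / 2) ^+ i in far.
have wE : w = v * xi ^+ (k.+1 - i).
  rewrite /w -thE -{1}(subnK (ltnW ik)) exprD -!mulrA -exprMn divff ?gt_eqF//.
  by rewrite expr1n mulr1.
apply: le_trans (P_le v (k.+1 - i)) _.
rewrite -wE PS exprS ler_pM ?cabs_ge0//; first exact: Hc.
apply: HX; rewrite -YX mulrC ler_pM2l//.
apply: le_trans (ltW Yk) _; rewrite /w ler_peMr//.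
  by rewrite mulr_ge0 ?exprn_ge0// ltW.
by rewrite -thE exprn_ege1// ltW.
Qed.

Lemma cantor_ft_cvg0 : (fun n : nat => cantor_ft xi01 n%:R) @ \oo --> (0 : C).
Proof.
have [c c01 H] := cantor_ft_decay; apply/ccvgP => e e0.
have [||B HB] := @expr_lt_eps R c e => //.
have [X X1 HX] := H B.
exists (Num.truncn (X / (1 - xi))).+1 => n nX; rewrite subr0.
apply: le_lt_trans (HB B (leqnn B)).
have -> : cabs (cantor_ft xi01 n%:R) = P (n%:R * (1 - xi)) by rewrite /P mulfK// gt_eqF.
apply: HX; rewrite -ler_pdivrMr//.
apply: le_trans (ltW (truncnS_gt _)) _.
by rewrite ler_nat.
Qed.

End decay.

(** * The Cantor measure on the circle *)

Section image.
Variables (R : realType) (xi : R).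
Hypothesis xi01 : 0 < xi < 2^-1.
Local Notation C := R[i].
Local Notation cabs := (@cabs R).
Local Notation sigma := (cantor_measure xi01).
Local Notation mu := (circle_image sigma).

Lemma measurable_borelC (f : borelC R -> measurableTypeR R) :
  continuous (f : C -> R) -> measurable_fun setT f.
Proof.
move=> /continuousP cf.
apply: (@measurability _ _ (borelC R) (measurableTypeR R) setT f (@RGenOpens.G R)).
  exact: RGenOpens.measurableE.
move=> _ [U [a [b ->]] <-]; rewrite setTI; apply: sub_sigma_algebra.
by apply: cf; exact: interval_open.
Qed.

Lemma continuous_contraction (f : C -> R) :
  (forall z w, `|f z - f w| <= cabs (z - w)) -> continuous f.
Proof.
move=> fc z U /nbhs_ballP[e /= e0 eU].
apply/nbhs_ballP; exists e%:C => /=; first by rewrite ltcR.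
move=> w; rewrite -ball_normE /= cabsE ltcR => zw; apply: eU.
by rewrite /ball /=; apply: le_lt_trans zw.
Qed.

Lemma continuous_cRe : continuous (@complex.Re R : C -> R).
Proof.
by apply: continuous_contraction => z w; rewrite -cReN -cReD Re_le_cabs.
Qed.

Lemma continuous_cIm : continuous (@complex.Im R : C -> R).
Proof.
by apply: continuous_contraction => z w; rewrite -cImN -cImD Im_le_cabs.
Qed.

(** Real and imaginary parts are handled together because each multiplication
    mixes them. *)
Lemma measurable_powC n :
  measurable_fun setT (fun z : borelC R => complex.Re ((z : C) ^+ n)) /\
  measurable_fun setT (fun z : borelC R => complex.Im ((z : C) ^+ n)).
Proof.
have mR : measurable_fun setT (fun z : borelC R => complex.Re (z : C)).
  by apply: measurable_borelC; exact: continuous_cRe.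
have mI : measurable_fun setT (fun z : borelC R => complex.Im (z : C)).
  by apply: measurable_borelC; exact: continuous_cIm.
elim: n => [|n [IHr IHi]]; first by split; under eq_fun do rewrite expr0; exact: measurable_cst.
split.
  rewrite (_ : (fun _ => _) = (fun z : borelC R => complex.Re (z : C) * complex.Re ((z : C) ^+ n) -
     complex.Im (z : C) * complex.Im ((z : C) ^+ n))).
    by apply: measurable_funB; apply: measurable_funM.
  by apply/funext => z; rewrite exprS; case: (z : C) => a b; case: (_ ^+ n).
rewrite (_ : (fun _ => _) = (fun z : borelC R => complex.Re (z : C) * complex.Im ((z : C) ^+ n) +
     complex.Im (z : C) * complex.Re ((z : C) ^+ n))).
  by apply: measurable_funD; apply: measurable_funM.
by apply/funext => z; rewrite exprS; case: (z : C) => a b; case: (_ ^+ n).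
Qed.

Lemma measurable_circle : measurable (circle R : set (borelC R)).
Proof.
rewrite -[circle R]setCK; apply: measurableC; apply: sub_sigma_algebra.
apply: closed_openC.
have -> : circle R = (fun z : C => cabs z) @^-1` [set 1].
  apply/seteqP; split => z /=; rewrite /circle /= cabsE.
    by move=> /(congr1 (@complex.Re R)).
  by move=> ->.
apply: closed_comp; last exact: closed_eq.
by move=> z _; apply: continuous_contraction => {}z w; exact: cabs_dist_dist.
Qed.

Lemma circle_cexp y : circle R (cexp y).
Proof. by rewrite /circle /= cabsE cabs_cexp. Qed.

Lemma integral_circle (f : borelC R -> R) (M : R) : measurable_fun setT f ->
  (forall y, `|f (cexp y)| <= M) ->
  \int[mu]_(z in circle R) f z = \int[sigma]_y f (cexp y).
Proof.
move=> mf fM; rewrite /Rintegral; congr fine.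
have E : circle_exp R @^-1` (circle R : set (borelC R)) = setT.
  by apply/seteqP; split => // y _; exact: circle_cexp.
have mg : measurable_fun setT (fun y : measurableTypeR R => f (cexp y)).
  by apply: measurableT_comp => //; exact: measurable_circle_exp.
rewrite -E; apply: integral_pushforward => //.
- exact/measurable_EFinP.
- rewrite E; exact: (bounded_integrable sigma mg fM measurableT).
- exact: measurable_circle.
Qed.

Lemma fourier_coef_cantor (n : nat) : fourier_coef mu (- n%:Z) = cantor_ft xi01 n%:R.
Proof.
have [mr mi] := measurable_powC n.
have E (z : C) : z ^ (- - n%:Z) = z ^+ n by rewrite opprK.
rewrite /fourier_coef; under eq_Rintegral do rewrite E.
under [X in _ +i* X]eq_Rintegral do rewrite E.
rewrite (@integral_circle _ 1 mr); last first.
  move=> y; apply: le_trans (Re_le_cabs _) _; by rewrite cabsX cabs_cexp expr1n.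
rewrite (@integral_circle _ 1 mi); last first.
  move=> y; apply: le_trans (Im_le_cabs _) _; by rewrite cabsX cabs_cexp expr1n.
by rewrite /cantor_ft; congr (_ +i* _); apply: eq_Rintegral => y _; rewrite cexpMn.
Qed.

(** Every neighbourhood of a point of the Cantor set contains the image of a
    whole dyadic cell, of mass 2 ^ (-n). *)
Lemma support_cantor : measure_support mu = cantor_circle_set xi.
Proof.
apply/seteqP; split=> z.
  move=> zS; apply: contrapT => zE.
  have oU : open (~` cantor_circle_set xi) by apply: closed_openC; exact: (closed_cantor_circle xi01).
  have h : (0 < unif01 R (cantor_fun xi @^-1` (circle_exp R @^-1` (~` cantor_circle_set xi))))%E := zS _ oU zE.
  move: h; rewrite (_ : _ @^-1` _ = set0) ?measure0 ?ltxx//.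
  apply/seteqP; split=> // x /=; apply; exists (cantor_fun xi x) => //.
  exact: cantor_fun_cantor.
move=> [x xE <-] U oU Ux.
have cU : nbhs (x : R) (@cexp R @^-1` U).
  by apply: continuous_cexp; apply: open_nbhs_nbhs.
have /nbhs_ballP[r /= r0 rU] := cU.
have [||n Hn] := @expr_lt_eps R xi r => //; first exact: xi_lim xi01.
have [I In /andP[a b]] := cantor_set_near xi01 n xE.
have /(nthP (0, 0))[i i2 iI] := In; rewrite size_cantor_intervals in i2.
have sub : dyad n i `<=` cantor_fun xi @^-1` (circle_exp R @^-1` U).
  move=> t td /=; have := cantor_fun_dyad xi01 i2 td.
  rewrite /cantor_itv iI; have [-> _ _] := cantor_intervals_length xi01 In => /andP[c d].
  apply: rU; rewrite /ball /=; apply: le_lt_trans (Hn n (leqnn n)).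
  by rewrite ler_norml; lra.
apply: (@lt_le_trans _ _ (unif01 R (dyad n i))).
  by rewrite unif01_dyad// lte_fin exprn_gt0.
change (unif01 R (dyad n i) <= unif01 R (cantor_fun xi @^-1` (circle_exp R @^-1` U)))%E.
apply: le_measure => //; rewrite inE; first exact: measurable_dyad.
have mU : measurable (U : set (borelC R)) by exact: sub_sigma_algebra.
have m1 : measurable (circle_exp R @^-1` U).
  by rewrite -[X in measurable X]setTI; apply: measurable_circle_exp.
by rewrite -[X in measurable X]setTI; apply: (measurable_cantor_fun xi01).
Qed.

End image.

Lemma rajchman_cantor (R : realType) (q : nat) (xi01 : 0 < (2 / q%:R : R) < 2^-1) :
  odd q -> rajchman (circle_image (cantor_measure xi01)).
Proof.
move=> oq; split.
  change (cantor_measure xi01 (circle_exp R @^-1` (~` circle R)) = 0%E).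
  rewrite (_ : _ @^-1` _ = set0) ?measure0//.
  by apply/seteqP; split=> // y /=; apply; exact: circle_cexp.
under eq_fun do rewrite fourier_coef_cantor.
exact: cantor_ft_cvg0.
Qed.

(** * Functionals given by summable sequences on c0 *)

Section functional.
Local Open Scope convex_scope.
Variables (R : realType) (a : nat -> R[i]).
Hypothesis aS : abs_summable a.
Local Notation C := R[i].
Local Notation cabs := (@cabs R).
Local Notation h := (coupling a).

Definition c0_rnorm (x : c0 R) : R := complex.Re `|x|.

Lemma c0_rnormE (x : c0 R) : `|x| = (c0_rnorm x)%:C.
Proof. by rewrite /c0_rnorm RRe_real// normr_real. Qed.

Lemma c0_rnorm_ge (x : c0 R) n : cabs (x n) <= c0_rnorm x.
Proof. by rewrite -lecR -c0_rnormE -cabsE; exact: c0_norm_ge. Qed.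

Lemma c0_rnorm_ge0 (x : c0 R) : 0 <= c0_rnorm x.
Proof. exact: le_trans (cabs_ge0 _) (c0_rnorm_ge x 0%N). Qed.

Lemma c0_rnorm_le (x : c0 R) (M : R) : (forall n, cabs (x n) <= M) -> c0_rnorm x <= M.
Proof.
move=> xM; rewrite -lecR -c0_rnormE; apply: c0_norm_le => n.
by rewrite cabsE lecR.
Qed.

Lemma abs_summable_bound : exists2 A : R, 0 < A & forall L, \sum_(0 <= n < L) cabs (a n) <= A.
Proof.
have [B aB] := aS; exists (B + 1) => [|L]; last by apply: le_trans (aB L) _; rewrite lerDl.
by have := aB 0%N; rewrite big_geq// => B0; rewrite ltr_wpDl.
Qed.

Lemma abs_summable_bounded_mul (u : nat -> C) (M : R) : (forall n, cabs (u n) <= M) ->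
  abs_summable (fun n => u n * a n).
Proof.
move=> uM; have [A A0 aA] := abs_summable_bound.
have M0 : 0 <= M by apply: le_trans (cabs_ge0 _) (uM 0%N).
exists (M * A) => L; apply: (@le_trans _ _ (M * \sum_(0 <= n < L) cabs (a n))).
  by rewrite mulr_sumr; apply: ler_sum => n _; rewrite cabsM ler_wpM2r ?cabs_ge0.
by rewrite ler_wpM2l.
Qed.

Lemma coupling_cvg (x : c0 R) : series (fun n => x n * a n) @ \oo --> h x.
Proof. by apply: abs_summable_cvg; apply: abs_summable_bounded_mul (c0_rnorm_ge x). Qed.

Lemma coupling_lin (k : C) (x y : c0 R) : h (k *: x + y) = k * h x + h y.
Proof.
apply: (ccvg_unique (@coupling_cvg (k *: x + y))).

have -> : series (fun n => (k *: x + y) n * a n) =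
    (fun L => k * series (fun n => x n * a n) L + series (fun n => y n * a n) L).
  apply/funext => L; rewrite /series /= mulr_sumr -big_split /=; apply: eq_bigr => n _.
  by rewrite [(_ + _) n](_ : _ = k * x n + y n)// mulrDl mulrA.
by apply: cvgD; [apply: cvgMr|]; exact: coupling_cvg.
Qed.

Lemma couplingB (x y : c0 R) : h (x - y) = h x - h y.
Proof. by rewrite addrC -scaleN1r coupling_lin mulN1r addrC. Qed.

Lemma coupling_scalar : scalar h.
Proof. by move=> k x y; rewrite coupling_lin. Qed.

Lemma coupling_bound : exists2 A : R, 0 < A & forall x, cabs (h x) <= A * c0_rnorm x.
Proof.
have [A A0 aA] := abs_summable_bound; exists A => // x.
apply: rcvg_le (ccvg_cabs (@coupling_cvg x)) _ => L.
apply: le_trans (cabs_sum _ _ _) _.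
apply: (@le_trans _ _ (c0_rnorm x * \sum_(0 <= n < L) cabs (a n))).
  by rewrite mulr_sumr; apply: ler_sum => n _; rewrite cabsM ler_wpM2r ?cabs_ge0 ?c0_rnorm_ge.
by rewrite mulrC ler_wpM2r ?c0_rnorm_ge0.
Qed.

Lemma continuous_coupling : continuous (h : c0 R -> C).
Proof.
have [A A0 hA] := coupling_bound.
move=> x U /nbhs_ballP[e /= e0 eU].
have eR : e = (complex.Re e)%:C by rewrite RRe_real// realE ltW.
have er0 : 0 < complex.Re e by rewrite -ltcR -eR.
apply/nbhs_ballP; exists (complex.Re e / A)%:C => /=; first by rewrite ltcR divr_gt0.
move=> y; rewrite -ball_normE /= c0_rnormE ltcR => xy; apply: eU.
rewrite -ball_normE /= cabsE eR ltcR -couplingB.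
by apply: le_lt_trans (hA _) _; rewrite mulrC -ltr_pdivlMr.
Qed.

Hypothesis a_le1 : forall z : C, cabs z <= 1 -> cabs (wiener_fun a z) <= 1.

(** The set of the x with |h x| <= 1 is closed and convex, and h takes on the
    geometric sequence of ratio l the value of the power series at l. *)
Lemma S0_le1 x : S0 R x -> cabs (h x) <= 1.
Proof.
move=> /(_ [set x | cabs (h x) <= 1]); apply; split; first split.
- have -> : [set x | cabs (h x) <= 1] = (fun x => cabs (h x)) @^-1` [set t : R | t <= 1] by [].
  apply: closed_comp; last exact: closed_le.
  move=> z _; apply: continuous_comp; first exact: continuous_coupling.
  by apply: continuous_contraction => z' w; exact: cabs_dist_dist.
- move=> u v t; rewrite !inE /= => u1 v1.
  rewrite [_ <| _ |> _](_ : _ = t%:num *: u + (1 - t%:num) *: v)//.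
  rewrite coupling_lin -[(1 - _) *: v]addr0 coupling_lin.
  have h00 : h 0 = 0 by rewrite -(subrr u) couplingB subrr.
  rewrite h00 addr0; apply: le_trans (cabsD _ _) _; rewrite !cabsM.
  have t0 : 0 <= t%:num by [].
  have t1 : t%:num <= 1 by [].
  have tE : t%:num = (complex.Re t%:num)%:C by rewrite RRe_real// realE t0.
  have E1 : 1 - t%:num = (1 - complex.Re t%:num)%:C by rewrite rmorphB /= -tE.
  rewrite E1 {1}tE !cabs_real.
  move: t0 t1; rewrite tE -(rmorph0 (real_complex R)) -(rmorph1 (real_complex R)) !lecR => t0 t1.
  rewrite !ger0_norm ?subr_ge0//; nra.
move=> {}x [l l1 xl] /=.
have l1' : cabs l <= 1 by rewrite ltW// -ltcR -cabsE.
have -> : h x = wiener_fun a l; last exact: a_le1.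
rewrite /coupling /wiener_fun; congr (limn (series _)).
by apply/funext => n; rewrite xl mulrC.
Qed.

End functional.

Section convexity.
Local Open Scope convex_scope.

Lemma convex_midpoint (K : numFieldType) (V : lmodType K) (B : set (convex_lmodType V)) (x y : V) :
  convex_set B -> B x -> B y -> B (2^-1 *: (x + y)).
Proof.
move=> cB Bx By.
have h0 : 0 <= 2^-1 :> K by rewrite invr_ge0.
have h1 : 2^-1 <= 1 :> K by rewrite invf_le1// ler1n.
have := cB x y (Itv01 h0 h1); rewrite !inE => /(_ Bx By).
rewrite [_ <| _ |> _](_ : _ = 2^-1 *: x + (1 - 2^-1) *: y)//.
by rewrite scalerDr [1 - _](_ : _ = 2^-1)//; rewrite {1}[1]splitr mul1r addrK.
Qed.

(** Averages of 2 ^ N points are obtained by N midpoints. *)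
Lemma convex_average (K : numFieldType) (V : lmodType K) (B : set (convex_lmodType V)) N (s : seq V) :
  convex_set B -> size s = (2 ^ N)%N -> (forall x, x \in s -> B x) ->
  B (2^-1 ^+ N *: \sum_(x <- s) x).
Proof.
move=> cB; elim: N s => [|N IH] s sN sB.
  case: s sN sB => [|x [|]]// _ sB; rewrite big_seq1 expr0 scale1r; apply: sB.
  by rewrite mem_head.
rewrite -(cat_take_drop (2 ^ N) s) big_cat /= exprS -scalerA scalerDr.
apply: (@convex_midpoint _ V B) => //.
  apply: IH => [|x xs]; last by apply: sB; exact: mem_take xs.
  by rewrite size_take sN ltn_exp2l// ltnS leqnn.
apply: IH => [|x xs]; last by apply: sB; exact: mem_drop xs.
by rewrite size_drop sN expnS mul2n -addnn addnK.
Qed.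

End convexity.

(** * The moment sequence as a support point *)

Section moment_point.
Variables (R : realType) (xi : R).
Hypothesis xi01 : 0 < xi < 2^-1.
Local Notation C := R[i].
Local Notation cabs := (@cabs R).
Local Notation ci := (cantor_intervals xi).
Local Notation cantor_ft := (cantor_ft xi01).
Hypothesis cantor_ft0 : (fun n : nat => cantor_ft n%:R) @ \oo --> (0 : C).

Fact moments_c0 : (fun n : nat => cantor_ft n%:R) \in @c0_pred R.
Proof. exact/c0_predP. Qed.

Definition moments : c0 R := C0 moments_c0.

Fact geometric_c0 (z : C) : cabs z < 1 -> (fun n => z ^+ n) \in @c0_pred R.
Proof.
move=> z1; apply/c0_predP/ccvgP => e e0.
have [||N HN] := @expr_lt_eps R (cabs z) e => //; first by rewrite cabs_ge0.
by exists N => n /HN; rewrite subr0 cabsX.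
Qed.

Lemma exp_mean_unif J (e : R) : 0 < e ->
  exists N, forall n, (n < J)%N -> cabs (cantor_ft n%:R - exp_mean xi N n%:R) < e.
Proof.
move=> e0.
suff [N HN] : exists N, forall N', (N <= N')%N -> forall n, (n < J)%N ->
    cabs (cantor_ft n%:R - exp_mean xi N' n%:R) < e.
  by exists N => n; apply: HN.
elim: J => [|J [N HN]]; first by exists 0%N.
have /ccvgP/(_ _ e0)[M HM] := @exp_mean_cvg R xi xi01 J%:R.
exists (maxn N M) => N'; rewrite geq_max => /andP[NN' MN'] n.
rewrite ltnS leq_eqVlt => /predU1P[->|]; last exact: HN.
by rewrite cabsB; exact: HM.
Qed.

Lemma exp_mean_pow N (n : nat) : exp_mean xi N n%:R = (2^-1 ^+ N)%:C * \sum_(I <- ci N) cexp I.1 ^+ n.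
Proof. by rewrite /exp_mean; congr (_ * _); apply: eq_bigr => I _; rewrite cexpMn. Qed.

Lemma bernoulli (d : R) n : 0 <= d <= 1 -> 1 - d *+ n <= (1 - d) ^+ n.
Proof.
move=> /andP[d0 d1]; elim: n => [|n IH]; first by rewrite expr0 mulr0n subr0.
rewrite exprS mulrS; have : 0 <= d *+ n by rewrite mulrn_wge0.
have : 0 <= 1 - d by lra.
set x := d *+ n in IH *; set p := _ ^+ n in IH * => h1 h2.
have : (1 - d) * (1 - x) <= (1 - d) * p by rewrite ler_wpM2l.
nra.
Qed.

(** The sequence of the numbers r ^ n times the transform of the uniform
    probability on left endpoints is an average of geometric sequences of ratio
    r t with |t| = 1.  Choosing r close to 1, then the generation N large, brings
    it close to the moments: for large n both are small, the moments by the
    Rajchman property and the averages thanks to r ^ n. *)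
Lemma moments_S0 : S0 R moments.
Proof.
move=> B [[cB vB] AB]; apply: cB => U /nbhs_ballP[e /= e0 eU].
have eR : e = (complex.Re e)%:C by rewrite RRe_real// realE ltW.
have er0 : 0 < complex.Re e by rewrite -ltcR -eR.
pose d := complex.Re e / 4; have d0 : 0 < d by rewrite divr_gt0.
have /ccvgP/(_ _ d0)[K HK] := cantor_ft0.
(* The radius r = 1 - t satisfies r ^ K >= 1 - d, by the Bernoulli inequality. *)
pose t := Num.min 2^-1 (d / K.+1%:R).
have t0 : 0 < t by rewrite lt_min invr_gt0 ltr0n divr_gt0.
have t2 : t <= 2^-1 by rewrite ge_min lexx.
have tK : t *+ K <= d.
  rewrite -mulr_natr; apply: (@le_trans _ _ (d / K.+1%:R * K.+1%:R)); last by rewrite divfK.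
  by rewrite ler_pM ?(ltW t0)// ?ler_nat// ge_min lexx orbT.
pose r := 1 - t; have r0 : 0 <= r by rewrite /r; lra.
have r1 : r < 1 by rewrite /r; lra.
have rn n : 0 <= r ^+ n <= 1 by rewrite exprn_ge0// exprn_ile1// ltW.
have rK n : (n < K)%N -> 1 - r ^+ n <= d.
  move=> nK; have t01 : 0 <= t <= 1 by rewrite ltW//=; lra.
  have := bernoulli n t01; rewrite -/r.
  have : t *+ n <= t *+ K by apply: ler_wpMn2l; rewrite ?ltW// ltnW.
  lra.
have [||J HJ] := @expr_lt_eps R r (d / 2); [by rewrite r0|by rewrite divr_gt0|].
have [N HN] := exp_mean_unif J d0.
have lz x : cabs (r%:C * cexp x) < 1 by rewrite cabsM cabs_cexp mulr1 cabs_real ger0_norm.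
pose pt (I : R * R) : c0 R := C0 (geometric_c0 (lz I.1)).
pose b := (2^-1 : C) ^+ N *: \sum_(x <- map pt (ci N)) x.
exists b; split.
  apply: (@convex_average C (c0 R)) => //; first by rewrite size_map size_cantor_intervals.
  move=> _ /mapP[I _ ->]; apply: AB; exists (r%:C * cexp I.1) => //.
  by rewrite cabsE ltcR.
apply: eU; rewrite -ball_normE /= c0_rnormE eR ltcR.
apply: (@le_lt_trans _ _ (3 * d)); last by rewrite /d; lra.
apply: c0_rnorm_le => n.
have bE : b n = (r ^+ n)%:C * exp_mean xi N n%:R.
  have sumE (s : seq (c0 R)) : (\sum_(x <- s) x : c0 R) n = \sum_(x <- s) x n.
    elim: s => [|x s IH]; first by rewrite !big_nil.
    by rewrite !big_cons -IH.
  rewrite /b [LHS](_ : _ = (2^-1) ^+ N * (\sum_(x <- map pt (ci N)) x : c0 R) n)//.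
  rewrite sumE big_map exp_mean_pow !rmorphXn /= fmorphV rmorph_nat mulrCA; congr (_ * _).
  by rewrite mulr_sumr; apply: eq_bigr => I _; rewrite /= exprMn.
rewrite [X in cabs X](_ : _ = cantor_ft n%:R - (r ^+ n)%:C * exp_mean xi N n%:R); last by rewrite -bE.
have -> : cantor_ft n%:R - (r ^+ n)%:C * exp_mean xi N n%:R =
    (1 - r ^+ n)%:C * cantor_ft n%:R + (r ^+ n)%:C * (cantor_ft n%:R - exp_mean xi N n%:R).
  by rewrite rmorphB /=; ring.
apply: le_trans (cabsD _ _) _; rewrite !cabsM !cabs_real.
have /andP[rn0 rn1] := rn n.
rewrite !ger0_norm ?subr_ge0//.
have P1 := cabs_cantor_ft xi01 n%:R.
have h1 : (1 - r ^+ n) * cabs (cantor_ft n%:R) <= d.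
  have [nK|Kn] := ltnP n K.
    by have := rK n nK; have := cabs_ge0 (cantor_ft n%:R); nra.
  by have := HK n Kn; rewrite subr0; have := cabs_ge0 (cantor_ft n%:R); nra.
have h2 : r ^+ n * cabs (cantor_ft n%:R - exp_mean xi N n%:R) <= d.
  have [nJ|Jn] := ltnP n J.
    by have := HN n nJ; have := cabs_ge0 (cantor_ft n%:R - exp_mean xi N n%:R); nra.
  have := HJ n Jn; have := cabs_leB (cantor_ft n%:R) (exp_mean xi N n%:R).
  have := cabs_exp_mean xi N n%:R; have := cabs_ge0 (cantor_ft n%:R - exp_mean xi N n%:R); nra.
lra.
Qed.

Lemma ccvg_sum (T : eqType) (s : seq T) (f : T -> nat -> C) (g : T -> C) :
  (forall i, i \in s -> f i @ \oo --> g i) ->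
  (fun n => \sum_(i <- s) f i n) @ \oo --> \sum_(i <- s) g i.
Proof.
elim: s => [|i s IH] fg.
  by under eq_fun do rewrite big_nil; rewrite big_nil; exact: cvg_cst.
under eq_fun do rewrite big_cons; rewrite big_cons; apply: cvgD.
  by apply: fg; rewrite mem_head.
by apply: IH => k ks; apply: fg; rewrite inE ks orbT.
Qed.

(** The moments are limits of means over left endpoints, at which the power
    series takes the value 1. *)
Lemma coupling_moments (a : nat -> C) : abs_summable a ->
  (forall z, cantor_circle_set xi z -> wiener_fun a z = 1) -> coupling a moments = 1.
Proof.
move=> aS a1; have [A A0 aA] := abs_summable_bound aS.
apply: (ccvg_unique (@coupling_cvg _ _ aS moments)); apply/ccvgP => e e0.
pose d := e / 4; have d0 : 0 < d by rewrite divr_gt0.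
have [K HK] := abs_summable_tail aS d0.
have [N HN] := @exp_mean_unif K (d / A) (divr_gt0 d0 A0).
have : series (fun n => exp_mean xi N n%:R * a n) @ \oo --> (1 : C).
  have -> : series (fun n => exp_mean xi N n%:R * a n) =
      (fun L => (2^-1 ^+ N)%:C * \sum_(I <- ci N) series (fun n => a n * cexp I.1 ^+ n) L).
    apply/funext => L; rewrite /series /= exchange_big /= mulr_sumr; apply: eq_bigr => n _.
    by rewrite exp_mean_pow -mulrA mulr_suml; congr (_ * _); apply: eq_bigr => I _; rewrite mulrC.
  have E : (2^-1 ^+ N)%:C * \sum_(I <- ci N) (1 : C) = 1.
    rewrite big_const_seq count_predT size_cantor_intervals iter_addr_0 natrX.
    by rewrite rmorphXn /= fmorphV rmorph_nat exprVn mulVf// expf_neq0// pnatr_eq0.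
  rewrite -E; apply: cvgMr; apply: ccvg_sum => I IN.
  rewrite -(a1 (cexp I.1)); last by exists I.1 => //; exact: cantor_left_in IN.
  by apply: wiener_cvg => //; rewrite cabs_cexp.
move=> /ccvgP/(_ _ d0)[L HL]; exists (maxn K L) => n; rewrite geq_max => /andP[Kn Ln].
have := HL n Ln; set S := series _ n; set T := series _ n => hS.
suff : cabs (T - S) <= 3 * d.
  have := cabs_distD T S 1; rewrite /d in hS *; lra.
rewrite /T /S /series /= -sumrB (@big_cat_nat _ _ _ K)//=.
apply: le_trans (cabsD _ _) _.
have h1 : cabs (\sum_(0 <= i < K) (cantor_ft i%:R * a i - exp_mean xi N i%:R * a i)) <= d.
  apply: le_trans (cabs_sum _ _ _) _.
  apply: (@le_trans _ _ (\sum_(0 <= i < K) d / A * cabs (a i))).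
    rewrite big_nat_cond [leRHS]big_nat_cond; apply: ler_sum => i /andP[/andP[_ iK] _].
    by rewrite -mulrBl cabsM ler_wpM2r ?cabs_ge0// ltW// HN.
  by rewrite -mulr_sumr mulrAC ler_pdivrMr// ler_pM2l.
have h2 : cabs (\sum_(K <= i < n) (cantor_ft i%:R * a i - exp_mean xi N i%:R * a i)) <= 2 * d.
  apply: le_trans (cabs_sum _ _ _) _.
  apply: (@le_trans _ _ (\sum_(K <= i < n) 2 * cabs (a i))).
    apply: ler_sum => i _; rewrite -mulrBl cabsM ler_wpM2r ?cabs_ge0//.
    have := cabs_leB (cantor_ft i%:R) (exp_mean xi N i%:R); have := cabs_cantor_ft xi01 i%:R.
    have := cabs_exp_mean xi N i%:R; lra.
  by rewrite -mulr_sumr ler_pM2l// ltW.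
lra.
Qed.

End moment_point.

(** * The main theorem *)

Section conclusion.
Variables (R : realType) (q : nat).
Hypotheses (oq : odd q) (q512 : (512 <= q)%N).
Let xi : R := 2 / q%:R.

Lemma xi_range : 0 < xi <= 256^-1.
Proof.
have q0 : 0 < q%:R :> R by rewrite ltr0n; apply: leq_trans q512.
have h : 512 <= q%:R :> R by rewrite (ler_nat R 512).
by rewrite /xi divr_gt0//= ler_pdivrMr//; lra.
Qed.

Lemma support_functional_exists : exists (a : nat -> R[i]) (y : c0 R),
    [/\ ell1 a, nontrivial a,
        modulus_support_functional (S0 R) (coupling a)
      & modulus_support_point (S0 R) (coupling a) y].
Proof.
have xi01 := xi_half xi_range.
have [a [aS a1 a2]] := peak_fun xi_range.
have P0 : (fun n : nat => cantor_ft xi01 n%:R) @ \oo --> (0 : R[i]) by exact: cantor_ft_cvg0.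
pose y := moments P0.
have hy : coupling a y = 1 by exact: coupling_moments.
have yS : S0 R y by exact: moments_S0.
have ale z : cabs z <= 1 -> cabs (wiener_fun a z) <= 1.
  move=> z1; have [/a1 ->|zE] := pselect (cantor_circle_set xi z); first by rewrite cabs1.
  have := a2 z; rewrite !cabsE -(rmorph1 (real_complex R)) lecR ltcR => /(_ z1 zE).
  exact: ltW.
have mp : modulus_support_point (S0 R) (coupling a) y.
  split=> //; split.
    move=> _ [x xS <-]; rewrite hy normr1 cabsE -(rmorph1 (real_complex R)) lecR.
    exact: (S0_le1 aS ale).
  by move=> u; apply; exists y.
exists a, y; split; [exact/ell1P| | |exact: mp].
  move=> [alpha aE].
  have wE z : cabs z <= 1 -> wiener_fun a z = alpha.
    move=> z1; apply: ccvg_unique (wiener_cvg aS z1) _; apply/ccvgP => e e0.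
    exists 1%N => -[//|n] _; rewrite /series /= aE big_nat_recl// expr0 mulr1.
    by rewrite big1 ?addr0 ?subrr ?cabs0// => i _; rewrite mul0r.
  have E1 : cantor_circle_set xi 1.
    by exists 0; [exact: cantor_set0|exact: cexp0].
  have al1 : alpha = 1 by rewrite -(wE 1) ?cabs1// a1.
  have := a2 0; rewrite normr0 ler01 => /(_ isT) h.
  have : `|wiener_fun a 0| < 1.
    apply: h => -[x _ /(congr1 (@cabs R))]; rewrite -/(cexp x) cabs_cexp cabs0.
    by apply/eqP; rewrite oner_eq0.
  by rewrite wE ?cabs0// al1 normr1 ltxx.
split.
- exact: coupling_scalar.
- exact: continuous_coupling.
- by exists y; rewrite hy oner_neq0.
- by exists y.
Qed.

Lemma cantor_rajchman_peak : 0 < xi < 2^-1 /\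
    exists sigma : probability (measurableTypeR R) R,
      [/\ is_cantor_measure xi sigma,
          rajchman (circle_image sigma),
          measure_support (circle_image sigma) = cantor_circle_set xi
        & peak_set (cantor_circle_set xi)].
Proof.
have xi01 := xi_half xi_range; split => //.
exists (cantor_measure xi01); split.
- exact: is_cantor.
- exact: rajchman_cantor.
- exact: support_cantor.
- exact: peak_cantor xi_range.
Qed.

End conclusion.

Theorem theorem4p1 (R : realType) :
  infinite_set [set xi : R |
    0 < xi < 2^-1 /\
    exists sigma : probability (measurableTypeR R) R,
      [/\ is_cantor_measure xi sigma,
          rajchman (circle_image sigma),
          measure_support (circle_image sigma) = cantor_circle_set xi
        & peak_set (cantor_circle_set xi)]] /\
  exists (a : nat -> R[i]) (y : c0 R),
    [/\ ell1 a, nontrivial a,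
        modulus_support_functional (S0 R) (coupling a)
      & modulus_support_point (S0 R) (coupling a) y].
Proof.
pose q n := (513 + n.*2)%N.
have oq n : odd (q n) by rewrite /q oddD odd_double.
have q512 n : (512 <= q n)%N by rewrite /q; lia.
split; last exact: support_functional_exists (oq 0%N) (q512 0%N).
pose f n : R := 2 / (q n)%:R.
move=> fin; apply: infinite_nat.
have finj : injective f.
  have two : (2 : R) != 0 by rewrite pnatr_eq0.
  move=> m n /(mulfI two)/invr_inj/eqP; rewrite eqr_nat /q eqn_add2l => /eqP.
  exact: double_inj.
have := finite_preimage _ fin => /(_ nat f) H.
apply: sub_finite_set (H _) => [n _ /=|]; first exact: cantor_rajchman_peak.
by move=> m n _ _; exact: finj.
Qed.
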